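(* Let $x,y,z\in\mathbb{R}$ and $t_0\in[0,2\pi)$, and put $$x_0=\frac{z^2}{3}(2\cos t_0+\cos 2t_0),\qquad y_0=\frac{z^2}{3}(2\sin t_0-\sin 2t_0),\qquad V=-\frac{(x-x_0)+\mathrm{i}(y-y_0)}{3\gamma},$$ where $\gamma=(2/3)^{2/3}$. Let $V^*$ be the complex conjugate of $V$, let $\sqrt{2\mathrm{i}\gamma z}$ denote any fixed square root of $2\mathrm{i}\gamma z$, and set $s=\mathrm{e}^{-\mathrm{i}t_0/2}\sqrt{2\mathrm{i}\gamma z}$ and $s'=\mathrm{e}^{\mathrm{i}t_0/2}\sqrt{2\mathrm{i}\gamma z}$. Then the integral below is absolutely convergent and $$E(x,y,z)=\frac{\gamma\sqrt{\pi}}{2}\exp\Bigl(\frac{\mathrm{i}z}{3}[x\cos t_0+y\sin t_0]-\frac{\mathrm{i}z^3}{27}[3+\cos 3t_0]\Bigr)\int_{\mathbb{R}}\mathrm{e}^{-t^2}\Bigl\{\mathrm{Ai}(V+ts)\,\mathrm{Bi}(V^*+ts')+\mathrm{Ai}(V^*+ts')\,\mathrm{Bi}(V+ts)\Bigr\}\,\mathrm{d}t .$$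
   Context: $\mathrm{Ai},\mathrm{Bi}$ are the Airy functions (entire functions of a complex variable). For real $x,y,z$ the elliptic umbilic integral is $$E(x,y,z)=\frac{1}{2\pi}\iint_{\mathbb{R}^2}\exp\bigl\{-\mathrm{i}(x\xi+y\eta)-\mathrm{i}z(\xi^2+\eta^2)+\mathrm{i}(\xi^3-3\xi\eta^2)\bigr\}\,\mathrm{d}\xi\,\mathrm{d}\eta ,$$ understood as an oscillatory integral, i.e. as the limit $\varepsilon\to0^+$ of the integral with the additional factor $\mathrm{e}^{-\varepsilon(\xi^2+\eta^2)}$. *)

(* Defs.v *)
From HB Require Import structures.
From mathcomp Require Import all_boot all_order all_algebra.
From mathcomp Require Import complex.
From mathcomp Require Import all_classical all_reals all_analysis.

Set Implicit Arguments.
Unset Strict Implicit.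
Unset Printing Implicit Defensive.

Import Order.TTheory GRing.Theory Num.Theory.
Import numFieldNormedType.Exports.

Local Open Scope classical_set_scope.
Local Open Scope ring_scope.
Local Open Scope complex_scope.

(* Limits of complex-valued functions are taken in the regular module R[i]^o
   over the numFieldType R[i], whose topology is that of the modulus. *)

Definition cexp (R : realType) (w : R[i]) : R[i] :=
  (expR (complex.Re w) * cos (complex.Im w))
  +i* (expR (complex.Re w) * sin (complex.Im w)).

(* Absolute (Lebesgue) integrability of a complex-valued function: it is
   measurable and its modulus has a finite integral. *)
Definition cintegrable (d : measure_display) (T : measurableType d)
    (R : realType) (mu : {measure set T -> \bar R}) (D : set T)
    (f : T -> R[i]) : Prop :=
  [/\ measurable_fun D (fun u => complex.Re (f u)),
      measurable_fun D (fun u => complex.Im (f u))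
    & (\int[mu]_(u in D) (Normc.normc (f u))%:E < +oo)%E].

(* Meaningful when cintegrable holds; Rintegral is a total function. *)
Definition cintegral (d : measure_display) (T : measurableType d)
    (R : realType) (mu : {measure set T -> \bar R}) (D : set T)
    (f : T -> R[i]) : R[i] :=
  Rintegral mu D (fun u => complex.Re (f u))
  +i* Rintegral mu D (fun u => complex.Im (f u)).

(* Euler's integral, for a > 0. *)
Definition Gamma (R : realType) (a : R) : R :=
  \int[@lebesgue_measure R]_(t in `]0, +oo[) (t `^ (a - 1) * expR (- t)).

(* The two Maclaurin series solving w'' = z w with (w(0), w'(0)) equal to
   (1, 0) and (0, 1):
     f(z) = sum_k 1.4...(3k-2) / (3k)!   z^(3k),
     g(z) = sum_k 2.5...(3k-1) / (3k+1)! z^(3k+1). *)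
Definition airy_f (R : realType) (w : R[i]) : R[i] :=
  limn (series (fun k : nat =>
    (\prod_(j < k) (3 * j + 1))%N%:R / ((3 * k)`!)%:R * w ^+ (3 * k))
    : nat -> R[i]^o).

Definition airy_g (R : realType) (w : R[i]) : R[i] :=
  limn (series (fun k : nat =>
    (\prod_(j < k) (3 * j + 2))%N%:R / ((3 * k + 1)`!)%:R * w ^+ (3 * k + 1))
    : nat -> R[i]^o).

(* Ai(0) and - Ai'(0); moreover Bi(0) = sqrt 3 Ai(0) and
   Bi'(0) = - sqrt 3 Ai'(0). *)
Definition airy_c1 (R : realType) : R := (3 `^ (2 / 3) * Gamma (2 / 3))^-1.
Definition airy_c2 (R : realType) : R := (3 `^ (1 / 3) * Gamma (1 / 3))^-1.

Definition Ai (R : realType) (w : R[i]) : R[i] :=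
  (airy_c1 R)%:C * airy_f w - (airy_c2 R)%:C * airy_g w.

Definition Bi (R : realType) (w : R[i]) : R[i] :=
  (Num.sqrt 3)%:C * ((airy_c1 R)%:C * airy_f w + (airy_c2 R)%:C * airy_g w).

(* The elliptic umbilic integral with the convergence factor
   exp (- eps (xi^2 + eta^2)), a Lebesgue integral over the plane. *)
Definition umbilic_reg (R : realType) (x y z eps : R) : R[i] :=
  ((2 * pi)^-1)%:C *
  cintegral (@lebesgue_measure R \x @lebesgue_measure R)%E setT
    (fun p : R * R =>
       let xi := p.1 in let eta := p.2 in
       cexp (- (x * xi + y * eta)*i - (z * (xi ^+ 2 + eta ^+ 2))*i
             + (xi ^+ 3 - 3 * xi * eta ^+ 2)*i)
       * (expR (- (eps * (xi ^+ 2 + eta ^+ 2))))%:C).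

Definition umbilic_cvg (R : realType) (x y z : R) : Prop :=
  cvg ((umbilic_reg x y z eps : R[i]^o) @[eps --> 0^'+]).

Definition umbilic (R : realType) (x y z : R) : R[i] :=
  lim ((umbilic_reg x y z eps : R[i]^o) @[eps --> 0^'+]).

Definition gam (R : realType) : R := (2 / 3) `^ (2 / 3).

(* Main.v *)
Require Import Defs.
From mathcomp Require Import all_boot all_order all_algebra.
From mathcomp Require Import complex ring lra zify.
From mathcomp Require Import all_classical all_reals all_analysis.
From mathcomp Require Import measurable_realfun.

Import Order.TTheory GRing.Theory Num.Theory.
Import numFieldNormedType.Exports.

Local Open Scope classical_set_scope.
Local Open Scope ring_scope.
Local Open Scope complex_scope.

(* Write a = eps + i z, X = x + i y, Y = x - i y and zeta = xi + i eta. The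
   moments of conj(zeta)^m zeta^n against the regularised umbilic integrand
   depend on (a, X, Y); integration by parts expresses all of them by the four
   with m, n <= 1, so these four satisfy a linear differential system along every
   path of parameters. Since Ai V Bi W + Ai W Bi V is a combination of f V f W and
   g V g W, where f and g are the Maclaurin solutions of U'' = w U, the right-hand
   side splits into two integrals, and Gaussian integration by parts in t shows
   that each of them, with its derivatives in X and Y, satisfies the same system
   along every path on which a = b^2. By uniqueness it suffices to compare the
   two sides for X = Y = 0 and real a > 0.

   There the zeroth moment L satisfies L'' = (4/9) a (a L' + L), is bounded, and
   a L -> pi at infinity, which characterises it as sqrt pi times
   D a = integral of exp (- v^2 (v^2 + a)^2), an integral that still makes sense
   at a = 0. Comparing initial values at a = 0 leaves D 0 and D' 0, that is
   Gamma (1/6) and Gamma (5/6), to be expressed by Gamma (1/3) and Gamma (2/3): this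
   is the duplication formula together with Gamma (1/3) Gamma (2/3) = 2 pi / sqrt 3.
   Finally eps -> 0 on both sides. *)

Set Implicit Arguments.
Unset Strict Implicit.
Unset Printing Implicit Defensive.

Local Notation Re := complex.Re.
Local Notation Im := complex.Im.
Local Notation normc := Normc.normc.

(** * Complex-valued calculus and integration *)

Section ComplexCalculus.
Context {R : realType}.
Implicit Types (w v : R[i]) (F G : R -> R[i]) (x : R).

(** The closed form originates in an expansion of the phase with zeta and conj(zeta) taken as
    independent variables. Put tau = exp (i t0). At zeta = i a tau / 3, conj(zeta) = i a / (3 tau)
    the quadratic part of the phase is the perfect square - (a / 2) (tau^(-1/2) conj(zeta) +
    tau^(1/2) zeta)^2. One Gaussian variable t linearises this square, with a slope proportional to
    sqrt a, and the rest separates into cubics in zeta and in conj(zeta), hence a product of Airy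
    functions. The value of the phase at that point gives the exponent in front, its gradient gives
    V and conj V. For a = i z the point is the degenerate critical point - (z / 3) tau of the phase
    at (x0, y0), which lies on the caustic. The separation is only formal because zeta and
    conj(zeta) are not independent on the real plane; uniqueness for a linear system replaces it.
    The angle t0 is free since it drops out at a = X = Y = 0. There the Airy side is explicit but
    the plane integral does not converge absolutely, so its initial values have to be reached from
    large real a. *)

Lemma ReD w v : Re (w + v) = Re w + Re v. Proof. by case: w v => a b []. Qed.
Lemma ImD w v : Im (w + v) = Im w + Im v. Proof. by case: w v => a b []. Qed.
Lemma ReN w : Re (- w) = - Re w. Proof. by case: w. Qed.
Lemma ImN w : Im (- w) = - Im w. Proof. by case: w. Qed.
Lemma ReB w v : Re (w - v) = Re w - Re v. Proof. by rewrite ReD ReN. Qed.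
Lemma ImB w v : Im (w - v) = Im w - Im v. Proof. by rewrite ImD ImN. Qed.
Lemma ReM w v : Re (w * v) = Re w * Re v - Im w * Im v.
Proof. by case: w v => a b []. Qed.
Lemma ImM w v : Im (w * v) = Re w * Im v + Im w * Re v.
Proof. by case: w v => a b []. Qed.
Lemma complexP w v : Re w = Re v -> Im w = Im v -> w = v.
Proof. by case: w v => a b [c d] /= -> ->. Qed.

Lemma normcDE w : normc w = Num.sqrt (Re w ^+ 2 + Im w ^+ 2). Proof. by case: w. Qed.
Lemma normc_ge0 w : 0 <= normc w. Proof. by rewrite normcDE sqrtr_ge0. Qed.
Lemma normc_normr w : `|w| = (normc w)%:C. Proof. by []. Qed.
Lemma normr_Re_le w : `|Re w| <= normc w.
Proof. by rewrite normcDE -sqrtr_sqr ler_wsqrtr// lerDl sqr_ge0. Qed.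
Lemma normr_Im_le w : `|Im w| <= normc w.
Proof. by rewrite normcDE -sqrtr_sqr ler_wsqrtr// lerDr sqr_ge0. Qed.
Lemma normc_le_ReIm w : normc w <= `|Re w| + `|Im w|.
Proof.
rewrite normcDE -(@ler_pXn2r _ 2)// ?nnegrE ?sqrtr_ge0 ?addr_ge0//.
rewrite sqr_sqrtr ?addr_ge0 ?sqr_ge0// sqrrD !real_normK ?num_real//.
by rewrite lerD2r lerDl mulrn_wge0// mulr_ge0.
Qed.
Lemma normcX w n : normc (w ^+ n) = normc w ^+ n.
Proof. by elim: n => [|n IH]; rewrite ?expr0 ?Normc.normc1// !exprS Normc.normcM IH. Qed.
Lemma normcR x : normc x%:C = `|x|.
Proof. by rewrite normcDE /= expr0n /= addr0 sqrtr_sqr. Qed.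
Lemma normc_sqr w : normc w ^+ 2 = Re w ^+ 2 + Im w ^+ 2.
Proof. by rewrite normcDE sqr_sqrtr// addr_ge0// sqr_ge0. Qed.
Lemma le_normcB w v : normc (w - v) <= normc w + normc v.
Proof. by rewrite (le_trans (le_normcD _ _))// normcN. Qed.

Lemma cexpD w v : cexp (w + v) = cexp w * cexp v.
Proof.
by apply: complexP; rewrite /cexp ?ReM ?ImM /= ReD ImD expRD ?cosD ?sinD; ring.
Qed.
Lemma cexp0 : cexp (0 : R[i]) = 1.
Proof. by apply: complexP; rewrite /cexp /= expR0 ?cos0 ?sin0; ring. Qed.
Lemma cexpN w : cexp w * cexp (- w) = 1.
Proof. by rewrite -cexpD subrr cexp0. Qed.
Lemma normc_cexp w : normc (cexp w) = expR (Re w).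
Proof.
rewrite normcDE /cexp /= !exprMn -mulrDr cos2Dsin2 mulr1 sqrtr_sqr ger0_norm//.
Qed.
Lemma cexpR x : cexp x%:C = (expR x)%:C.
Proof. by apply: complexP; rewrite /cexp /= ?cos0 ?sin0; ring. Qed.
Lemma cexp_neq0 w : cexp w != 0.
Proof.
apply/eqP => h; have := normc_cexp w; rewrite h Normc.normc0 => /esym /eqP.
by rewrite gt_eqF ?expR_gt0.
Qed.
Lemma cexpX w n : cexp w ^+ n = cexp (w *+ n).
Proof. by elim: n => [|n IH]; rewrite ?expr0 ?mulr0n ?cexp0// exprS mulrS cexpD IH. Qed.

(** The variable is real and the derivative componentwise, so that real calculus applies to both
    components; holomorphy enters only later, as the chain rule [cdiff]. *)
Definition cderiv F x w :=
  is_derive x 1 (fun u => Re (F u)) (Re w) /\ is_derive x 1 (fun u => Im (F u)) (Im w).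

Lemma is_derive_transport (f g : R -> R) x (d e : R) :
  is_derive x 1 f d -> f =1 g -> d = e -> is_derive x 1 g e.
Proof. by move=> h /funext <- <-. Qed.

Lemma cderiv_transport F x w v : cderiv F x w -> w = v -> cderiv F x v.
Proof. by move=> + <-. Qed.

Lemma cderiv_ext F G x w : F =1 G -> cderiv F x w -> cderiv G x w.
Proof. by move=> /funext ->. Qed.

Lemma cderiv_cst w x : cderiv (fun=> w) x 0.
Proof. by split; exact: is_derive_cst. Qed.

Lemma cderiv_real (f : R -> R) x d : is_derive x 1 f d -> cderiv (fun u => (f u)%:C) x d%:C.
Proof. by move=> h; split=> //=; exact: is_derive_cst. Qed.

Lemma cderiv_id x : cderiv (fun u => u%:C) x 1.
Proof. apply: cderiv_real; exact: is_derive_id. Qed.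

Lemma cderivD F G x w v : cderiv F x w -> cderiv G x v ->
  cderiv (fun u => F u + G u) x (w + v).
Proof.
move=> [a b] [c d]; split.
  by apply: (is_derive_transport (is_deriveD a c)) => [u|]; rewrite /= ReD.
by apply: (is_derive_transport (is_deriveD b d)) => [u|]; rewrite /= ImD.
Qed.

Lemma cderivN F x w : cderiv F x w -> cderiv (fun u => - F u) x (- w).
Proof.
move=> [a b]; split.
  by apply: (is_derive_transport (is_deriveN a)) => [u|]; rewrite /= ReN.
by apply: (is_derive_transport (is_deriveN b)) => [u|]; rewrite /= ImN.
Qed.

Lemma cderivB F G x w v : cderiv F x w -> cderiv G x v ->
  cderiv (fun u => F u - G u) x (w - v).
Proof. by move=> a b; apply: cderivD => //; exact: cderivN. Qed.

Lemma cderivM F G x w v : cderiv F x w -> cderiv G x v ->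
  cderiv (fun u => F u * G u) x (w * G x + F x * v).
Proof.
move=> [a b] [c d]; split.
  apply: (is_derive_transport (is_deriveB (is_deriveM a c) (is_deriveM b d))).
    by move=> u; rewrite ReM.
  by rewrite ReD !ReM /GRing.scale /=; ring.
apply: (is_derive_transport (is_deriveD (is_deriveM a d) (is_deriveM b c))).
  by move=> u; rewrite ImM.
by rewrite ImD !ImM /GRing.scale /=; ring.
Qed.

Lemma cderivZ F x w v : cderiv F x w -> cderiv (fun u => v * F u) x (v * w).
Proof.
move=> h; apply: (cderiv_transport (cderivM (cderiv_cst v x) h)).
by rewrite mul0r add0r.
Qed.

Lemma cderiv_cexp F x w : cderiv F x w ->
  cderiv (fun u => cexp (F u)) x (w * cexp (F x)).
Proof.
move=> [a b].
have e := @is_derive1_comp _ _ _ _ _ _ (is_derive_expR _) a.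
have c := @is_derive1_comp _ _ _ _ _ _ (is_derive_cos _) b.
have s := @is_derive1_comp _ _ _ _ _ _ (is_derive_sin _) b.
split.
  apply: (is_derive_transport (is_deriveM e c)) => //.
  by rewrite ReM /cexp /GRing.scale /=; ring.
apply: (is_derive_transport (is_deriveM e s)) => //.
by rewrite ImM /cexp /GRing.scale /=; ring.
Qed.

Lemma cderiv_expR (f : R -> R) x d : is_derive x 1 f d ->
  cderiv (fun u => (expR (f u))%:C) x (d * expR (f x))%:C.
Proof.
move=> h; apply: cderiv_real; rewrite mulrC.
exact: (is_derive1_comp (is_derive_expR _) h).
Qed.

Lemma cderiv_Re_continuous F x w : cderiv F x w -> {for x, continuous (fun u => Re (F u))}.
Proof. by move=> [[h _] _]; apply/differentiable_continuous/derivable1_diffP. Qed.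
Lemma cderiv_Im_continuous F x w : cderiv F x w -> {for x, continuous (fun u => Im (F u))}.
Proof. by move=> [_ [h _]]; apply/differentiable_continuous/derivable1_diffP. Qed.

End ComplexCalculus.

(** * Integrals of complex-valued functions, linearity and differentiation under the integral *)

Section ComplexIntegral.
Context {R : realType} {d : measure_display} {T : measurableType d}.
Variable mu : {measure set T -> \bar R}.
Implicit Types (f g : T -> R[i]) (w : R[i]).

Definition cmeasurable f :=
  measurable_fun setT (fun u => Re (f u)) /\ measurable_fun setT (fun u => Im (f u)).

Lemma cmeasurable_cst w : cmeasurable (fun=> w).
Proof. by split; exact: measurable_cst. Qed.

Lemma cmeasurableD f g : cmeasurable f -> cmeasurable g -> cmeasurable (fun u => f u + g u).
Proof.
move=> [a b] [c e]; split.
  by under eq_fun do rewrite ReD; exact: measurable_funD.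
by under eq_fun do rewrite ImD; exact: measurable_funD.
Qed.

Lemma cmeasurableM f g : cmeasurable f -> cmeasurable g -> cmeasurable (fun u => f u * g u).
Proof.
move=> [a b] [c e]; split.
  by under eq_fun do rewrite ReM; apply: measurable_funB;
    exact: measurable_funM.
by under eq_fun do rewrite ImM; apply: measurable_funD;
  exact: measurable_funM.
Qed.

Lemma cmeasurableN f : cmeasurable f -> cmeasurable (fun u => - f u).
Proof.
move=> mf; under eq_fun do rewrite -mulN1r.
by apply: cmeasurableM => //; exact: cmeasurable_cst.
Qed.

Lemma cmeasurableX f n : cmeasurable f -> cmeasurable (fun u => f u ^+ n).
Proof.
move=> mf; elim: n => [|n IH]; first exact: cmeasurable_cst.
by under eq_fun do rewrite exprS; exact: cmeasurableM.
Qed.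

Lemma cmeasurable_cexp f : cmeasurable f -> cmeasurable (fun u => cexp (f u)).
Proof.
move=> [a b]; split; apply: measurable_funM.
- exact: measurableT_comp.
- by apply: measurableT_comp b; apply: continuous_measurable_fun; exact: continuous_cos.
- exact: measurableT_comp.
- by apply: measurableT_comp b; apply: continuous_measurable_fun; exact: continuous_sin.
Qed.

Lemma measurable_normc f : cmeasurable f -> measurable_fun setT (fun u => normc (f u)).
Proof.
move=> [a b]; under eq_fun do rewrite normcDE.
apply: (measurableT_comp (continuous_measurable_fun (@sqrt_continuous R))).
by apply: measurable_funD; exact: measurable_funX.
Qed.

Lemma cintegrableP f : cintegrable mu setT f <->
  mu.-integrable setT (EFin \o (fun u => Re (f u))) /\
  mu.-integrable setT (EFin \o (fun u => Im (f u))).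
Proof.
split=> [[a b c]|[/integrableP[a b] /integrableP[c e]]].
  have mn : measurable_fun setT (fun u => (normc (f u))%:E).
    by apply/measurable_EFinP; exact: measurable_normc.
  split; apply/integrableP; (split; first exact/measurable_EFinP);
    apply: le_lt_trans c; apply: ge0_le_integral => //=.
  - by apply/measurable_EFinP; apply: measurableT_comp.
  - by move=> x _; rewrite lee_fin normr_Re_le.
  - by apply/measurable_EFinP; apply: measurableT_comp.
  - by move=> x _; rewrite lee_fin normr_Im_le.
have /measurable_EFinP ma := a; have /measurable_EFinP mc := c.
split=> //.
have ab : measurable_fun setT (abse \o (EFin \o (fun u => Re (f u)))) by apply: measurableT_comp.
have ad : measurable_fun setT (abse \o (EFin \o (fun u => Im (f u)))) by apply: measurableT_comp.
apply: (@le_lt_trans _ _ (\int[mu]_u (`|(Re (f u))%:E| + `|(Im (f u))%:E|))%E).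
  apply: ge0_le_integral => //=.
  - by move=> x _; rewrite lee_fin normc_ge0.
  - by apply/measurable_EFinP; exact: measurable_normc.
  - exact: emeasurable_funD.
  - by move=> x _; rewrite lee_fin normc_le_ReIm.
by rewrite ge0_integralD//= lte_add_pinfty.
Qed.

Lemma cintegrable_cmeasurable f : cintegrable mu setT f -> cmeasurable f.
Proof. by case. Qed.

Lemma cintegrable_le f (g : T -> R) : cmeasurable f ->
  mu.-integrable setT (EFin \o g) -> (forall u, normc (f u) <= g u) ->
  cintegrable mu setT f.
Proof.
move=> [a b] ig h; apply/cintegrableP; split; apply: le_integrable ig => //=.
- exact/measurable_EFinP.
- by move=> x _; rewrite lee_fin (le_trans (normr_Re_le _))// (le_trans (h x))// ler_norm.
- exact/measurable_EFinP.
- by move=> x _; rewrite lee_fin (le_trans (normr_Im_le _))// (le_trans (h x))// ler_norm.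
Qed.

Lemma integrable_linear2 (a b : R) (f g : T -> R) : mu.-integrable setT (EFin \o f) ->
  mu.-integrable setT (EFin \o g) ->
  mu.-integrable setT (EFin \o (fun u => a * f u + b * g u)) /\
  Rintegral mu setT (fun u => a * f u + b * g u) =
  a * Rintegral mu setT f + b * Rintegral mu setT g.
Proof.
move=> fi gi.
have fi' : mu.-integrable setT (EFin \o (fun u => a * f u)).
  by rewrite (_ : EFin \o _ = (fun u => a%:E * (EFin \o f) u)%E)//; exact: integrableZl.
have gi' : mu.-integrable setT (EFin \o (fun u => b * g u)).
  by rewrite (_ : EFin \o _ = (fun u => b%:E * (EFin \o g) u)%E)//; exact: integrableZl.
split; last by rewrite RintegralD// !RintegralZl.
exact: (integrableD measurableT fi' gi').
Qed.

Lemma cintegrableD f g : cintegrable mu setT f -> cintegrable mu setT g ->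
  cintegrable mu setT (fun u => f u + g u).
Proof.
move=> /cintegrableP[a b] /cintegrableP[c e]; apply/cintegrableP.
have [h _] := integrable_linear2 1 1 a c; have [h' _] := integrable_linear2 1 1 b e.
by split; [move: h|move: h']; congr (integrable _ _ _); apply/funext => u /=;
  rewrite !mul1r ?ReD ?ImD.
Qed.

Lemma cintegralD f g : cintegrable mu setT f -> cintegrable mu setT g ->
  cintegral mu setT (fun u => f u + g u) = cintegral mu setT f + cintegral mu setT g.
Proof.
move=> /cintegrableP[a b] /cintegrableP[c e].
have [_ h] := integrable_linear2 1 1 a c; have [_ h'] := integrable_linear2 1 1 b e.
rewrite !mul1r in h h'.
apply: complexP; rewrite ?ReD ?ImD /= -?h -?h'; congr Rintegral; apply/funext => u;
by rewrite !mul1r ?ReD ?ImD.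
Qed.

Lemma cintegrableZ w f : cintegrable mu setT f -> cintegrable mu setT (fun u => w * f u).
Proof.
move=> /cintegrableP[a b]; apply/cintegrableP.
have [h _] := integrable_linear2 (Re w) (- Im w) a b.
have [h' _] := integrable_linear2 (Re w) (Im w) b a.
by split; [move: h|move: h']; congr (integrable _ _ _); apply/funext => u /=;
  rewrite ?ReM ?ImM ?mulNr.
Qed.

Lemma cintegralZ w f : cintegrable mu setT f ->
  cintegral mu setT (fun u => w * f u) = w * cintegral mu setT f.
Proof.
move=> /cintegrableP[a b].
have [_ h] := integrable_linear2 (Re w) (- Im w) a b.
have [_ h'] := integrable_linear2 (Re w) (Im w) b a.
apply: complexP; rewrite ?ReM ?ImM /=; [rewrite -mulNr -h|rewrite -h'];
  congr Rintegral; apply/funext => u; by rewrite ?ReM ?ImM ?mulNr.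
Qed.

Lemma cintegral_ext f g : f =1 g -> cintegral mu setT f = cintegral mu setT g.
Proof. by move=> /funext ->. Qed.

(** The factor 2 is the price of bounding the real and imaginary integrals separately; the estimate
    serves only for boundedness and limits. *)
Lemma normc_cintegral_le f (g : T -> R) : cmeasurable f ->
  mu.-integrable setT (EFin \o g) -> (forall u, normc (f u) <= g u) ->
  normc (cintegral mu setT f) <= 2 * Rintegral mu setT g.
Proof.
move=> mf ig h; have /cintegrableP[a b] := cintegrable_le mf ig h.
apply: (le_trans (normc_le_ReIm _)); rewrite mulr_natl mulr2n; apply: lerD => /=.
  apply: (le_trans (le_normr_Rintegral _ a)) => //; apply: le_Rintegral => //.
    exact: integrable_norm.
  by move=> x _; exact: (le_trans (normr_Re_le _)).
apply: (le_trans (le_normr_Rintegral _ b)) => //; apply: le_Rintegral => //.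
  exact: integrable_norm.
by move=> x _; exact: (le_trans (normr_Im_le _)).
Qed.

Lemma is_derive_under_integral (F dF : R -> T -> R) (g : T -> R) (a u v : R) :
  u < a < v ->
  (forall x, u < x < v -> mu.-integrable setT (EFin \o F x)) ->
  (forall x y, u < x < v -> is_derive x 1 (F ^~ y) (dF x y)) ->
  mu.-integrable setT (EFin \o g) ->
  (forall x y, u < x < v -> `|dF x y| <= g y) ->
  is_derive a 1 (fun x => Rintegral mu setT (F x)) (Rintegral mu setT (dF a)).
Proof.
move=> uav iF dFE ig gub.
have Ia : `]u, v[%classic a by rewrite /= in_itv.
have I x : `]u, v[%classic x -> u < x < v by rewrite /= in_itv.
have d1E x y : u < x < v -> partial1of2 F x y = dF x y.
  by move=> /dFE - /(_ y) ?; rewrite partial1of2E derive_val.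
have g0 y : 0 <= g y by apply: le_trans (gub a y uav).
have dd : forall x y, `]u, v[%classic x -> setT y -> derivable (F^~ y) x 1.
  by move=> x y /I /dFE - /(_ y) [].
have gub' : forall x y, `]u, v[%classic x -> setT y -> `|partial1of2 F x y| <= g y.
  by move=> x y /I xuv _; rewrite d1E//; exact: gub.
split.
  exact: (derivable_under_integral measurableT Ia (fun x h => iF x (I x h)) dd g0 ig gub').
rewrite -derive1E (differentiation_under_integral measurableT Ia (fun x h => iF x (I x h)) dd g0 ig gub').
by apply: eq_Rintegral => y _; rewrite d1E.
Qed.

Lemma cderiv_under_integral (F dF : R -> T -> R[i]) (g : T -> R) (a u v : R) :
  u < a < v ->
  (forall x, u < x < v -> cintegrable mu setT (F x)) ->
  (forall x y, u < x < v -> cderiv (F ^~ y) x (dF x y)) ->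
  mu.-integrable setT (EFin \o g) ->
  (forall x y, u < x < v -> normc (dF x y) <= g y) ->
  cderiv (fun x => cintegral mu setT (F x)) a (cintegral mu setT (dF a)).
Proof.
move=> uav iF dFE ig gub; split => /=.
  apply: (@is_derive_under_integral (fun x y => Re (F x y)) (fun x y => Re (dF x y)) g a u v) => //.
  - by move=> x /iF/cintegrableP[].
  - by move=> x y uxv; case: (dFE x y uxv).
  - by move=> x y uxv; apply: le_trans (gub x y uxv); exact: normr_Re_le.
apply: (@is_derive_under_integral (fun x y => Im (F x y)) (fun x y => Im (dF x y)) g a u v) => //.
- by move=> x /iF/cintegrableP[].
- by move=> x y uxv; case: (dFE x y uxv).
- by move=> x y uxv; apply: le_trans (gub x y uxv); exact: normr_Im_le.
Qed.

End ComplexIntegral.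

(** * Dominated convergence and integrals of derivatives on the line *)

Section RealIntegral.
Context {R : realType}.
Local Notation mu := (@lebesgue_measure R).

Lemma Rintegral_dominated_cvg {d} {T : measurableType d} (m : {measure set T -> \bar R})
    (D : set T) (f_ : nat -> T -> R) (f g : T -> R) :
  measurable D -> (forall n, measurable_fun D (f_ n)) ->
  (forall x, D x -> f_ n x @[n --> \oo] --> f x) ->
  m.-integrable D (EFin \o g) -> (forall n x, D x -> `|f_ n x| <= g x) ->
  Rintegral m D (f_ n) @[n --> \oo] --> Rintegral m D f.
Proof.
move=> mD mf ff ig fg.
have mf' : measurable_fun D f.
  by apply: (measurable_fun_cvg mf) => x Dx; exact: ff.
have i_f : m.-integrable D (EFin \o f).
  apply: le_integrable ig => //; first exact/measurable_EFinP.
  move=> x Dx /=; rewrite lee_fin; apply: (le_trans _ (ler_norm _)).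
  have h : `|f_ n x| @[n --> \oo] --> `|f x| by apply: cvg_norm; exact: ff.
  rewrite -(cvg_lim _ h)//; apply: limr_le; first by apply/cvg_ex; exists `|f x|.
  by apply: nearW => n; exact: fg.
apply: fine_cvg; rewrite fineK; last exact: integrable_fin_num.
apply: (@dominated_cvg _ _ _ _ _ mD _ _ (EFin \o g)) => //.
- by move=> n; exact/measurable_EFinP.
- by move=> x Dx; apply/fine_cvgP; split; [exact: nearW|exact: ff].
Qed.

Lemma Rintegral_cvg_sets {d} {T : measurableType d} (m : {measure set T -> \bar R})
    (D : set T) (A : nat -> set T) (f : T -> R) :
  measurable D -> (forall n, measurable (A n)) -> (forall n, A n `<=` D) ->
  (forall x, D x -> \forall n \near \oo, A n x) -> m.-integrable D (EFin \o f) ->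
  Rintegral m (A n) f @[n --> \oo] --> Rintegral m D f.
Proof.
move=> mD mA AD DA i_f.
have h n : Rintegral m (A n) f = Rintegral m D (f \_ (A n)).
  by rewrite -Rintegral_mkcondr setIidr.
under eq_fun do rewrite h.
apply: (@Rintegral_dominated_cvg _ _ _ _ _ _ (fun x => `|f x|)) => //.
- move=> n; apply/(measurable_restrict f (mA n) mD).
  apply: (measurable_funS mD); first exact: subIsetl.
  by apply/measurable_EFinP; case/integrableP : i_f.
- move=> x Dx; apply: cvg_near_cst.
  by near=> n; rewrite patchE ifT// inE; near: n; exact: DA.
- exact: integrable_norm.
- by move=> n x Dx; rewrite patchE; case: ifP => // _; rewrite normr0.
Unshelve. all: end_near. Qed.

Lemma Rintegral_FTC_exhaust (D : set R) (a b : nat -> R) (F f : R -> R) (l : R) :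
  measurable D -> mu.-integrable D (EFin \o f) ->
  (forall n, a n < b n) -> (forall n, `[a n, b n] `<=` D) ->
  (forall x, D x -> \forall n \near \oo, a n <= x <= b n) ->
  (forall x, D x -> is_derive x 1 F (f x)) ->
  (forall x, D x -> {for x, continuous f}) ->
  F (b n) - F (a n) @[n --> \oo] --> l -> Rintegral mu D f = l.
Proof.
move=> mD i_f ab abD Dab dF cf Fl.
have h n : Rintegral mu `[a n, b n] f = F (b n) - F (a n).
  have D' x : a n <= x <= b n -> D x by move=> h; apply: (abD n); rewrite /= in_itv.
  have cF x : a n <= x <= b n -> {for x, continuous F}.
    by move=> /D' /dF[h _]; apply/differentiable_continuous/derivable1_diffP.
  rewrite /Rintegral (@continuous_FTC2 _ f F) //=.
  - apply/continuous_within_itvP => //; split.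
    + by move=> x; rewrite in_itv /= => /andP[/ltW ? /ltW ?]; apply: cf; apply: D'; apply/andP.
    + by apply: cvg_at_right_filter; apply: cf; apply: D'; rewrite lexx ltW.
    + by apply: cvg_at_left_filter; apply: cf; apply: D'; rewrite lexx ltW.
  - split.
    + move=> x; rewrite in_itv /= => /andP[/ltW ax /ltW xb].
      have Dx : D x by apply: D'; rewrite ax.
      by case: (dF x Dx).
    + by apply: cvg_at_right_filter; apply: cF; rewrite lexx ltW.
    + by apply: cvg_at_left_filter; apply: cF; rewrite lexx ltW.
  - move=> x; rewrite in_itv /= => /andP[/ltW ax /ltW xb].
    have Dx : D x by apply: D'; rewrite ax.
    by rewrite derive1E; case: (dF x Dx).
have c1 : F (b n) - F (a n) @[n --> \oo] --> Rintegral mu D f.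
  under eq_fun do rewrite -h.
  apply: (@Rintegral_cvg_sets _ _ mu D (fun n => `[a n, b n]%classic)) => //.
by apply: (cvg_unique _ c1 Fl); exact: Rhausdorff.
Qed.

Lemma Rintegral_deriv_vanish (F f : R -> R) :
  mu.-integrable setT (EFin \o f) ->
  (forall x : R, is_derive x 1 F (f x)) -> continuous f ->
  F x @[x --> +oo] --> (0:R) -> F x @[x --> -oo] --> (0:R) -> Rintegral mu setT f = 0.
Proof.
move=> i_f dF cf Fp Fm.
apply: (@Rintegral_FTC_exhaust setT (fun n => - n.+1%:R) (fun n => n.+1%:R) F) => //.
- by move=> n; rewrite gtrN// ltr0n.
- move=> x _; near=> n; rewrite -ler_norml.
  rewrite (@le_trans _ _ n%:R) ?ler_nat//.
  by near: n; exact: nbhs_infty_ger.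
- by move=> x _; exact: cf.
- suff : F n.+1%:R - F (- n.+1%:R) @[n --> \oo] --> (0 - 0 : R) by rewrite subr0.
  apply: cvgB.
    apply: (cvg_comp _ _ _ Fp); apply/cvgryPge => A.
    near=> n; rewrite (@le_trans _ _ n%:R) ?ler_nat//; near: n; exact: nbhs_infty_ger.
  apply: (cvg_comp _ _ _ Fm); apply/cvgrNyPle => A.
  near=> n; rewrite lerNl (@le_trans _ _ n%:R) ?ler_nat//; near: n; exact: nbhs_infty_ger.
Unshelve. all: end_near. Qed.

Lemma integrable_le_norm {d} {T : measurableType d} (m : {measure set T -> \bar R})
   (D : set T) (f g : T -> R) : measurable D -> measurable_fun D f ->
  m.-integrable D (EFin \o g) -> (forall x, D x -> `|f x| <= g x) ->
  m.-integrable D (EFin \o f).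
Proof.
move=> mD mf ig fg; apply: le_integrable ig => //; first exact/measurable_EFinP.
by move=> x Dx /=; rewrite lee_fin (le_trans (fg x Dx))// ler_norm.
Qed.

Lemma integrable_scale {d} {T : measurableType d} (m : {measure set T -> \bar R})
   (D : set T) (c : R) (f : T -> R) : measurable D ->
  m.-integrable D (EFin \o f) -> m.-integrable D (EFin \o (fun x => c * f x)).
Proof.
move=> mD i_f; rewrite (_ : EFin \o _ = (fun u => c%:E * (EFin \o f) u)%E)//.
exact: integrableZl.
Qed.

Lemma integrable_gaussian (c : R) : 0 < c ->
  mu.-integrable setT (EFin \o (fun t => expR (- (c * t ^+ 2)))).
Proof.
(* With variance 1 / (2 c) the normal density is a multiple of the integrand. *)
move=> c0; pose s : R := Num.sqrt (2 * c)^-1.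
have s2 : s ^+ 2 = (2 * c)^-1 by rewrite sqr_sqrtr// invr_ge0 mulr_ge0// ltW.
have s0 : s != 0 by rewrite sqrtr_eq0 -ltNge invr_gt0 mulr_gt0.
have h := integrable_scale (normal_peak s)^-1 measurableT (integrable_normal_pdf 0 s).
apply: eq_integrable h => // t _ /=; congr EFin.
have p0 : normal_peak s != 0 by rewrite gt_eqF// normal_peak_gt0.
rewrite /normal_pdf (negbTE s0) mulrA mulVf// mul1r /normal_fun subr0 s2.
congr expR; rewrite -mulr_natr; field; exact: lt0r_neq0.
Qed.

(** A single term of the exponential series. This is how powers are absorbed into exponentials in
    all the bounds below. *)
Lemma exprn_le_expR (k : nat) (t : R) : 0 <= t -> t ^+ k <= k`!%:R * expR t.
Proof.
move=> t0; case: k => [|k]; first by rewrite expr0 fact0 mul1r -expR0 ler_expR.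
have f0 : 0 < (k.+1)`!%:R :> R by rewrite ltr0n fact_gt0.
have := expR_ge1Dxn k t0; rewrite -ler_pdivrMl// mulrC.
by apply: le_trans; rewrite lerDr.
Qed.

End RealIntegral.

(** * Gaussian majorants and Fubini's theorem in the plane *)

Section PlaneIntegral.
Context {R : realType}.
Local Notation mu := (@lebesgue_measure R).
Local Notation mu2 := (@lebesgue_measure R \x @lebesgue_measure R)%E.

Lemma integrable_gaussian2 (c : R) : 0 < c ->
  mu2.-integrable setT (EFin \o (fun p : R * R => expR (- (c * (p.1 ^+ 2 + p.2 ^+ 2))))).
Proof.
move=> c0; have ig := integrable_gaussian c0.
apply/integrable12ltyP.
  apply/measurable_EFinP; apply: measurableT_comp => //; apply: measurable_funN.
  apply: measurable_funM => //; apply: measurable_funD; apply: measurable_funX.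
    exact: measurable_fst.
  exact: measurable_snd.
pose g t := expR (- (c * t ^+ 2)).
have gE (x y : R) : expR (- (c * (x ^+ 2 + y ^+ 2))) = g x * g y.
  by rewrite /g -expRD mulrDr opprD.
have inner (x : R) : (\int[mu]_y `|(expR (- (c * (x ^+ 2 + y ^+ 2))))%:E| =
    (Rintegral mu setT g)%:E * (g x)%:E)%E.
  under eq_integral do rewrite gE gee0_abs ?lee_fin ?mulr_ge0 ?expR_ge0// EFinM.
  rewrite integralZl// muleC /Rintegral fineK//; exact: integrable_fin_num.
under eq_integral do rewrite /= inner.
by rewrite integralZl// -[X in (_ * X)%E]fineK ?ltry//; exact: integrable_fin_num.
Qed.

Lemma cderiv_cmeasurable (F dF : R -> R[i]) : (forall t, cderiv F t (dF t)) -> cmeasurable F.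
Proof.
move=> h; split; apply: continuous_measurable_fun => t.
  exact: cderiv_Re_continuous (h t).
exact: cderiv_Im_continuous (h t).
Qed.

Lemma cvg0_le_gaussian (F : set_system R) {FF : Filter F} (f : R -> R) (K c : R) : 0 < c ->
  (x ^+ 2 @[x --> F] --> +oo) ->
  (forall t, `|f t| <= K * expR (- (c * t ^+ 2))) -> f x @[x --> F] --> (0:R).
Proof.
move=> c0 F2 fK.
have h1 : c * x ^+ 2 @[x --> F] --> +oo.
  apply/cvgryPge => A; move/cvgryPge : F2 => /(_ (A / c)).
  by apply: filterS => x; rewrite ler_pdivrMr// mulrC.
have h : K * expR (- (c * x ^+ 2)) @[x --> F] --> (0:R).
  have h2 : expR (- (c * x ^+ 2)) @[x --> F] --> (0:R) by exact: (cvg_comp _ _ h1 (@cvgr_expR R)).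
  by have := cvgM (cvg_cst K) h2; rewrite mulr0; apply.
apply/norm_cvg0P; apply: (squeeze_cvgr _ (cvg_cst 0) h).
by apply: nearW => x; rewrite normr_ge0 fK.
Qed.

Lemma sqr_cvgy : x ^+ 2 @[x --> +oo] --> (+oo : set_system R).
Proof.
apply/cvgryPge => A; near=> x.
have x1 : 1 <= x by near: x; apply: nbhs_pinfty_ge; exact: num_real.
have xA : A <= x by near: x; apply: nbhs_pinfty_ge; exact: num_real.
by rewrite (le_trans xA)// expr2 ler_peMr// (le_trans _ x1).
Unshelve. all: end_near. Qed.

Lemma sqr_cvgNy : x ^+ 2 @[x --> -oo] --> (+oo : set_system R).
Proof.
apply/cvgryPge => A; near=> x.
have x1 : 1 <= - x by rewrite lerNr; near: x; apply: nbhs_ninfty_le; exact: num_real.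
have xA : A <= - x by rewrite lerNr; near: x; apply: nbhs_ninfty_le; exact: num_real.
by rewrite (le_trans xA)// -sqrrN expr2 ler_peMr// (le_trans _ x1).
Unshelve. all: end_near. Qed.

(** The derivative [f'] of [f] supplies the continuity that the fundamental theorem of calculus asks
    of [f]; the Gaussian bound on [F] removes the boundary terms. *)
Lemma cintegral_deriv_vanish (F f f' : R -> R[i]) (K c : R) : 0 < c ->
  (forall t, cderiv F t (f t)) -> (forall t, cderiv f t (f' t)) ->
  cintegrable mu setT f -> (forall t, normc (F t) <= K * expR (- (c * t ^+ 2))) ->
  Rintegral mu setT (fun t => Re (f t)) = 0 /\ Rintegral mu setT (fun t => Im (f t)) = 0.
Proof.
move=> c0 dF df /cintegrableP[ia ib] FK.
have bRe t : `|Re (F t)| <= K * expR (- (c * t ^+ 2)) by apply: le_trans (FK t); exact: normr_Re_le.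
have bIm t : `|Im (F t)| <= K * expR (- (c * t ^+ 2)) by apply: le_trans (FK t); exact: normr_Im_le.
split.
  apply: (@Rintegral_deriv_vanish _ (fun t => Re (F t))) => //.
  - by move=> t; case: (dF t).
  - by move=> t; exact: cderiv_Re_continuous (df t).
  - exact: (cvg0_le_gaussian c0 sqr_cvgy bRe).
  - exact: (cvg0_le_gaussian c0 sqr_cvgNy bRe).
apply: (@Rintegral_deriv_vanish _ (fun t => Im (F t))) => //.
- by move=> t; case: (dF t).
- by move=> t; exact: cderiv_Im_continuous (df t).
- exact: (cvg0_le_gaussian c0 sqr_cvgy bIm).
- exact: (cvg0_le_gaussian c0 sqr_cvgNy bIm).
Qed.

Lemma Rintegral2_vanish1 (f : R * R -> R) : mu2.-integrable setT (EFin \o f) ->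
  (forall y, mu.-integrable setT (EFin \o (fun x => f (x, y)))) ->
  (forall y, Rintegral mu setT (fun x => f (x, y)) = 0) -> Rintegral mu2 setT f = 0.
Proof.
move=> i_f is_ f0; rewrite /Rintegral -(integral21_prod_meas1 i_f) integral0_eq// => y _.
rewrite /fubini_G /= -[LHS]fineK; last exact: (integrable_fin_num _ (is_ y)).
by have := f0 y; rewrite /Rintegral => ->.
Qed.

Lemma Rintegral2_vanish2 (f : R * R -> R) : mu2.-integrable setT (EFin \o f) ->
  (forall x, mu.-integrable setT (EFin \o (fun y => f (x, y)))) ->
  (forall x, Rintegral mu setT (fun y => f (x, y)) = 0) -> Rintegral mu2 setT f = 0.
Proof.
move=> i_f is_ f0; rewrite /Rintegral -(integral12_prod_meas1 i_f) integral0_eq// => x _.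
rewrite /fubini_F /= -[LHS]fineK; last exact: (integrable_fin_num _ (is_ x)).
by have := f0 x; rewrite /Rintegral => ->.
Qed.

Lemma cintegrable_gaussian (f : R -> R[i]) (K c : R) : 0 < c -> cmeasurable f ->
  (forall t, normc (f t) <= K * expR (- (c * t ^+ 2))) -> cintegrable mu setT f.
Proof.
move=> c0 mf fK; apply: (@cintegrable_le _ _ _ mu f (fun t => K * expR (- (c * t ^+ 2)))) => //.
exact: integrable_scale (integrable_gaussian c0).
Qed.

Lemma cintegrable_gaussian2 (f : R * R -> R[i]) (K c : R) : 0 < c -> cmeasurable f ->
  (forall p, normc (f p) <= K * expR (- (c * (p.1 ^+ 2 + p.2 ^+ 2)))) ->
  cintegrable mu2 setT f.
Proof.
move=> c0 mf fK; apply: (@cintegrable_le _ _ _ mu2 f (fun p => K * expR (- (c * (p.1 ^+ 2 + p.2 ^+ 2))))) => //.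
exact: integrable_scale (integrable_gaussian2 c0).
Qed.

(** On each line with y fixed the Gaussian bound is a constant times a Gaussian in x, so the inner
    integral of the derivative vanishes, and Fubini concludes. *)
Lemma cintegral2_deriv_vanish1 (F f f' : R * R -> R[i]) (K c : R) : 0 < c -> cmeasurable f ->
  (forall x y, cderiv (fun x => F (x, y)) x (f (x, y))) ->
  (forall x y, cderiv (fun x => f (x, y)) x (f' (x, y))) ->
  (forall p, normc (F p) <= K * expR (- (c * (p.1 ^+ 2 + p.2 ^+ 2)))) ->
  (forall p, normc (f p) <= K * expR (- (c * (p.1 ^+ 2 + p.2 ^+ 2)))) ->
  cintegral mu2 setT f = 0.
Proof.
move=> c0 mf dF df FK fK; have /cintegrableP[ia ib] := cintegrable_gaussian2 c0 mf fK.
have gE (x y : R) : K * expR (- (c * (x ^+ 2 + y ^+ 2))) =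
    (K * expR (- (c * y ^+ 2))) * expR (- (c * x ^+ 2)).
  by rewrite mulrDr opprD expRD; ring.
have is_ y : cintegrable mu setT (fun x => f (x, y)).
  apply: (@cintegrable_gaussian _ (K * expR (- (c * y ^+ 2))) c) => //.
    exact: cderiv_cmeasurable (df ^~ y).
  by move=> t; rewrite -gE; exact: fK.
have z y : Rintegral mu setT (fun t => Re (f (t, y))) = 0 /\
           Rintegral mu setT (fun t => Im (f (t, y))) = 0.
  apply: (cintegral_deriv_vanish c0 (dF ^~ y) (df ^~ y) (is_ y)
    (K := K * expR (- (c * y ^+ 2)))).
  by move=> t; rewrite -gE; exact: FK.
apply: complexP => /=; apply: Rintegral2_vanish1 => //= y.
- by have /cintegrableP[] := is_ y.
- by case: (z y).
- by have /cintegrableP[] := is_ y.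
- by case: (z y).
Qed.

Lemma cintegral2_deriv_vanish2 (F f f' : R * R -> R[i]) (K c : R) : 0 < c -> cmeasurable f ->
  (forall x y, cderiv (fun y => F (x, y)) y (f (x, y))) ->
  (forall x y, cderiv (fun y => f (x, y)) y (f' (x, y))) ->
  (forall p, normc (F p) <= K * expR (- (c * (p.1 ^+ 2 + p.2 ^+ 2)))) ->
  (forall p, normc (f p) <= K * expR (- (c * (p.1 ^+ 2 + p.2 ^+ 2)))) ->
  cintegral mu2 setT f = 0.
Proof.
move=> c0 mf dF df FK fK; have /cintegrableP[ia ib] := cintegrable_gaussian2 c0 mf fK.
have gE (x y : R) : K * expR (- (c * (x ^+ 2 + y ^+ 2))) =
    (K * expR (- (c * x ^+ 2))) * expR (- (c * y ^+ 2)).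
  by rewrite mulrDr opprD expRD; ring.
have is_ x : cintegrable mu setT (fun y => f (x, y)).
  apply: (@cintegrable_gaussian _ (K * expR (- (c * x ^+ 2))) c) => //.
    exact: cderiv_cmeasurable (df x).
  by move=> t; rewrite -gE; exact: fK.
have z x : Rintegral mu setT (fun t => Re (f (x, t))) = 0 /\
           Rintegral mu setT (fun t => Im (f (x, t))) = 0.
  apply: (cintegral_deriv_vanish c0 (dF x) (df x) (is_ x)
    (K := K * expR (- (c * x ^+ 2)))).
  by move=> t; rewrite -gE; exact: FK.
apply: complexP => /=; apply: Rintegral2_vanish2 => //= y.
- by have /cintegrableP[] := is_ y.
- by case: (z y).
- by have /cintegrableP[] := is_ y.
- by case: (z y).
Qed.

End PlaneIntegral.

Section MoreCalculus.
Context {R : realType}.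
Implicit Types (w v : R[i]) (F G : R -> R[i]) (x : R).

Lemma cderivX F x w n : cderiv F x w ->
  cderiv (fun u => F u ^+ n) x (n%:R * F x ^+ n.-1 * w).
Proof.
move=> h; elim: n => [|n IH].
  by rewrite !mul0r; exact: cderiv_cst.
apply: (cderiv_ext (F := fun u => F u * F u ^+ n)) => [u|]; first by rewrite exprS.
apply: (cderiv_transport (cderivM h IH)).
case: n {IH} => [|n]; first by rewrite !expr0; ring.
by rewrite /= -[n.+2%:R]natr1 exprS; move: (n.+1%:R) (F x ^+ n) => N E; ring.
Qed.

Lemma near_itv (P : R -> Prop) x : (\forall y \near x, P y) ->
  exists u u' : R, u < x < u' /\ forall y, u < y < u' -> P y.
Proof.
move=> /nbhs_ballP[e /= e0 eP]; exists (x - e), (x + e); split.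
  by rewrite ltrDl e0 andbT gtrBl.
move=> y /andP[h1 h2]; apply: eP; rewrite /ball /= ltr_distlC.
by rewrite h1 h2.
Qed.

Lemma cderiv_near_Re F x w (e : R) : 0 < e -> cderiv F x w ->
  \forall y \near x, `|Re (F x) - Re (F y)| < e.
Proof. by move=> e0 h; have /cvgrPdist_lt/(_ _ e0) := cderiv_Re_continuous h. Qed.

Lemma cderiv_near_Im F x w (e : R) : 0 < e -> cderiv F x w ->
  \forall y \near x, `|Im (F x) - Im (F y)| < e.
Proof. by move=> e0 h; have /cvgrPdist_lt/(_ _ e0) := cderiv_Im_continuous h. Qed.

Lemma cderiv_near_bound F x w : cderiv F x w ->
  \forall y \near x, normc (F y) <= normc (F x) + 2.
Proof.
move=> h; near=> y; rewrite -[F y](subrKC (F x)) (le_trans (le_normcD _ _))// lerD2l.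
rewrite -normcN opprB (le_trans (normc_le_ReIm _))// ReB ImB (_ : 2 = 1 + 1)//.
by apply: lerD; apply: ltW; near: y; [exact: cderiv_near_Re h|exact: cderiv_near_Im h].
Unshelve. all: end_near. Qed.

End MoreCalculus.

(** * Moments of the umbilic integrand *)

Section PlaneMoments.
Context {R : realType}.
Local Notation mu := (@lebesgue_measure R).
Local Notation mu2 := (@lebesgue_measure R \x @lebesgue_measure R)%E.
Implicit Types (a X Y : R[i]) (p : R * R) (m n : nat).

Definition zvar p : R[i] := p.1 +i* p.2.
Definition zbar p : R[i] := p.1 -i* p.2.

(** X and Y are independent complex numbers, so that d/dX and d/dY act as multiplication by - i/2
    times [zbar] and [zvar]. The values X = x + i y, Y = x - i y, a = eps + i z give back the
    regularised exponent, by [umbilic_reg_moment]. *)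
Definition umb_phase a X Y p : R[i] :=
  - (a * (zbar p * zvar p)) - 'i / 2 * (X * zbar p + Y * zvar p)
  + 'i / 2 * (zvar p ^+ 3 + zbar p ^+ 3).

Definition umb_term a X Y m n p : R[i] :=
  zbar p ^+ m * zvar p ^+ n * cexp (umb_phase a X Y p).

Definition umb_moment a X Y m n : R[i] := cintegral mu2 setT (umb_term a X Y m n).

Lemma cmeasurable_zvar : cmeasurable zvar.
Proof. by split; [exact: measurable_fst|exact: measurable_snd]. Qed.
Lemma cmeasurable_zbar : cmeasurable zbar.
Proof. by split; [exact: measurable_fst|apply: measurable_funN; exact: measurable_snd]. Qed.

Lemma cmeasurable_umb_term a X Y m n : cmeasurable (umb_term a X Y m n).
Proof.
have [z zb] := (cmeasurable_zvar, cmeasurable_zbar).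
have c w : cmeasurable (fun _ : R * R => w : R[i]) by exact: cmeasurable_cst.
apply: cmeasurableM; first by apply: cmeasurableM; exact: cmeasurableX.
apply: cmeasurable_cexp; apply: cmeasurableD; first apply: cmeasurableD.
- by apply: cmeasurableN; apply: cmeasurableM => //; exact: cmeasurableM.
- by apply: cmeasurableN; apply: cmeasurableM => //; apply: cmeasurableD; exact: cmeasurableM.
- by apply: cmeasurableM => //; apply: cmeasurableD; exact: cmeasurableX.
Qed.

(** zeta^3 + conj(zeta)^3 is real, so the cubic term is purely imaginary; only the Gaussian and the
    linear term influence the modulus. *)
Lemma Re_umb_phase a X Y p : Re (umb_phase a X Y p) <=
  - (Re a * (p.1 ^+ 2 + p.2 ^+ 2)) + (normc X + normc Y) / 2 * normc (zvar p).
Proof.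
have zz : zbar p * zvar p = (p.1 ^+ 2 + p.2 ^+ 2)%:C.
  by apply: complexP; rewrite ?ReM ?ImM /=; ring.
have z3 : Re ('i / 2 * (zvar p ^+ 3 + zbar p ^+ 3)) = 0.
  have -> : zvar p ^+ 3 + zbar p ^+ 3 = (2 * (p.1 ^+ 3 - 3 * p.1 * p.2 ^+ 2))%:C.
    by rewrite !exprS expr0; apply: complexP; rewrite ?(ReD, ImD, ReM, ImM) /=; ring.
  have -> : ('i / 2 : R[i]) = 'i * (2^-1)%:C by rewrite fmorphV rmorphMn rmorph1.
  by rewrite ReM ImM ?ReM ?ImM /=; ring.
rewrite /umb_phase zz ReD z3 addr0 ReB ReN ReM /= mulr0 subr0 lerD2l.
rewrite -ReN (le_trans (ler_norm _))// (le_trans (normr_Re_le _))// normcN.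
have nz : normc (zbar p) = normc (zvar p) by rewrite !normcDE /= sqrrN.
have n2 : normc ('i / 2 : R[i]) = 2^-1.
  rewrite Normc.normcM Normc.normcV (_ : 2 = (2%:R : R)%:C); last by rewrite rmorphMn rmorph1.
  by rewrite normcR ger0_norm// normcDE /= expr0n expr1n add0r sqrtr1 mul1r.
rewrite Normc.normcM n2 mulrC -mulrA [_^-1 * _]mulrC mulrA ler_pM2r ?invr_gt0//.
by rewrite (le_trans (le_normcD _ _))// !Normc.normcM nz mulrDl.
Qed.

(** Half of the Gaussian decay is spent, by completing a square, on the exponent (M + 1) |zeta|,
    where M comes from the linear term and 1 from the exponential that bounds the monomial. The
    constant depends on a, X, Y through c and M only, as differentiation under the integral
    requires. *)
Lemma umb_term_bound (c M : R) m n : 0 < c -> exists2 K, 0 <= K &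
  forall a X Y, 2 * c <= Re a -> normc X <= M -> normc Y <= M ->
  forall p, normc (umb_term a X Y m n p) <= K * expR (- (c * (p.1 ^+ 2 + p.2 ^+ 2))).
Proof.
move=> c0; exists ((m + n)`!%:R * expR ((M + 1) ^+ 2 / (4 * c))).
  by rewrite mulr_ge0 ?ler0n ?expR_ge0.
move=> a X Y ca XM YM p; set r2 := p.1 ^+ 2 + p.2 ^+ 2; set r := normc (zvar p).
have rr : r ^+ 2 = r2 by rewrite normc_sqr.
have r0 : 0 <= r by exact: normc_ge0.
have nz : normc (zbar p) = r by rewrite /r !normcDE /= sqrrN.
rewrite /umb_term Normc.normcM Normc.normcM !normcX nz -/r -exprD normc_cexp.
rewrite -mulrA -expRD.
apply: (@le_trans _ _ (((m + n)`!%:R * expR r) * expR (Re (umb_phase a X Y p)))).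
  by rewrite ler_wpM2r ?expR_ge0// exprn_le_expR.
rewrite -mulrA ler_wpM2l ?ler0n// -expRD ler_expR.
apply: (le_trans (lerD (lexx _) (Re_umb_phase _ _ _ _))); rewrite -/r2 -/r -rr.
have h : (normc X + normc Y) / 2 * r <= M * r.
  by rewrite ler_wpM2r// ler_pdivrMr// mulr_natr mulr2n lerD.
have h2 : 2 * c * r ^+ 2 <= Re a * r ^+ 2 by rewrite ler_wpM2r// sqr_ge0.
have h3 : (M + 1) * r <= (M + 1) ^+ 2 / (4 * c) + c * r ^+ 2.
  rewrite -subr_ge0.
  have -> : (M + 1) ^+ 2 / (4 * c) + c * r ^+ 2 - (M + 1) * r =
      (M + 1 - 2 * c * r) ^+ 2 / (4 * c).
    by field; exact: lt0r_neq0.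
  by rewrite divr_ge0 ?sqr_ge0// mulr_ge0// ltW.
nra.
Qed.

Lemma cintegrable_umb_term a X Y m n : 0 < Re a -> cintegrable mu2 setT (umb_term a X Y m n).
Proof.
move=> a0; have c0 : 0 < Re a / 2 by rewrite divr_gt0.
have [K _ hK] := umb_term_bound (normc X + normc Y) m n c0.
apply: (cintegrable_gaussian2 (K := K) c0); first exact: cmeasurable_umb_term.
apply: hK; rewrite ?lerDl ?lerDr ?normc_ge0//.
by rewrite mulrC divfK.
Qed.

(** With [dzb_term], the formal derivatives of [umb_term] in zeta and conj(zeta). For a zero
    exponent the truncated predecessor is multiplied by 0. *)
Definition dz_term a X Y m n p : R[i] :=
  n%:R * umb_term a X Y m n.-1 p - a * umb_term a X Y m.+1 n p
  - 'i / 2 * Y * umb_term a X Y m n p + 3 * 'i / 2 * umb_term a X Y m n.+2 p.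

Definition dzb_term a X Y m n p : R[i] :=
  m%:R * umb_term a X Y m.-1 n p - a * umb_term a X Y m n.+1 p
  - 'i / 2 * X * umb_term a X Y m n p + 3 * 'i / 2 * umb_term a X Y m.+2 n p.

End PlaneMoments.

Section PlaneMoments2.
Context {R : realType}.
Local Notation mu := (@lebesgue_measure R).
Local Notation mu2 := (@lebesgue_measure R \x @lebesgue_measure R)%E.
Implicit Types (a X Y : R[i]) (p : R * R) (m n : nat).

(** One chain rule for two purposes: with constant parameters and q moving along an axis it
    differentiates in the integration variables, with q constant it differentiates in the
    parameters. *)
Lemma cderiv_umb_term (a X Y z zb : R -> R[i]) (a' X' Y' z' zb' : R[i]) (q : R -> R * R) m n u :
  (forall t, zvar (q t) = z t) -> (forall t, zbar (q t) = zb t) ->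
  cderiv a u a' -> cderiv X u X' -> cderiv Y u Y' -> cderiv z u z' -> cderiv zb u zb' ->
  cderiv (fun t => umb_term (a t) (X t) (Y t) m n (q t)) u
   (z' * dz_term (a u) (X u) (Y u) m n (q u) + zb' * dzb_term (a u) (X u) (Y u) m n (q u)
    - a' * umb_term (a u) (X u) (Y u) m.+1 n.+1 (q u)
    - 'i / 2 * (X' * umb_term (a u) (X u) (Y u) m.+1 n (q u)
               + Y' * umb_term (a u) (X u) (Y u) m n.+1 (q u))).
Proof.
move=> qz qzb da dX dY dz dzb.
have dQ := cderivD (cderivB (cderivN (cderivM da (cderivM dzb dz)))
   (cderivZ ('i / 2) (cderivD (cderivM dX dzb) (cderivM dY dz))))
   (cderivZ ('i / 2) (cderivD (cderivX 3 dz) (cderivX 3 dzb))).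
have := cderivM (cderivM (cderivX m dzb) (cderivX n dz)) (cderiv_cexp dQ).
move=> /(cderiv_ext (G := fun t => umb_term (a t) (X t) (Y t) m n (q t))) h.
apply: (cderiv_transport (h _)).
  by move=> t; rewrite /umb_term /umb_phase qz qzb.
rewrite /dz_term /dzb_term /umb_term !qz !qzb.
have -> : umb_phase (a u) (X u) (Y u) (q u) = - (a u * (zb u * z u)) -
    'i / 2 * (X u * zb u + Y u * z u) + 'i / 2 * (z u ^+ 3 + zb u ^+ 3).
  by rewrite /umb_phase qz qzb.
set e := cexp _; set I2 := 'i / 2.
have -> : 3 * 'i / 2 = 3 * I2 :> R[i] by rewrite /I2 mulrA.
rewrite !exprS /=; move: (z u) (zb u) (a u) (X u) (Y u) I2 e => Z B A X0 Y0 I e.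
move: (B ^+ m.-1) (Z ^+ n.-1) (B ^+ m) (Z ^+ n) => Bm' Zn' Bm Zn.
by rewrite !expr0; ring.
Qed.

Lemma cderiv_zvar1 (x y : R) : cderiv (fun t => zvar (t, y)) x 1.
Proof. by split => /=; [exact: is_derive_id|exact: is_derive_cst]. Qed.
Lemma cderiv_zbar1 (x y : R) : cderiv (fun t => zbar (t, y)) x 1.
Proof. by split => /=; [exact: is_derive_id|exact: is_derive_cst]. Qed.
Lemma cderiv_zvar2 (x y : R) : cderiv (fun t => zvar (x, t)) y 'i.
Proof. by split => /=; [exact: is_derive_cst|exact: is_derive_id]. Qed.
Lemma cderiv_zbar2 (x y : R) : cderiv (fun t => zbar (x, t)) y (- 'i).
Proof.
split => /=; first by rewrite oppr0; exact: is_derive_cst.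
by apply: (is_derive_transport (is_deriveN (is_derive_id _ _))).
Qed.

Lemma cderiv_umb_term_fst a X Y m n x y :
  cderiv (fun t => umb_term a X Y m n (t, y)) x
    (dz_term a X Y m n (x, y) + dzb_term a X Y m n (x, y)).
Proof.
have := cderiv_umb_term m n (q := fun t => (t, y)) (fun=> erefl) (fun=> erefl)
  (cderiv_cst a x) (cderiv_cst X x) (cderiv_cst Y x) (cderiv_zvar1 x y) (cderiv_zbar1 x y).
by move/cderiv_transport; apply; rewrite /=; ring.
Qed.

Lemma cderiv_umb_term_snd a X Y m n x y :
  cderiv (fun t => umb_term a X Y m n (x, t)) y
    ('i * (dz_term a X Y m n (x, y) - dzb_term a X Y m n (x, y))).
Proof.
have := cderiv_umb_term m n (q := fun t => (x, t)) (fun=> erefl) (fun=> erefl)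
  (cderiv_cst a y) (cderiv_cst X y) (cderiv_cst Y y) (cderiv_zvar2 x y) (cderiv_zbar2 x y).
by move/cderiv_transport; apply; rewrite !mul0r addr0 mulr0 !subr0 mulrBr mulNr.
Qed.

Lemma cintegrable_dz_term a X Y m n : 0 < Re a ->
  cintegrable mu2 setT (dz_term a X Y m n).
Proof.
move=> a0; have i m' n' := cintegrable_umb_term X Y m' n' a0.
have Z w m' n' : cintegrable mu2 setT (fun p => w * umb_term a X Y m' n' p).
  exact: cintegrableZ.
have N f g : cintegrable mu2 setT f -> cintegrable mu2 setT g ->
   cintegrable mu2 setT (fun p => f p - g p).
  move=> hf hg; apply: cintegrableD => //.
  by under eq_fun do rewrite -mulN1r; exact: cintegrableZ.
by apply: cintegrableD => //; apply: (N) => //; apply: (N).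
Qed.

Lemma cintegrable_dzb_term a X Y m n : 0 < Re a ->
  cintegrable mu2 setT (dzb_term a X Y m n).
Proof.
move=> a0; have i m' n' := cintegrable_umb_term X Y m' n' a0.
have Z w m' n' : cintegrable mu2 setT (fun p => w * umb_term a X Y m' n' p).
  exact: cintegrableZ.
have N f g : cintegrable mu2 setT f -> cintegrable mu2 setT g ->
   cintegrable mu2 setT (fun p => f p - g p).
  move=> hf hg; apply: cintegrableD => //.
  by under eq_fun do rewrite -mulN1r; exact: cintegrableZ.
by apply: cintegrableD => //; apply: (N) => //; apply: (N).
Qed.

Lemma cintegralB {d} {T : measurableType d} (m : {measure set T -> \bar R}) (f g : T -> R[i]) :
  cintegrable m setT f -> cintegrable m setT g ->
  cintegral m setT (fun u => f u - g u) = cintegral m setT f - cintegral m setT g.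
Proof.
move=> hf hg; under eq_fun do rewrite -mulN1r.
by rewrite cintegralD ?cintegralZ ?mulN1r//; exact: cintegrableZ.
Qed.

Lemma cintegrableB {d} {T : measurableType d} (m : {measure set T -> \bar R}) (f g : T -> R[i]) :
  cintegrable m setT f -> cintegrable m setT g ->
  cintegrable m setT (fun u => f u - g u).
Proof.
move=> hf hg; apply: cintegrableD => //.
by under eq_fun do rewrite -mulN1r; exact: cintegrableZ.
Qed.

Lemma dz_term_bound a X Y m n (c : R) : 0 < c -> 2 * c <= Re a -> exists2 K, 0 <= K &
  forall p, normc (dz_term a X Y m n p) <= K * expR (- (c * (p.1 ^+ 2 + p.2 ^+ 2))).
Proof.
move=> c0 ca; pose M := normc X + normc Y.
have XM : normc X <= M by rewrite lerDl normc_ge0.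
have YM : normc Y <= M by rewrite lerDr normc_ge0.
have b m' n' w : exists2 K, 0 <= K & forall p, normc (w * umb_term a X Y m' n' p) <=
    K * expR (- (c * (p.1 ^+ 2 + p.2 ^+ 2))).
  have [K K0 hK] := umb_term_bound M m' n' c0.
  exists (normc w * K); first by rewrite mulr_ge0// normc_ge0.
  by move=> p; rewrite Normc.normcM -mulrA ler_wpM2l ?normc_ge0// hK.
have [K1 h1 k1] := b m n.-1 n%:R; have [K2 h2 k2] := b m.+1 n a.
have [K3 h3 k3] := b m n ('i / 2 * Y); have [K4 h4 k4] := b m n.+2 (3 * 'i / 2).
exists (K1 + K2 + K3 + K4); first by rewrite !addr_ge0.
move=> p; rewrite !mulrDl (le_trans (le_normcD _ _))// lerD//.
by rewrite (le_trans (le_normcB _ _))// lerD// (le_trans (le_normcB _ _))// lerD.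
Qed.

Lemma dzb_term_bound a X Y m n (c : R) : 0 < c -> 2 * c <= Re a -> exists2 K, 0 <= K &
  forall p, normc (dzb_term a X Y m n p) <= K * expR (- (c * (p.1 ^+ 2 + p.2 ^+ 2))).
Proof.
move=> c0 ca; pose M := normc X + normc Y.
have XM : normc X <= M by rewrite lerDl normc_ge0.
have YM : normc Y <= M by rewrite lerDr normc_ge0.
have b m' n' w : exists2 K, 0 <= K & forall p, normc (w * umb_term a X Y m' n' p) <=
    K * expR (- (c * (p.1 ^+ 2 + p.2 ^+ 2))).
  have [K K0 hK] := umb_term_bound M m' n' c0.
  exists (normc w * K); first by rewrite mulr_ge0// normc_ge0.
  by move=> p; rewrite Normc.normcM -mulrA ler_wpM2l ?normc_ge0// hK.
have [K1 h1 k1] := b m.-1 n m%:R; have [K2 h2 k2] := b m n.+1 a.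
have [K3 h3 k3] := b m n ('i / 2 * X); have [K4 h4 k4] := b m.+2 n (3 * 'i / 2).
exists (K1 + K2 + K3 + K4); first by rewrite !addr_ge0.
move=> p; rewrite !mulrDl (le_trans (le_normcD _ _))// lerD//.
by rewrite (le_trans (le_normcB _ _))// lerD// (le_trans (le_normcB _ _))// lerD.
Qed.

(** The derivatives of [umb_term] in xi and eta are dz + dzb and i (dz - dzb). Both have integral
    zero, hence so do dz and dzb. *)
Lemma cintegral_dz_term a X Y m n : 0 < Re a ->
  cintegral mu2 setT (dz_term a X Y m n) = 0 /\ cintegral mu2 setT (dzb_term a X Y m n) = 0.
Proof.
move=> a0; have c0 : 0 < Re a / 2 by rewrite divr_gt0.
have ca : 2 * (Re a / 2) <= Re a by rewrite mulrC divfK.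
have iA := cintegrable_dz_term X Y m n a0; have iB := cintegrable_dzb_term X Y m n a0.
have [K1 K10 h1] := dz_term_bound X Y m n c0 ca.
have [K2 K20 h2] := dzb_term_bound X Y m n c0 ca.
have [K3 K30 h3'] := umb_term_bound (normc X + normc Y) m n c0.
have h3 := h3' a X Y ca (ler_wpDr (normc_ge0 _) (lexx _)) (ler_wpDl (normc_ge0 _) (lexx _)).
pose K := K1 + K2 + K3; pose g p : R := expR (- (Re a / 2 * (p.1 ^+ 2 + p.2 ^+ 2))).
have g0 p : 0 <= g p by exact: expR_ge0.
have FK p : normc (umb_term a X Y m n p) <= K * g p.
  by apply: (le_trans (h3 p)); rewrite ler_wpM2r// lerDr addr_ge0.
have fK f : (forall p, normc (f p) <= (K1 + K2) * g p) -> forall p, normc (f p) <= K * g p.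
  by move=> hf p; apply: (le_trans (hf p)); rewrite ler_wpM2r// lerDl.
have e1 : cintegral mu2 setT (fun p => dz_term a X Y m n p + dzb_term a X Y m n p) = 0.
  pose f' p := n%:R * (dz_term a X Y m n.-1 p + dzb_term a X Y m n.-1 p)
    - a * (dz_term a X Y m.+1 n p + dzb_term a X Y m.+1 n p)
    - 'i / 2 * Y * (dz_term a X Y m n p + dzb_term a X Y m n p)
    + 3 * 'i / 2 * (dz_term a X Y m n.+2 p + dzb_term a X Y m n.+2 p)
    + (m%:R * (dz_term a X Y m.-1 n p + dzb_term a X Y m.-1 n p)
    - a * (dz_term a X Y m n.+1 p + dzb_term a X Y m n.+1 p)
    - 'i / 2 * X * (dz_term a X Y m n p + dzb_term a X Y m n p)
    + 3 * 'i / 2 * (dz_term a X Y m.+2 n p + dzb_term a X Y m.+2 n p)).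
  apply: (@cintegral2_deriv_vanish1 _ (umb_term a X Y m n) _ f' K (Re a / 2)) => //.
  - exact: cintegrable_cmeasurable (cintegrableD iA iB).
  - by move=> x y; exact: cderiv_umb_term_fst.
  - move=> x y; have D m' n' w := cderivZ w (cderiv_umb_term_fst a X Y m' n' x y).
    by apply: cderivD; (apply: cderivD; last exact: D); do 2 (apply: cderivB; last exact: D);
      exact: D.
  - by apply: fK => p; rewrite (le_trans (le_normcD _ _))// mulrDl lerD.
have e2 : cintegral mu2 setT (fun p => 'i * (dz_term a X Y m n p - dzb_term a X Y m n p)) = 0.
  pose d m n p : R[i] := 'i * (dz_term a X Y m n p - dzb_term a X Y m n p).
  pose f' p := 'i * ((n%:R * d m n.-1 p - a * d m.+1 n p
    - 'i / 2 * Y * d m n p + 3 * 'i / 2 * d m n.+2 p)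
    - (m%:R * d m.-1 n p - a * d m n.+1 p
    - 'i / 2 * X * d m n p + 3 * 'i / 2 * d m.+2 n p)).
  apply: (@cintegral2_deriv_vanish2 _ (umb_term a X Y m n) _ f' K (Re a / 2)) => //.
  - exact: cintegrable_cmeasurable (cintegrableZ 'i (cintegrableB iA iB)).
  - by move=> x y; exact: cderiv_umb_term_snd.
  - move=> x y; have D m' n' w := cderivZ w (cderiv_umb_term_snd a X Y m' n' x y).
    apply: cderivZ; apply: cderivB; (apply: cderivD; last exact: D);
      do 2 (apply: cderivB; last exact: D); exact: D.
  - apply: fK => p; rewrite Normc.normcM (_ : normc 'i = 1) ?mul1r; last first.
      by rewrite normcDE /= expr0n expr1n add0r sqrtr1.
    by rewrite (le_trans (le_normcB _ _))// mulrDl lerD.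
move: e1 e2; rewrite cintegralD// cintegralZ; last exact: cintegrableB.
rewrite cintegralB// => e1 /eqP; rewrite mulf_eq0 => /orP[|].
  by move=> /eqP/(congr1 (@complex.Im R)) /= /eqP; rewrite oner_eq0.
rewrite subr_eq0 => /eqP e2; move: e1; rewrite -e2 -mulr2n -mulr_natl => /eqP.
by rewrite mulf_eq0 pnatr_eq0 /= => /eqP.
Qed.

(** The derivative of the cubic in zeta is a multiple of zeta^2, so this relation expresses the
    moment of index n + 2 by moments of lower total degree. Its conjugate does the same for m, and
    only m, n <= 1 survive. *)
Lemma umb_moment_dz a X Y m n : 0 < Re a ->
  n%:R * umb_moment a X Y m n.-1 - a * umb_moment a X Y m.+1 n
  - 'i / 2 * Y * umb_moment a X Y m n + 3 * 'i / 2 * umb_moment a X Y m n.+2 = 0.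
Proof.
move=> a0; have [<- _] := cintegral_dz_term X Y m n a0.
have i m' n' w := cintegrableZ w (cintegrable_umb_term X Y m' n' a0).
rewrite /dz_term /umb_moment.
rewrite cintegralD//; last by do 2 (apply: cintegrableB; last exact: i); exact: i.
rewrite cintegralB//; last by apply: cintegrableB.
by rewrite cintegralB// !cintegralZ//; exact: cintegrable_umb_term.
Qed.

Lemma umb_moment_dzb a X Y m n : 0 < Re a ->
  m%:R * umb_moment a X Y m.-1 n - a * umb_moment a X Y m n.+1
  - 'i / 2 * X * umb_moment a X Y m n + 3 * 'i / 2 * umb_moment a X Y m.+2 n = 0.
Proof.
move=> a0; have [_ <-] := cintegral_dz_term X Y m n a0.
have i m' n' w := cintegrableZ w (cintegrable_umb_term X Y m' n' a0).
rewrite /dzb_term /umb_moment.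
rewrite cintegralD//; last by do 2 (apply: cintegrableB; last exact: i); exact: i.
rewrite cintegralB//; last by apply: cintegrableB.
by rewrite cintegralB// !cintegralZ//; exact: cintegrable_umb_term.
Qed.

Lemma cderiv_umb_moment (a X Y a' X' Y' a'' X'' Y'' : R -> R[i]) m n u :
  (forall t, cderiv a t (a' t)) -> (forall t, cderiv X t (X' t)) ->
  (forall t, cderiv Y t (Y' t)) -> cderiv a' u (a'' u) -> cderiv X' u (X'' u) ->
  cderiv Y' u (Y'' u) -> 0 < Re (a u) ->
  cderiv (fun t => umb_moment (a t) (X t) (Y t) m n) u
   (- (a' u * umb_moment (a u) (X u) (Y u) m.+1 n.+1)
    - 'i / 2 * (X' u * umb_moment (a u) (X u) (Y u) m.+1 n
               + Y' u * umb_moment (a u) (X u) (Y u) m n.+1)).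
Proof.
move=> da dX dY da' dX' dY' a0.
(* Near u the real part of a stays above half of its value at u, that is above 2 c, the form asked
   for by [umb_term_bound]. *)
pose c := Re (a u) / 4; have c0 : 0 < c by rewrite divr_gt0.
pose M := normc (X u) + normc (Y u) + normc (a' u) + normc (X' u) + normc (Y' u) + 2.
pose P t := [/\ 2 * c <= Re (a t), normc (X t) <= M, normc (Y t) <= M &
   [/\ normc (a' t) <= M, normc (X' t) <= M & normc (Y' t) <= M]].
have nP : \forall t \near u, P t.
  have n0 (w : R[i]) : 0 <= normc w := normc_ge0 w.
  have [] := (n0 (X u), n0 (Y u)); have [] := (n0 (a' u), n0 (X' u)).
  have := n0 (Y' u) => q1 q2 q3 q4 q5.
  near=> t; split; last split.
  - have : `|Re (a u) - Re (a t)| < 2 * c.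
      by near: t; apply: cderiv_near_Re (da u); rewrite mulr_gt0.
    by rewrite ltr_distlC /c => /andP[h _]; lra.
  - have : normc (X t) <= normc (X u) + 2 by near: t; exact: cderiv_near_bound (dX u).
    by rewrite /M; lra.
  - have : normc (Y t) <= normc (Y u) + 2 by near: t; exact: cderiv_near_bound (dY u).
    by rewrite /M; lra.
  - have : normc (a' t) <= normc (a' u) + 2 by near: t; exact: cderiv_near_bound da'.
    by rewrite /M; lra.
  - have : normc (X' t) <= normc (X' u) + 2 by near: t; exact: cderiv_near_bound dX'.
    by rewrite /M; lra.
  - have : normc (Y' t) <= normc (Y' u) + 2 by near: t; exact: cderiv_near_bound dY'.
    by rewrite /M; lra.
have [u1 [u2 [u12 hP]]] := near_itv nP.
have [K1 K10 h1] := umb_term_bound M m.+1 n.+1 c0.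
have [K2 K20 h2] := umb_term_bound M m.+1 n c0.
have [K3 K30 h3] := umb_term_bound M m n.+1 c0.
have M0 : 0 <= M by rewrite !addr_ge0// normc_ge0.
pose dF t p := - (a' t * umb_term (a t) (X t) (Y t) m.+1 n.+1 p)
    - 'i / 2 * (X' t * umb_term (a t) (X t) (Y t) m.+1 n p
               + Y' t * umb_term (a t) (X t) (Y t) m n.+1 p).
have a_gt0 t : u1 < t < u2 -> 0 < Re (a t).
  by move=> /hP[h _ _ _]; apply: lt_le_trans h; rewrite mulr_gt0.
have := @cderiv_under_integral _ _ _ mu2 (fun t => umb_term (a t) (X t) (Y t) m n) dF
  (fun p => M * (K1 + K2 + K3) * expR (- (c * (p.1 ^+ 2 + p.2 ^+ 2)))) u u1 u2 u12.
move=> /(_ _ _ _ _)/cderiv_transport; apply.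
- by move=> t ut; apply: cintegrable_umb_term; exact: a_gt0.
- move=> t p ut.
  have := cderiv_umb_term m n (q := fun=> p) (fun=> erefl) (fun=> erefl)
    (da t) (dX t) (dY t) (cderiv_cst (zvar p) t) (cderiv_cst (zbar p) t).
  by move/cderiv_transport; apply; rewrite /dF; ring.
- exact: integrable_scale (integrable_gaussian2 c0).
- move=> t p /hP[ca XM YM [aM X'M Y'M]].
  have ni : normc ('i / 2 : R[i]) <= 1.
    rewrite Normc.normcM Normc.normcV (_ : 2 = (2%:R : R)%:C); last by rewrite rmorphMn rmorph1.
    rewrite normcR ger0_norm// normcDE /= expr0n expr1n add0r sqrtr1 mul1r.
    by rewrite invf_le1// ler1n.
  set g := expR _; have -> : M * (K1 + K2 + K3) * g = M * (K1 * g) + (M * (K2 * g) + M * (K3 * g)).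
    by ring.
  have bnd w T0 K : normc w <= M -> normc T0 <= K -> normc (w * T0) <= M * K.
    by move=> *; rewrite Normc.normcM ler_pM// normc_ge0.
  rewrite /dF (le_trans (le_normcB _ _))// normcN lerD//; first exact: bnd (h1 _ _ _ ca XM YM p).
  rewrite Normc.normcM -[leRHS]mul1r ler_pM ?normc_ge0// (le_trans (le_normcD _ _))// lerD//.
    exact: bnd (h2 _ _ _ ca XM YM p).
  exact: bnd (h3 _ _ _ ca XM YM p).
- have i m' n' w := cintegrableZ w (cintegrable_umb_term (X u) (Y u) m' n' a0).
  have i1 := i m.+1 n.+1 (- a' u); have i2 := i m.+1 n (X' u); have i3 := i m n.+1 (Y' u).
  rewrite /dF; under cintegral_ext do rewrite -mulNr.
  rewrite cintegralB//; last by apply: cintegrableZ; exact: cintegrableD.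
  rewrite !cintegralZ ?cintegralD ?cintegralZ -?mulNr//; try exact: cintegrable_umb_term.
  exact: cintegrableD.
Unshelve. all: end_near. Qed.

End PlaneMoments2.

(** * Uniqueness for the linear system of the moments *)

Section LinearSystem.
Context {R : realType}.
Implicit Types (w v : R[i]) (F G : R -> R[i]) (x : R).

Lemma is_derive_within (f f' : R -> R) (a b : R) :
  (forall x, a <= x <= b -> is_derive x 1 f (f' x)) -> {within `[a, b], continuous f}.
Proof.
move=> h; apply: continuous_in_subspaceT => x /set_mem; rewrite /= in_itv => /h[d _].
exact/differentiable_continuous/derivable1_diffP.
Qed.

Lemma is_derive_le0_le (f f' : R -> R) (a b : R) : a <= b ->
  (forall x, a <= x <= b -> is_derive x 1 f (f' x)) ->
  (forall x, a <= x <= b -> f' x <= 0) -> f b <= f a.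
Proof.
move=> ab df f0.
have dfo x : x \in `]a, b[ -> is_derive x 1 f (f' x).
  by rewrite in_itv /= => /andP[/ltW ax /ltW xb]; apply: df; rewrite ax.
have [c cab e] := MVT_segment ab dfo (is_derive_within df).
rewrite -subr_le0 e mulr_le0_ge0 ?subr_ge0//; apply: f0.
by move: cab; rewrite in_itv.
Qed.

Lemma is_derive0_eq (f : R -> R) (a b : R) : a <= b ->
  (forall x, a <= x <= b -> is_derive x 1 f 0) -> f a = f b.
Proof.
move=> ab df; have h1 : f b <= f a by exact: (@is_derive_le0_le f (fun=> 0)).
have h2 : - f b <= - f a.
  apply: (@is_derive_le0_le (fun x => - f x) (fun=> 0)) => // x /df h.
  by apply: (is_derive_transport (is_deriveN h)) => //; rewrite oppr0.
by apply/eqP; rewrite eq_le h1 andbT -lerN2.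
Qed.

Lemma cderiv0_eq F (a b : R) : a <= b ->
  (forall x, a <= x <= b -> cderiv F x 0) -> F a = F b.
Proof.
by move=> ab dF; apply: complexP;
  [apply: (@is_derive0_eq (fun t => Re (F t)))|apply: (@is_derive0_eq (fun t => Im (F t)))] => // x /dF[].
Qed.

(** Componentwise convergence, reduced to real limits; [ccvg_cvg] passes from it to the topology of
    R[i]^o. *)
Definition ccvg {T : Type} (F : T -> R[i]) (fl : set_system T) w :=
  (Re (F t) @[t --> fl] --> Re w) /\ (Im (F t) @[t --> fl] --> Im w).

Lemma cderiv_ccvg F x w : cderiv F x w -> ccvg F (nbhs x) (F x).
Proof.
by move=> h; split; [exact: (cderiv_Re_continuous h)|exact: (cderiv_Im_continuous h)].
Qed.

Lemma cderiv_ccvg_right F x w : cderiv F x w -> ccvg F x^'+ (F x).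
Proof. by move=> /cderiv_ccvg[a b]; split; exact: cvg_at_right_filter. Qed.

Section ccvg_ops.
Context {T : Type} (fl : set_system T) {FF : Filter fl}.
Implicit Types f g : T -> R[i].

Lemma ccvg_cst w : ccvg (fun _ : T => w) fl w.
Proof. by split; exact: cvg_cst. Qed.

Lemma ccvgD f g w v : ccvg f fl w -> ccvg g fl v -> ccvg (fun t => f t + g t) fl (w + v).
Proof.
move=> [a b] [c d]; split; rewrite ?ReD ?ImD.
  by under eq_fun do rewrite ReD; exact: cvgD.
by under eq_fun do rewrite ImD; exact: cvgD.
Qed.

Lemma ccvgM f g w v : ccvg f fl w -> ccvg g fl v -> ccvg (fun t => f t * g t) fl (w * v).
Proof.
move=> [a b] [c d]; split; rewrite ?ReM ?ImM.
  by under eq_fun do rewrite ReM; apply: cvgB; exact: cvgM.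
by under eq_fun do rewrite ImM; apply: cvgD; exact: cvgM.
Qed.

Lemma ccvgB f g w v : ccvg f fl w -> ccvg g fl v -> ccvg (fun t => f t - g t) fl (w - v).
Proof.
move=> h1 h2; have := ccvgD h1 (ccvgM (ccvg_cst (-1)) h2); rewrite mulN1r.
by under eq_fun do rewrite mulN1r.
Qed.

Lemma ccvg_real (f : T -> R) (l : R) : f t @[t --> fl] --> l -> ccvg (fun t => (f t)%:C) fl l%:C.
Proof. by move=> h; split => //=; exact: cvg_cst. Qed.

End ccvg_ops.

Lemma ccvg_unique {T : Type} (fl : set_system T) {FF : ProperFilter fl} (f : T -> R[i]) w v :
  ccvg f fl w -> ccvg f fl v -> w = v.
Proof.
move=> [a b] [c d]; apply: complexP; [apply: (cvg_unique _ a c)|apply: (cvg_unique _ b d)];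
exact: Rhausdorff.
Qed.

Lemma cvg_sum_seq {T I : Type} (fl : set_system T) {FF : Filter fl} (s : seq I)
    (f : I -> T -> R) (l : I -> R) : (forall i, f i t @[t --> fl] --> l i) ->
  \sum_(i <- s) f i t @[t --> fl] --> \sum_(i <- s) l i.
Proof.
move=> h; elim: s => [|i s IH].
  by under eq_fun do rewrite big_nil; rewrite big_nil; exact: cvg_cst.
by under eq_fun do rewrite big_cons; rewrite big_cons; exact: cvgD.
Qed.

Lemma gronwall_zero (E E' : R -> R) (K : R) :
  (forall u : R, 0 < u <= 1 -> is_derive u 1 E (E' u)) ->
  (forall u : R, 0 < u <= 1 -> E' u <= K * E u) ->
  E u @[u --> 0^'+] --> (0:R) -> E 1 <= 0.
Proof.
move=> dE E'K E0.
pose G (u : R) := expR (- K * u) * E u.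
have e (u : R) : is_derive u 1 (fun u => expR (- K * u)) (expR (- K * u) * - K).
  apply: (is_derive1_comp (is_derive_expR _)).
  apply: (is_derive_transport (is_deriveM (is_derive_cst (- K) u 1) (is_derive_id u 1))) => //.
  by rewrite /GRing.scale /=; ring.
have dG (u : R) : 0 < u <= 1 -> is_derive u 1 G (expR (- K * u) * (E' u - K * E u)).
  move=> h; apply: (is_derive_transport (is_deriveM (e u) (dE u h))) => //.
  by rewrite /GRing.scale /=; ring.
have G1 : \forall u \near 0^'+, G 1 <= G u.
  near=> u; have u0 : 0 < u by near: u; exact: nbhs_right_gt.
  have u1 : u <= 1 by near: u; exact: nbhs_right_le.
  have s x : u <= x <= 1 -> 0 < x <= 1 by move=> /andP[ux ->]; rewrite (lt_le_trans u0).
  apply: (is_derive_le0_le u1 (fun x h => dG x (s x h))) => x /s h.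
  by rewrite mulr_ge0_le0 ?expR_ge0// subr_le0 E'K.
have G0 : G u @[u --> 0^'+] --> (0:R).
  suff : G u @[u --> 0^'+] --> expR (- K * 0) * 0 by rewrite mulr0.
  apply: cvgM => //.
  have c : {for (0:R), continuous (fun u : R => expR (- K * u))}.
    by have [d _] := e 0; exact/differentiable_continuous/derivable1_diffP.
  exact: cvg_at_right_filter.
have : G 1 <= 0.
  rewrite -(cvg_lim _ G0)//; apply: limr_ge => //; by apply/cvg_ex; exists 0.
by rewrite /G pmulr_rle0// expR_gt0.
Unshelve. all: end_near. Qed.

(** Gronwall's argument for the sum of the squared moduli, which is differentiable even where a
    modulus vanishes. *)
Lemma linear_system_zero (n : nat) (D D' : 'I_n -> R -> R[i]) (K : R) : 0 <= K ->
  (forall i (u : R), 0 < u <= 1 -> cderiv (D i) u (D' i u)) ->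
  (forall i (u : R), 0 < u <= 1 -> normc (D' i u) <= K * \sum_(j < n) normc (D j u)) ->
  (forall i, ccvg (D i) 0^'+ 0) -> forall i, D i 1 = 0.
Proof.
move=> K0 dD D'K D0.
pose E (u : R) := \sum_(i < n) (Re (D i u) ^+ 2 + Im (D i u) ^+ 2).
pose E' (u : R) := \sum_(i < n) (2 * Re (D i u) * Re (D' i u) + 2 * Im (D i u) * Im (D' i u)).
have dE (u : R) : 0 < u <= 1 -> is_derive u 1 E (E' u).
  move=> h; rewrite /E /E'.
  have di i : is_derive u 1 (fun u => Re (D i u) ^+ 2 + Im (D i u) ^+ 2)
     (2 * Re (D i u) * Re (D' i u) + 2 * Im (D i u) * Im (D' i u)).
    have [a b] := dD i u h.
    apply: (is_derive_transport (is_deriveD (is_deriveM a a) (is_deriveM b b))) => //.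
    by rewrite /GRing.scale /=; ring.
  have := @is_derive_sum R R R n (fun i u => Re (D i u) ^+ 2 + Im (D i u) ^+ 2) u 1 _ di.
  move/is_derive_transport; apply => // x.
  by rewrite fct_sumE.
have EN u : E u = \sum_(i < n) normc (D i u) ^+ 2 by apply: eq_bigr => i _; rewrite normc_sqr.
have sumsq u : (\sum_(j < n) normc (D j u)) ^+ 2 <= n%:R * E u.
  rewrite EN expr2 mulr_suml.
  (* Cauchy-Schwarz obtained from x y <= (x^2 + y^2) / 2 summed over all pairs of indices. *)
  have -> : n%:R * \sum_(i < n) normc (D i u) ^+ 2 =
     \sum_(i < n) \sum_(j < n) (normc (D i u) ^+ 2 + normc (D j u) ^+ 2) / 2.
    set A := fun i => normc (D i u) ^+ 2.
    transitivity (\sum_(i < n) \sum_(j < n) A i / 2 + \sum_(i < n) \sum_(j < n) A j / 2).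
      have c (i : 'I_n) : \sum_(j < n) A i / 2 = (A i / 2) *+ n by rewrite sumr_const card_ord.
      rewrite [X in _ + X]exchange_big /= (eq_bigr _ (fun i _ => c i)).
      by rewrite sumrMnl -mulr_suml -mulr_natl; field.
    by rewrite -big_split; apply: eq_bigr => i _; rewrite -big_split; apply: eq_bigr => j _; rewrite mulrDl.
  apply: ler_sum => i _; rewrite mulr_sumr; apply: ler_sum => j _.
  by rewrite ler_pdivlMr// mulr_natr -subr_ge0; have := sqr_ge0 (normc (D i u) - normc (D j u)); rewrite sqrrB; lra.
have E'K (u : R) : 0 < u <= 1 -> E' u <= (2 * K * n%:R) * E u.
  move=> h; apply: (@le_trans _ _ (2 * K * (\sum_(j < n) normc (D j u)) ^+ 2)); last first.
    by rewrite -[leRHS]mulrA ler_wpM2l// mulr_ge0.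
  rewrite expr2 mulrA mulr_sumr; apply: ler_sum => i _.
  have := D'K i u h; set S := \sum_(j < n) _ => hS.
  have : Re (D i u) * Re (D' i u) + Im (D i u) * Im (D' i u) <= normc (D i u) * normc (D' i u).
    have -> : Re (D i u) * Re (D' i u) + Im (D i u) * Im (D' i u) = Re (conjc (D i u) * D' i u).
      by case: (D i u) => p q; case: (D' i u) => p' q' /=; ring.
    rewrite (le_trans (ler_norm _))// (le_trans (normr_Re_le _))// Normc.normcM.
    by rewrite (_ : normc (conjc _) = normc (D i u))//; case: (D i u) => p q /=; rewrite sqrrN.
  have : normc (D i u) * normc (D' i u) <= normc (D i u) * (K * S).
    by rewrite ler_wpM2l ?normc_ge0.
  by rewrite -!mulrA -mulrDr => p q; rewrite ler_wpM2l// (le_trans q)// (le_trans p)// mulrCA [S * _]mulrC.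
have E0 : E u @[u --> 0^'+] --> (0:R).
  suff : E u @[u --> 0^'+] --> \sum_(i < n) (0 * 0 + 0 * 0 : R).
    by rewrite big1// => i _; rewrite mul0r addr0.
  apply: cvg_sum_seq => i; have [p q] := D0 i; apply: cvgD.
    by under eq_fun do rewrite expr2; exact: cvgM.
  by under eq_fun do rewrite expr2; exact: cvgM.
have E1 := gronwall_zero dE E'K E0.
move=> i; have : normc (D i 1) ^+ 2 <= 0.
  apply: le_trans E1; rewrite EN (bigD1 i)//= lerDl sumr_ge0// => j _.
  by rewrite sqr_ge0.
by rewrite le_eqVlt ltNge sqr_ge0 orbF sqrf_eq0 => /eqP/Normc.eq0_normc.
Qed.

End LinearSystem.

(** * The four-dimensional system satisfied by the moments *)

Section UmbilicSystem.
Context {R : realType}.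
Implicit Types (w v : R[i]) (F G : R -> R[i]).

(* 2/(3i), the inverse of the coefficient of the second-order moments in
   umb_moment_dz and umb_moment_dzb. *)
Definition umb_kappa : R[i] := - (2 * 'i / 3).

(* The moments of indices (0,0), (1,0), (0,1), (1,1) are numbered 0, 1, 2, 3;
   l20, l02, l12, l21, l22 are the other moments occurring in their
   derivatives, reduced to these four. *)
Definition umb_field (a X Y a' X' Y' : R[i]) (l : nat -> R[i]) (i : nat) : R[i] :=
  let l20 := umb_kappa * (a * l 2 + 'i / 2 * X * l 0) in
  let l02 := umb_kappa * (a * l 1 + 'i / 2 * Y * l 0) in
  let l12 := umb_kappa * (a * l20 + 'i / 2 * Y * l 1) in
  let l21 := umb_kappa * (a * l02 + 'i / 2 * X * l 2) in
  let l30 := umb_kappa * (a * l 3 + 'i / 2 * X * l 1 - l 0) in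
  let l22 := umb_kappa * (a * l30 + 'i / 2 * Y * l20) in
  match i with
  | 0%N => - (a' * l 3) - 'i / 2 * (X' * l 1 + Y' * l 2)
  | 1%N => - (a' * l21) - 'i / 2 * (X' * l20 + Y' * l 3)
  | 2%N => - (a' * l12) - 'i / 2 * (X' * l 3 + Y' * l02)
  | _ => - (a' * l22) - 'i / 2 * (X' * l21 + Y' * l12)
  end.

Lemma umb_fieldB a X Y a' X' Y' l k i :
  umb_field a X Y a' X' Y' l i - umb_field a X Y a' X' Y' k i =
  umb_field a X Y a' X' Y' (fun j => l j - k j) i.
Proof.
rewrite /umb_field; set I2 := 'i / 2; set K := umb_kappa.
by case: i => [|[|[|i]]]; ring.
Qed.

Lemma umb_fieldZ c a X Y a' X' Y' l i :
  umb_field a X Y a' X' Y' (fun j => c * l j) i = c * umb_field a X Y a' X' Y' l i.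
Proof.
rewrite /umb_field; set I2 := 'i / 2; set K := umb_kappa.
by case: i => [|[|[|i]]]; ring.
Qed.

Definition umb_solution (a X Y a' X' Y' : R -> R[i]) (l : nat -> R -> R[i]) (u : R) :=
  forall i, (i < 4)%N -> cderiv (l i) u
    (umb_field (a u) (X u) (Y u) (a' u) (X' u) (Y' u) (fun j => l j u) i).

Definition cbounded F := exists2 K : R, 0 <= K & forall u : R, 0 <= u <= 1 -> normc (F u) <= K.

Lemma cbounded_cst w : cbounded (fun=> w).
Proof. by exists (normc w) => //; exact: normc_ge0. Qed.

Lemma cboundedM F G : cbounded F -> cbounded G -> cbounded (fun u => F u * G u).
Proof.
move=> [K K0 hK] [M M0 hM]; exists (K * M); first exact: mulr_ge0.
by move=> u h; rewrite Normc.normcM ler_pM ?normc_ge0 ?hK ?hM.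
Qed.

Lemma cderiv_cbounded F F' : (forall u, cderiv F u (F' u)) -> cbounded F.
Proof.
move=> dF.
have c1 : {within `[0, 1], continuous (fun u => `|Re (F u)| + `|Im (F u)|)}.
  apply: continuous_subspaceT => u; have hr := cderiv_Re_continuous (dF u).
  by have hi := cderiv_Im_continuous (dF u); apply: cvgD; apply: cvg_norm.
have [c _ hc] := EVT_max (@ler01 R) c1.
exists (`|Re (F c)| + `|Im (F c)|); first by rewrite addr_ge0.
move=> u u01; rewrite (le_trans (normc_le_ReIm _))//; apply: hc.
by rewrite in_itv.
Qed.

Definition dominated_by (S : R -> R) F :=
  exists2 K : R, 0 <= K & forall u : R, 0 < u <= 1 -> normc (F u) <= K * S u.

Lemma dominatedD S F G : dominated_by S F -> dominated_by S G ->
  dominated_by S (fun u => F u + G u).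
Proof.
move=> [K K0 hK] [M M0 hM]; exists (K + M); first exact: addr_ge0.
by move=> u h; rewrite (le_trans (le_normcD _ _))// mulrDl lerD ?hK ?hM.
Qed.

Lemma dominatedN S F : dominated_by S F -> dominated_by S (fun u => - F u).
Proof. by move=> [K K0 hK]; exists K => // u h; rewrite normcN hK. Qed.

Lemma dominatedM S F G : cbounded F -> dominated_by S G -> dominated_by S (fun u => F u * G u).
Proof.
move=> [K K0 hK] [M M0 hM]; exists (K * M); first exact: mulr_ge0.
move=> u h; have u01 : 0 <= u <= 1 by move: h => /andP[/ltW -> ->].
by rewrite Normc.normcM -mulrA ler_pM ?normc_ge0 ?hK ?hM.
Qed.

(** [umb_field] is linear in l with coefficients bounded on [0, 1], so the difference of two
    solutions falls under [linear_system_zero]. Agreement at 0 is a limit, which allows a path to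
    start at a = 0. *)
Lemma umb_solution_unique (a X Y a' X' Y' a'' X'' Y'' : R -> R[i]) (l k : nat -> R -> R[i]) :
  (forall u, cderiv a u (a' u)) -> (forall u, cderiv X u (X' u)) ->
  (forall u, cderiv Y u (Y' u)) -> (forall u, cderiv a' u (a'' u)) ->
  (forall u, cderiv X' u (X'' u)) -> (forall u, cderiv Y' u (Y'' u)) ->
  (forall u, 0 < u <= 1 -> umb_solution a X Y a' X' Y' l u) ->
  (forall u, 0 < u <= 1 -> umb_solution a X Y a' X' Y' k u) ->
  (forall i, (i < 4)%N -> ccvg (fun u => l i u - k i u) 0^'+ 0) ->
  forall i, (i < 4)%N -> l i 1 = k i 1.
Proof.
move=> /cderiv_cbounded ba /cderiv_cbounded bX /cderiv_cbounded bY.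
move=> /cderiv_cbounded ba' /cderiv_cbounded bX' /cderiv_cbounded bY' sl sk lk0 i i4.
pose D (i : nat) u := l i u - k i u.
pose S u := \sum_(j < 4) normc (D j u).
pose D' i u := umb_field (a u) (X u) (Y u) (a' u) (X' u) (Y' u) (fun j => D j u) i.
have dD j : (j < 4)%N -> dominated_by S (D j).
  move=> j4; exists 1 => // u _; rewrite mul1r /S (bigD1 (Ordinal j4))//= lerDl.
  by rewrite sumr_ge0// => *; exact: normc_ge0.
have [D0 D1 D2 D3] : [/\ dominated_by S (D 0), dominated_by S (D 1),
   dominated_by S (D 2) & dominated_by S (D 3)]%N by split; exact: dD.
have c w : cbounded (fun=> w) by exact: cbounded_cst.
have cI F : cbounded F -> cbounded (fun u => 'i / 2 * F u) by exact: cboundedM.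
have cK F : dominated_by S F -> dominated_by S (fun u => umb_kappa * F u) by exact: dominatedM.
have cJ F : dominated_by S F -> dominated_by S (fun u => 'i / 2 * F u) by exact: dominatedM.
pose l20 u := umb_kappa * (a u * D 2%N u + 'i / 2 * X u * D 0%N u).
pose l02 u := umb_kappa * (a u * D 1%N u + 'i / 2 * Y u * D 0%N u).
have d20 : dominated_by S l20.
  by apply: cK; apply: dominatedD; apply: dominatedM => //; exact: cI.
have d02 : dominated_by S l02.
  by apply: cK; apply: dominatedD; apply: dominatedM => //; exact: cI.
pose l12 u := umb_kappa * (a u * l20 u + 'i / 2 * Y u * D 1%N u).
pose l21 u := umb_kappa * (a u * l02 u + 'i / 2 * X u * D 2%N u).
have d12 : dominated_by S l12.
  by apply: cK; apply: dominatedD; apply: dominatedM => //; exact: cI.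
have d21 : dominated_by S l21.
  by apply: cK; apply: dominatedD; apply: dominatedM => //; exact: cI.
pose l30 u := umb_kappa * (a u * D 3%N u + 'i / 2 * X u * D 1%N u - D 0%N u).
have d30 : dominated_by S l30.
  apply: cK; apply: dominatedD; last exact: dominatedN.
  by apply: dominatedD; apply: dominatedM => //; exact: cI.
pose l22 u := umb_kappa * (a u * l30 u + 'i / 2 * Y u * l20 u).
have d22 : dominated_by S l22.
  by apply: cK; apply: dominatedD; apply: dominatedM => //; exact: cI.
have dD' j : dominated_by S (D' j).
  by case: j => [|[|[|j]]]; (apply: dominatedD; apply: dominatedN;
    [exact: dominatedM|apply: cJ; apply: dominatedD; exact: dominatedM]).
have [K K0 hK] : exists2 K, 0 <= K & forall (j : 'I_4) (u : R), 0 < u <= 1 -> normc (D' j u) <= K * S u.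
  have [K0 k0 h0] := dD' 0%N; have [K1 k1 h1] := dD' 1%N.
  have [K2 k2 h2] := dD' 2%N; have [K3 k3 h3] := dD' 3%N.
  exists (K0 + K1 + K2 + K3); first by rewrite !addr_ge0.
  move=> j u u01; have S0 : 0 <= S u by rewrite sumr_ge0// => *; exact: normc_ge0.
  have m (p q : R) : p <= q -> p * S u <= q * S u by move=> pq; rewrite ler_wpM2r.
  case: j => -[|[|[|[|j]]]]//= _.
  - by apply: (le_trans (h0 u u01)); apply: m; lra.
  - by apply: (le_trans (h1 u u01)); apply: m; lra.
  - by apply: (le_trans (h2 u u01)); apply: m; lra.
  - by apply: (le_trans (h3 u u01)); apply: m; lra.
apply/eqP; rewrite -subr_eq0; apply/eqP.
apply: (@linear_system_zero _ 4 (fun j => D j) (fun j => D' j) K K0 _ _ _ (Ordinal i4)).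
- move=> j u u01; rewrite /D' /D -umb_fieldB; apply: cderivB; [exact: sl|exact: sk].
- by move=> j u u01; exact: hK.
- by move=> j; exact: lk0.
Qed.

Definition umb_vec (a X Y : R -> R[i]) (i : nat) (u : R) : R[i] :=
  match i with
  | 0%N => umb_moment (a u) (X u) (Y u) 0 0
  | 1%N => umb_moment (a u) (X u) (Y u) 1 0
  | 2%N => umb_moment (a u) (X u) (Y u) 0 1
  | _ => umb_moment (a u) (X u) (Y u) 1 1
  end.

Lemma umb_kappaK (w v : R[i]) : - w + 3 * 'i / 2 * v = 0 -> v = umb_kappa * w.
Proof.
move=> /eqP; rewrite addrC subr_eq0 => /eqP <-.
rewrite /umb_kappa; have i2 : 'i * 'i = -1 :> R[i] by rewrite -expr2 sqrCi.
have -> : - (2 * 'i / 3) * (3 * 'i / 2 * v) = - ('i * 'i) * v by field.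
by rewrite i2 opprK mul1r.
Qed.

Lemma umb_vec_solution (a X Y a' X' Y' a'' X'' Y'' : R -> R[i]) (u : R) :
  (forall u, cderiv a u (a' u)) -> (forall u, cderiv X u (X' u)) ->
  (forall u, cderiv Y u (Y' u)) -> (forall u, cderiv a' u (a'' u)) ->
  (forall u, cderiv X' u (X'' u)) -> (forall u, cderiv Y' u (Y'' u)) ->
  0 < Re (a u) -> umb_solution a X Y a' X' Y' (umb_vec a X Y) u.
Proof.
move=> da dX dY da' dX' dY' a0 i i4.
pose L := umb_moment (a u) (X u) (Y u).
have A m n := umb_moment_dz (X u) (Y u) m n a0.
have B m n := umb_moment_dzb (X u) (Y u) m n a0.
rewrite -/L in A B.
have l20 : L 2%N 0%N = umb_kappa * (a u * L 0%N 1%N + 'i / 2 * X u * L 0%N 0%N).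
  by apply: umb_kappaK; rewrite -[RHS](B 0 0)%N; set I := 'i / 2; ring.
have l02 : L 0%N 2%N = umb_kappa * (a u * L 1%N 0%N + 'i / 2 * Y u * L 0%N 0%N).
  by apply: umb_kappaK; rewrite -[RHS](A 0 0)%N; set I := 'i / 2; ring.
have l12 : L 1%N 2%N = umb_kappa * (a u * L 2%N 0%N + 'i / 2 * Y u * L 1%N 0%N).
  by apply: umb_kappaK; rewrite -[RHS](A 1 0)%N; set I := 'i / 2; ring.
have l21 : L 2%N 1%N = umb_kappa * (a u * L 0%N 2%N + 'i / 2 * X u * L 0%N 1%N).
  by apply: umb_kappaK; rewrite -[RHS](B 0 1)%N; set I := 'i / 2; ring.
(* The only reduction in which the derivative falls on the monomial itself, whence the extra
   [- L 0 0]. *)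
have l30 : L 3%N 0%N = umb_kappa * (a u * L 1%N 1%N + 'i / 2 * X u * L 1%N 0%N - L 0%N 0%N).
  by apply: umb_kappaK; rewrite -[RHS](B 1 0)%N /=; set I := 'i / 2; ring.
have l22 : L 2%N 2%N = umb_kappa * (a u * L 3%N 0%N + 'i / 2 * Y u * L 2%N 0%N).
  by apply: umb_kappaK; rewrite -[RHS](A 2 0)%N; set I := 'i / 2; ring.
have d m n := cderiv_umb_moment m n da dX dY (da' u) (dX' u) (dY' u) a0.
case: i i4 => [|[|[|[|//]]]] _.
- exact: d.
- by apply: (cderiv_transport (d 1 0)%N); rewrite -/(L 2%N 1%N) -/(L 2%N 0%N) l21 l02 l20.
- by apply: (cderiv_transport (d 0 1)%N); rewrite -/(L 1%N 2%N) -/(L 0%N 2%N) l12 l20 l02.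
- apply: (cderiv_transport (d 1 1)%N).
  by rewrite -/(L 2%N 2%N) -/(L 2%N 1%N) -/(L 1%N 2%N) l22 l30 l21 l12 l20 l02.
Qed.

End UmbilicSystem.

(** * Growth and differential equation of the Airy series *)

Section EntireSeries.
Context {R : realType}.
Implicit Types (w v : R[i]) (u : nat -> R[i]) (r : R).

Lemma is_derive_cvg (f : R -> R) (x d : R) :
  (fun h => h^-1 * (f (h + x) - f x)) h @[h --> 0^'] --> d -> is_derive x 1 f d.
Proof.
move=> h; have e : (fun h : R => h^-1 *: ((f \o shift x) (h *: 1) - f x)) =
    (fun h => h^-1 * (f (h + x) - f x)).
  by apply/funext => t; rewrite /= /shift /GRing.scale /= mulr1.
split; first by rewrite /derivable e; apply/cvg_ex; exists d.
by rewrite /derive e; apply: cvg_lim.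
Qed.

Lemma is_derive0_squeeze (f g : R -> R) (x : R) : g x = 0 -> is_derive x 1 g 0 ->
  (\forall t \near x, `|f t| <= g t) -> is_derive x 1 f 0.
Proof.
move=> gx [dg g0] fg.
have fx : f x = 0 by have := nbhs_singleton fg; rewrite gx normr_le0 => /eqP.
apply: is_derive_cvg; rewrite fx.
have e : (fun h : R => h^-1 *: ((g \o shift x) (h *: 1) - g x)) =
    (fun h => h^-1 * g (h + x)).
  by apply/funext => t; rewrite /= /shift /GRing.scale /= mulr1 gx subr0.
have c : h^-1 * g (h + x) @[h --> 0^'] --> (0:R).
  have hl : 'D_1 g x = lim (h^-1 * g (h + x) @[h --> 0^']) by rewrite /derive e.
  by rewrite -[X in _ --> X]g0 hl; move: dg; rewrite /derivable e.
have c' : `|h^-1 * g (h + x)| @[h --> 0^'] --> (0:R) by apply/norm_cvg0P.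
apply/norm_cvg0P.
apply: (squeeze_cvgr _ (cvg_cst 0) c'); near=> h.
rewrite normr_ge0 /= !normrM subr0 ler_wpM2l// (le_trans _ (ler_norm _))//.
near: h; apply: nbhs_dnbhs.
have c0 : (fun h : R => h + x) h @[h --> (0:R)] --> 0 + x.
  by apply: cvgD; [exact: cvg_id|exact: cvg_cst].
by rewrite add0r in c0; exact: (c0 _ fg).
Unshelve. all: end_near. Qed.

(** Componentwise, so that real series theorems apply; [csum_ccvg] and [ccvg_lim] identify it with
    the limit that defines the Airy series. *)
Definition csum u : R[i] :=
  limn (series (fun n => Re (u n))) +i* limn (series (fun n => Im (u n))).

Definition csummable u := cvgn (series (fun n => normc (u n))).

Lemma csummable_le u (b : nat -> R) : (forall n, normc (u n) <= b n) -> cvgn (series b) ->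
  csummable u.
Proof.
move=> ub cb; apply: (series_le_cvg _ _ ub cb) => n; first exact: normc_ge0.
by apply: le_trans (ub n); exact: normc_ge0.
Qed.

Lemma csummable_Re u : csummable u -> cvgn (series (fun n => Re (u n))).
Proof.
move=> h; apply: normed_cvg; apply: (series_le_cvg _ _ _ h) => n; last exact: normr_Re_le.
  exact: normr_ge0.
exact: normc_ge0.
Qed.

Lemma csummable_Im u : csummable u -> cvgn (series (fun n => Im (u n))).
Proof.
move=> h; apply: normed_cvg; apply: (series_le_cvg _ _ _ h) => n; last exact: normr_Im_le.
  exact: normr_ge0.
exact: normc_ge0.
Qed.

Lemma csum_ccvg u : csummable u -> ccvg (series u) \oo (csum u).
Proof.
move=> h; split => /=.
  rewrite (_ : (fun n => Re (series u n)) = series (fun n => Re (u n))).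
    exact: csummable_Re.
  apply/funext => n; rewrite /series /=; elim: n => [|n IH]; first by rewrite !big_nil.
  by rewrite !big_nat_recr //= ReD IH.
rewrite (_ : (fun n => Im (series u n)) = series (fun n => Im (u n))).
  exact: csummable_Im.
apply/funext => n; rewrite /series /=; elim: n => [|n IH]; first by rewrite !big_nil.
by rewrite !big_nat_recr //= ImD IH.
Qed.

Lemma csum_unique u w : csummable u -> ccvg (series u) \oo w -> csum u = w.
Proof. by move=> /csum_ccvg h h'; exact: ccvg_unique h h'. Qed.

Lemma csummableD u u' : csummable u -> csummable u' -> csummable (fun n => u n + u' n).
Proof.
move=> h h'; apply: (csummable_le (b := fun n => normc (u n) + normc (u' n))).
  by move=> n; exact: le_normcD.
rewrite (_ : series _ = series (fun n => normc (u n)) + series (fun n => normc (u' n))).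
  exact: is_cvgD.
by rewrite -seriesD.
Qed.

Lemma csummableZ w u : csummable u -> csummable (fun n => w * u n).
Proof.
move=> h; rewrite /csummable.
rewrite (_ : (fun n => _) = normc w *: (fun n => normc (u n))); first exact: is_cvg_seriesZ.
by apply/funext => n; rewrite Normc.normcM.
Qed.

Lemma csumD u u' : csummable u -> csummable u' ->
  csum (fun n => u n + u' n) = csum u + csum u'.
Proof.
move=> h h'; apply: csum_unique; first exact: csummableD.
have -> : series (fun n => u n + u' n) = (fun n => series u n + series u' n).
  by apply/funext => n; rewrite /series /= big_split.
by apply: ccvgD; exact: csum_ccvg.
Qed.

Lemma csumZ w u : csummable u -> csum (fun n => w * u n) = w * csum u.
Proof.
move=> h; apply: csum_unique; first exact: csummableZ.
have -> : series (fun n => w * u n) = (fun n => w * series u n).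
  by apply/funext => n; rewrite /series /= mulr_sumr.
by apply: ccvgM; [exact: ccvg_cst|exact: csum_ccvg].
Qed.

Lemma csum_shift u : csummable u -> u 0%N = 0 -> csum (fun n => u n.+1) = csum u.
Proof.
move=> h u0; have s n : series u n.+1 = series (fun n => u n.+1) n.
  by rewrite /series /= big_nat_recl //= u0 add0r.
have s' : csummable (fun n => u n.+1).
  have : cvgn (fun n => series (fun n => normc (u n)) n.+1).
    by apply/cvg_ex; exists (limn (series (fun n => normc (u n)))); rewrite cvg_shiftS.
  rewrite (_ : (fun n => series _ n.+1) = series (fun n => normc (u n.+1)))//.
  by apply/funext => n; rewrite /series /= big_nat_recl //= u0 Normc.normc0 add0r.
apply: csum_unique => //.
have [a b] := csum_ccvg h; split.
  by under eq_fun do rewrite -s; move: a; rewrite -(cvg_shiftS (fun n => Re (series u n))).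
by under eq_fun do rewrite -s; move: b; rewrite -(cvg_shiftS (fun n => Im (series u n))).
Qed.

Lemma normc_csum_le u (b : nat -> R) : (forall n, normc (u n) <= b n) -> cvgn (series b) ->
  normc (csum u) <= 2 * limn (series b).
Proof.
move=> ub cb; have h := csummable_le ub cb.
have le (x : nat -> R) : (forall n, `|x n| <= b n) -> cvgn (series x) -> `|limn (series x)| <= limn (series b).
  move=> xb cx; have c : cvgn [normed series x].
    apply: (series_le_cvg _ _ xb cb) => n /=; first exact: normr_ge0.
    by apply: le_trans (xb n).
  apply: (le_trans (lim_series_norm c)).
  by apply: lim_series_le.
rewrite (le_trans (normc_le_ReIm _))// mulr_natl mulr2n lerD//= le//.
- by move=> n; apply: le_trans (ub n); exact: normr_Re_le.
- exact: csummable_Re.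
- by move=> n; apply: le_trans (ub n); exact: normr_Im_le.
- exact: csummable_Im.
Qed.

(** Nonnegative coefficients make the series at |w| its own majorant; the separate exponent function
    keeps the lacunary Airy series free of zero terms. *)
Definition entire_coef (a : nat -> R) (e : nat -> nat) :=
  (forall n, 0 <= a n) /\ forall r, 0 <= r -> cvgn (series (fun n => a n * r ^+ e n)).

Definition entire_majorant (a : nat -> R) (e : nat -> nat) r := limn (series (fun n => a n * r ^+ e n)).

Definition entire_sum (a : nat -> R) (e : nat -> nat) w : R[i] :=
  csum (fun n => (a n)%:C * w ^+ e n).

Lemma normc_entire_term (a : nat -> R) (e : nat -> nat) w n : 0 <= a n ->
  normc ((a n)%:C * w ^+ e n) = a n * normc w ^+ e n.
Proof. by move=> a0; rewrite Normc.normcM normcX normcR ger0_norm. Qed.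

Lemma entire_summable (a : nat -> R) (e : nat -> nat) w : entire_coef a e ->
  csummable (fun n => (a n)%:C * w ^+ e n).
Proof.
move=> [a0 ca]; apply: csummable_le (ca _ (normc_ge0 w)) => n.
by rewrite normc_entire_term.
Qed.

Lemma normc_entire_sum_le (a : nat -> R) (e : nat -> nat) w : entire_coef a e ->
  normc (entire_sum a e w) <= 2 * entire_majorant a e (normc w).
Proof.
move=> [a0 ca]; apply: normc_csum_le (ca _ (normc_ge0 w)) => n.
by rewrite normc_entire_term.
Qed.

(** The left side is the term of index n - 1 in the binomial expansion of the right side. It lets
    the differentiated series inherit convergence and growth from the series at r + 1. *)
Lemma exprn_deriv_le r n : 0 <= r -> n%:R * r ^+ n.-1 <= (r + 1) ^+ n.
Proof.
move=> r0; case: n => [|n]; first by rewrite mul0r expr0.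
rewrite [n.+1.-1]/= addrC exprDn (bigD1 (inord n)) //= inordK//.
rewrite subSn// subnn expr1n mul1r binSn mulr_natl lerDl sumr_ge0// => i _.
by rewrite mulrn_wge0// expr1n mul1r exprn_ge0.
Qed.

Lemma entire_deriv (a : nat -> R) (e : nat -> nat) : entire_coef a e ->
  entire_coef (fun n => a n * (e n)%:R) (fun n => (e n).-1).
Proof.
move=> [a0 ca]; split=> [n|r r0]; first by rewrite mulr_ge0.
have r1 : 0 <= r + 1 by rewrite addr_ge0.
apply: (series_le_cvg _ _ _ (ca _ r1)) => n.
- by rewrite !mulr_ge0 ?exprn_ge0.
- by rewrite mulr_ge0 ?exprn_ge0.
- by rewrite -mulrA ler_wpM2l// exprn_deriv_le.
Qed.

Lemma entire_majorant_deriv (a : nat -> R) (e : nat -> nat) r : 0 <= r -> entire_coef a e ->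
  entire_majorant (fun n => a n * (e n)%:R) (fun n => (e n).-1) r <= entire_majorant a e (r + 1).
Proof.
move=> r0 ea; have [_ cd] := entire_deriv ea; have [a0 ca] := ea.
apply: lim_series_le; [exact: cd|by apply: ca; rewrite addr_ge0|].
by move=> n; rewrite -mulrA ler_wpM2l// exprn_deriv_le.
Qed.

(** The factor on the right is the same remainder taken at |w| with increment 1. Both sides then
    obey the same recurrence in n, so the induction closes; with the weaker factor (|w| + 1)^n it
    would not. *)
Lemma exprn_remainder_sharp w v n : normc v <= 1 ->
  normc ((w + v) ^+ n - w ^+ n - v * (n%:R * w ^+ n.-1)) <=
  normc v ^+ 2 * ((normc w + 1) ^+ n - normc w ^+ n - n%:R * normc w ^+ n.-1).
Proof.
move=> v1; have pK (S : comRingType) (x : S) m : m%:R * x ^+ m.-1 * x = m%:R * x ^+ m.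
  by case: m => [|m]; rewrite ?mul0r// -mulrA -exprSr.
elim: n => [|n IH].
  by rewrite !expr0 subrr mul0r mulr0 subr0 Normc.normc0 subrr !mul0r subr0 mulr0.
set r := normc w in IH *.
have -> : (w + v) ^+ n.+1 - w ^+ n.+1 - v * (n.+1%:R * w ^+ n) =
    (w + v) * ((w + v) ^+ n - w ^+ n - v * (n%:R * w ^+ n.-1)) + v ^+ 2 * (n%:R * w ^+ n.-1).
  have := pK _ w n; rewrite !exprS -natr1; move: (w ^+ n.-1) (w ^+ n) ((w + v) ^+ n) => A B C h.
  have -> : v * ((n%:R + 1) * B) = v * (n%:R * B) + v * B by ring.
  by rewrite -h; ring.
have -> : (r + 1) ^+ n.+1 - r ^+ n.+1 - n.+1%:R * r ^+ n =
    (r + 1) * ((r + 1) ^+ n - r ^+ n - n%:R * r ^+ n.-1) + n%:R * r ^+ n.-1.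
  have := pK _ r n; rewrite !exprS -natr1; move: (r ^+ n.-1) (r ^+ n) ((r + 1) ^+ n) => A B C h.
  have -> : (n%:R + 1) * B = n%:R * B + B by ring.
  by rewrite -h; ring.
rewrite (le_trans (le_normcD _ _))// [leRHS]mulrDr lerD//.
  rewrite Normc.normcM [leRHS]mulrCA; apply: ler_pM; rewrite ?normc_ge0//.
  by apply: (le_trans (le_normcD _ _)); apply: lerD.
rewrite !Normc.normcM !normcX (_ : normc n%:R = n%:R)//.
by rewrite (_ : n%:R = (n%:R)%:C) ?normcR ?normr_nat// rmorph_nat.
Qed.

Lemma exprn_remainder w v n : normc v <= 1 ->
  normc ((w + v) ^+ n - w ^+ n - v * (n%:R * w ^+ n.-1)) <= normc v ^+ 2 * (normc w + 1) ^+ n.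
Proof.
move=> v1; rewrite (le_trans (exprn_remainder_sharp _ _ v1))// ler_wpM2l ?sqr_ge0//.
by rewrite -addrA gerDl -opprD oppr_le0 addr_ge0// ?mulr_ge0// exprn_ge0// normc_ge0.
Qed.

Lemma entire_remainder (a : nat -> R) (e : nat -> nat) w v : entire_coef a e -> normc v <= 1 ->
  normc (entire_sum a e (w + v) - entire_sum a e w
    - v * entire_sum (fun n => a n * (e n)%:R) (fun n => (e n).-1) w) <=
  normc v ^+ 2 * (2 * entire_majorant a e (normc w + 1)).
Proof.
move=> ea v1; have da := entire_deriv ea; have [a0 ca] := ea.
pose t n := (a n)%:C * ((w + v) ^+ e n - w ^+ e n - v * ((e n)%:R * w ^+ (e n).-1)).
have -> : entire_sum a e (w + v) - entire_sum a e w
    - v * entire_sum (fun n => a n * (e n)%:R) (fun n => (e n).-1) w = csum t.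
  have s1 := entire_summable (w := w + v) ea; have s2 := entire_summable (w := w) ea.
  have s3 := entire_summable (w := w) da.
  have s4 := csummableZ (w := -1) s2; have s5 := csummableZ (w := - v) s3.
  rewrite -[- entire_sum a e w]mulN1r -mulNr /entire_sum -(csumZ _ s2) -(csumZ _ s3).
  rewrite -(csumD s1 s4) -(csumD (csummableD s1 s4) s5).
  congr csum; apply/funext => n; rewrite /t.
  have -> : (a n * (e n)%:R)%:C = (a n)%:C * (e n)%:R by rewrite rmorphM rmorph_nat.
  move: (w ^+ e n) ((w + v) ^+ e n) (w ^+ (e n).-1) (a n)%:C => W1 W2 W3 A.
  by ring.
have w1 : 0 <= normc w + 1 by rewrite addr_ge0// normc_ge0.
rewrite mulrCA; have -> : normc v ^+ 2 * entire_majorant a e (normc w + 1) =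
    limn (series (fun n => normc v ^+ 2 * (a n * (normc w + 1) ^+ e n))).
  by have := lim_seriesZ (normc v ^+ 2) (ca _ w1).
apply: normc_csum_le.
  move=> n; rewrite /t Normc.normcM normcR ger0_norm// [leRHS]mulrCA ler_wpM2l//.
  exact: exprn_remainder.
by apply: is_cvg_seriesZ; exact: ca.
Qed.

(** Complex differentiability in the form of a chain rule along real paths, the form in which it
    combines directly with [cderiv]. *)
Definition cdiff (U U' : R[i] -> R[i]) := forall (p : R -> R[i]) x p',
  cderiv p x p' -> cderiv (fun t => U (p t)) x (p' * U' (p x)).

(** Along a path through w = p x, U differs from its linearisation by at most K w |p t - w|^2, which
    vanishes at x together with its derivative. *)
Lemma cdiff_remainder (U U' : R[i] -> R[i]) (K : R[i] -> R) :
  (forall w v, normc v <= 1 -> normc (U (w + v) - U w - v * U' w) <= normc v ^+ 2 * K w) ->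
  cdiff U U'.
Proof.
move=> rem p x p' dp; set w := p x.
pose lin t := U w + U' w * (p t - w).
have dlin : cderiv lin x (p' * U' w).
  apply: (cderiv_transport (cderivD (cderiv_cst (U w) x)
    (cderivZ (U' w) (cderivB dp (cderiv_cst w x))))).
  by ring.
pose r t := U (p t) - lin t.
pose g t := K w * (Re (p t - w) ^+ 2 + Im (p t - w) ^+ 2).
have gx : g x = 0 by rewrite /g /w subrr /= expr0n /= addr0 mulr0.
have dg : is_derive x 1 g 0.
  have [p1 p2] := cderivB dp (cderiv_cst w x).
  have := is_deriveD (is_deriveM p1 p1) (is_deriveM p2 p2).
  move/(is_deriveM (is_derive_cst (K w) x 1))/is_derive_transport; apply=> //.
  by rewrite -/w subrr /GRing.scale /=; ring.
have near1 : \forall t \near x, normc (p t - w) <= 1.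
  have h : (0:R) < 2^-1 by rewrite invr_gt0.
  near=> t; rewrite (le_trans (normc_le_ReIm _))// ReB ImB distrC [X in _ + X]distrC.
  have -> : (1:R) = 2^-1 + 2^-1 by field.
  by apply: lerD; apply: ltW; near: t; [exact: cderiv_near_Re dp|exact: cderiv_near_Im dp].
have rg t : normc (p t - w) <= 1 -> normc (r t) <= g t.
  move=> h; have := rem w _ h; rewrite subrKC /r /lin /g -normc_sqr [leRHS]mulrC => h2.
  rewrite (_ : U (p t) - _ = U (p t) - U w - (p t - w) * U' w)//.
  by move: (U (p t)) (U w) (p t) (U' w) => A B C D; ring.
have dr : cderiv r x 0.
  split; apply: (is_derive0_squeeze gx dg); apply: filterS near1 => t /rg; apply: le_trans.
    exact: normr_Re_le.
  exact: normr_Im_le.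
apply: (cderiv_ext (F := fun t => lin t + r t)) => [t|]; first by rewrite /r subrKC.
by apply: (cderiv_transport (cderivD dlin dr)); rewrite addr0.
Unshelve. all: end_near. Qed.

Lemma entire_cdiff (a : nat -> R) (e : nat -> nat) : entire_coef a e ->
  cdiff (entire_sum a e) (entire_sum (fun n => a n * (e n)%:R) (fun n => (e n).-1)).
Proof.
move=> ea; apply: (@cdiff_remainder _ _ (fun w => 2 * entire_majorant a e (normc w + 1))).
by move=> w v v1; exact: entire_remainder.
Qed.

(** Growth of order 2 and type zero: against exp (- t^2) a product of such functions is integrable
    along any complex line, whatever its slope. *)
Definition subgaussian (U : R[i] -> R[i]) := forall c : R, 0 < c ->
  exists2 K : R, 0 <= K & forall w, normc (U w) <= K * expR (c * normc w ^+ 2).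

Lemma entire_subgaussian (a : nat -> R) (e : nat -> nat) : entire_coef a e ->
  (forall c : R, 0 < c -> exists2 K : R, 0 <= K &
    forall r, 0 <= r -> entire_majorant a e r <= K * expR (c * r ^+ 2)) ->
  subgaussian (entire_sum a e) /\
  subgaussian (entire_sum (fun n => a n * (e n)%:R) (fun n => (e n).-1)).
Proof.
move=> ea gr; split=> c c0.
  have [K K0 hK] := gr c c0; exists (2 * K); first by rewrite mulr_ge0.
  move=> w; rewrite (le_trans (normc_entire_sum_le w ea))// -mulrA ler_wpM2l//.
  by apply: hK; exact: normc_ge0.
(* Half of the exponent pays for the shift from r to r + 1, since (r + 1)^2 / 2 <= r^2 + 1. *)
have c20 : 0 < c / 2 by rewrite divr_gt0.
have [K K0 hK] := gr _ c20.
exists (2 * (K * expR c)); first by rewrite !mulr_ge0// expR_ge0.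
move=> w; rewrite (le_trans (normc_entire_sum_le w (entire_deriv ea)))// -mulrA ler_wpM2l//.
have w0 := normc_ge0 w.
rewrite (le_trans (entire_majorant_deriv w0 ea))// (le_trans (hK _ _)) ?addr_ge0//.
rewrite -[leRHS]mulrA ler_wpM2l// -expRD ler_expR.
have := sqr_ge0 (normc w - 1); move: (normc w) w0 => r r0 h.
nra.
Qed.

End EntireSeries.

(** * The two Maclaurin solutions of the Airy equation *)

Section AirySeries.
Context {R : realType}.
Implicit Types (w v : R[i]) (u : nat -> R[i]) (r : R).

Lemma ccvg_cvg {T : Type} (fl : set_system T) {FF : Filter fl} (F : T -> R[i]) w :
  ccvg F fl w -> (F t : R[i]^o) @[t --> fl] --> (w : R[i]^o).
Proof.
move=> [hr hi]; apply/cvgrPdist_lt => e e0.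
have [er ei] : e = (Re e)%:C /\ 0 < Re e.
  move: e0; rewrite ltcE /= => /andP[/eqP ie ->]; split=> //.
  by apply: complexP => //=; rewrite -ie.
have e2 : 0 < Re e / 2 by rewrite divr_gt0.
move/cvgrPdist_lt : hr => /(_ _ e2) hr; move/cvgrPdist_lt : hi => /(_ _ e2) hi.
near=> t; rewrite er normc_normr ltcR (le_lt_trans (normc_le_ReIm _))//.
rewrite ReB ImB [ltRHS](splitr (Re e)) ltrD//; first by near: t.
by near: t.
Unshelve. all: end_near. Qed.

Lemma ccvg_lim {T : Type} (fl : set_system T) {FF : ProperFilter fl} (F : T -> R[i]) w :
  ccvg F fl w -> lim ((F t : R[i]^o) @[t --> fl]) = w.
Proof. by move=> h; apply: cvg_lim; [exact: norm_hausdorff|exact: ccvg_cvg]. Qed.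

Lemma csum_single u : (forall n, u n.+1 = 0) -> csum u = u 0%N.
Proof.
move=> u0; have s n : series u n.+1 = u 0%N.
  by rewrite /series /= big_nat_recl //= big1 ?addr0.
apply: csum_unique.
  apply/cvg_ex; exists (normc (u 0%N)); rewrite -cvg_shiftS.
  apply: cvg_near_cst; apply: nearW => n; rewrite /series /= big_nat_recl //= big1 ?addr0//.
  by move=> i _; rewrite u0 Normc.normc0.
split; rewrite -(cvg_shiftS (fun n => _ (series u n))); under eq_fun do rewrite s; exact: cvg_cst.
Qed.

Definition airy_coef_bound (a : nat -> R) (e : nat -> nat) (d : nat) :=
  (forall k, 0 <= a k <= (k`!%:R ^+ 2)^-1) /\ forall k, e k = (3 * k + d)%N.

(** Write r^(3k) / (k!)^2 as (mu r)^k / k! times (r^2 / mu)^k / k! and bound the first factor by exp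
    (mu r). The sum over k is then at most r^d exp (mu r + r^2 / mu), and a large mu makes the
    quadratic rate as small as desired. *)
Lemma airy_term_le a e d (mu r : R) k : airy_coef_bound a e d -> 0 < mu -> 0 <= r ->
  a k * r ^+ e k <= (r ^+ d * expR (mu * r)) * exp_coeff (r ^+ 2 / mu) k.
Proof.
move=> [ha he] mu0 r0; rewrite he; have /andP[ak0 ak] := ha k.
have kf : (0:R) < k`!%:R by rewrite ltr0n fact_gt0.
have h : (mu * r) ^+ k / k`!%:R <= expR (mu * r).
  rewrite ler_pdivrMr// [leRHS]mulrC; apply: exprn_le_expR.
  by rewrite mulr_ge0// ltW.
rewrite exprD [r ^+ _ * r ^+ d]mulrC mulrCA -[leRHS]mulrA ler_wpM2l ?exprn_ge0//.
apply: (@le_trans _ _ ((k`!%:R ^+ 2)^-1 * r ^+ (3 * k))).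
  by rewrite ler_wpM2r ?exprn_ge0.
have -> : (k`!%:R ^+ 2)^-1 * r ^+ (3 * k) = (mu * r) ^+ k / k`!%:R * exp_coeff (r ^+ 2 / mu) k.
  rewrite /exp_coeff /= [(mu * r) ^+ k]exprMn [(r ^+ 2 / mu) ^+ k]exprMn exprVn -exprM (_ : (3 * k = k + 2 * k)%N) ?exprD; last by lia.
  have m0 : mu ^+ k != 0 by rewrite expf_neq0// gt_eqF.
  move: (mu ^+ k) (k`!%:R) kf m0 => M N N0 M0.
  by field; rewrite M0 gt_eqF.
by rewrite ler_wpM2r// exp_coeff_ge0// divr_ge0 ?sqr_ge0// ltW.
Qed.

Lemma airy_entire a e d : airy_coef_bound a e d -> entire_coef a e.
Proof.
move=> h; split=> [n|r r0]; first by have [/(_ n)/andP[]] := h.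
have t n := airy_term_le n h ltr01 r0.
have a0 n : 0 <= a n by have [/(_ n)/andP[]] := h.
apply: (series_le_cvg _ _ t) => [n|n|].
- by rewrite mulr_ge0// exprn_ge0.
- by apply: le_trans (t n); rewrite mulr_ge0// exprn_ge0.
- by apply: is_cvg_seriesZ; exact: is_cvg_series_exp_coeff.
Qed.

Lemma airy_majorant a e d : airy_coef_bound a e d ->
  forall c : R, 0 < c -> exists2 K : R, 0 <= K &
    forall r, 0 <= r -> entire_majorant a e r <= K * expR (c * r ^+ 2).
Proof.
(* The quadratic rate becomes c / 2; the other half of c absorbs the linear exponent (mu + 1) r by
   completing a square. *)
move=> h c c0; pose mu := 2 / c; have mu0 : 0 < mu by rewrite divr_gt0.
exists (d`!%:R * expR ((mu + 1) ^+ 2 / (2 * c))); first by rewrite mulr_ge0// expR_ge0.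
move=> r r0; have [_ ca] := airy_entire h.
have le1 : entire_majorant a e r <= (r ^+ d * expR (mu * r)) * expR (r ^+ 2 / mu).
  have := lim_seriesZ (r ^+ d * expR (mu * r)) (is_cvg_series_exp_coeff (r ^+ 2 / mu)).
  rewrite -[limn (series (exp_coeff _))]/(expR _) /GRing.scale /= => <-.
  apply: lim_series_le; first exact: ca.
    by apply: is_cvg_seriesZ; exact: is_cvg_series_exp_coeff.
  by move=> n; exact: airy_term_le.
apply: (le_trans le1).
apply: (@le_trans _ _ ((d`!%:R * expR r * expR (mu * r)) * expR (r ^+ 2 / mu))).
  by rewrite !ler_wpM2r ?expR_ge0// exprn_le_expR.
rewrite (_ : _ * expR r * _ * _ = d`!%:R * expR (r + (mu * r + r ^+ 2 / mu))); last first.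
  by rewrite !expRD; ring.
rewrite -[leRHS]mulrA -expRD ler_wpM2l// ler_expR -subr_ge0.
have -> : (mu + 1) ^+ 2 / (2 * c) + c * r ^+ 2 - (r + (mu * r + r ^+ 2 / mu)) =
   (mu + 1 - c * r) ^+ 2 / (2 * c).
  by rewrite /mu; field; rewrite gt_eqF.
by rewrite divr_ge0 ?sqr_ge0// mulr_ge0// ltW.
Qed.

Record airy_pair (U U' : R[i] -> R[i]) : Prop := AiryPair {
  airy_diff : cdiff U U';
  airy_diff2 : cdiff U' (fun w => w * U w);
  airy_growth : subgaussian U;
  airy_growth' : subgaussian U' }.

(** The recurrence says that differentiating twice shifts the series by one term, which is
    multiplication by w. The initial term disappears because its exponent d is below 2. *)
Lemma airy_pair_series a e d : airy_coef_bound a e d -> (d < 2)%N ->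
  (forall k, a k.+1 * (e k.+1)%:R * (e k.+1).-1%:R = a k) ->
  airy_pair (entire_sum a e) (entire_sum (fun n => a n * (e n)%:R) (fun n => (e n).-1)).
Proof.
move=> h d2 rec; have ea := airy_entire h; have [g g'] := entire_subgaussian ea (airy_majorant h).
split => //; first exact: entire_cdiff.
have ed := entire_deriv ea; have edd := entire_deriv ed.
have -> : (fun w => w * entire_sum a e w) =
   entire_sum (fun n => a n * (e n)%:R * (e n).-1%:R) (fun n => (e n).-1.-1).
  apply/funext => w; rewrite /entire_sum -csumZ; last exact: entire_summable.
  rewrite -[RHS]csum_shift; last 2 first.
  - exact: entire_summable edd.
  - have [_ ->] := h; rewrite muln0 add0n.
    by case: d d2 {h} => [|[|//]] _; rewrite ?mulr0 ?mul0r ?rmorph0 ?mul0r.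
  congr csum; apply/funext => n; rewrite rec.
  have [_ he] := h; have -> : (e n.+1).-1.-1 = (e n).+1 by rewrite !he; lia.
  by rewrite exprS; ring.
exact: entire_cdiff.
Qed.

Definition airy_coef_f (k : nat) : R := (\prod_(j < k) (3 * j + 1))%N%:R / ((3 * k)`!)%:R.
Definition airy_coef_g (k : nat) : R := (\prod_(j < k) (3 * j + 2))%N%:R / ((3 * k + 1)`!)%:R.

Lemma airy_coef_f_rec k :
  airy_coef_f k.+1 * (3 * k.+1)%N%:R * (3 * k.+1).-1%:R = airy_coef_f k.
Proof.
rewrite /airy_coef_f; have -> : (3 * k.+1)%N = (3 * k).+3 by lia.
rewrite big_ord_recr /=.
rewrite !factS !natrM /=; have f0 : ((3 * k)`!)%:R != 0 :> R by rewrite pnatr_eq0 -lt0n fact_gt0.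
have n0 m : m.+1%:R != 0 :> R by rewrite pnatr_eq0.
rewrite addn1; move: (n0 (3 * k)%N) (n0 (3 * k).+1) (n0 (3 * k).+2) f0.
by move: ((3 * k).+1%:R) ((3 * k).+2%:R) ((3 * k).+3%:R) (((3 * k)`!)%:R) => A B C F *; field; apply/and4P.
Qed.

Lemma airy_coef_g_rec k :
  airy_coef_g k.+1 * (3 * k.+1 + 1)%N%:R * (3 * k.+1 + 1).-1%:R = airy_coef_g k.
Proof.
rewrite /airy_coef_g; have -> : (3 * k.+1 + 1)%N = (3 * k).+4 by lia.
rewrite big_ord_recr /=.
have f0 : ((3 * k).+1`!)%:R != 0 :> R by rewrite pnatr_eq0 -lt0n fact_gt0.
rewrite addn1 addn2 [((3 * k).+4)`!]factS [((3 * k).+3)`!]factS [((3 * k).+2)`!]factS.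
move: ((3 * k).+1`!) f0 => F F0; rewrite !natrM /=.
have n0 m : m.+1%:R != 0 :> R by rewrite pnatr_eq0.
move: (n0 (3 * k).+1%N) (n0 (3 * k).+2) (n0 (3 * k).+3).
by move: ((3 * k).+2%:R) ((3 * k).+3%:R) ((3 * k).+4%:R) => A B C *; field; apply/and4P.
Qed.

(** Each step divides by at least (3k + 3) (3k + 2), which exceeds (k + 1)^2. *)
Lemma airy_coef_rec_bound (a : nat -> R) (e : nat -> nat) d : (forall k, 0 <= a k) -> a 0%N = 1 ->
  (forall k, e k = (3 * k + d)%N) ->
  (forall k, a k.+1 * (e k.+1)%:R * (e k.+1).-1%:R = a k) -> airy_coef_bound a e d.
Proof.
move=> a0 a1 he rec; split=> // k; rewrite a0 /=; elim: k => [|k IH].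
  by rewrite a1 fact0 expr1n invr1.
rewrite factS natrM exprMn invfM [leRHS]mulrC ler_pdivlMr ?exprn_gt0 ?ltr0n//.
apply: le_trans IH; rewrite -[leRHS]rec -[leRHS]mulrA ler_wpM2l// expr2 -!natrM ler_nat he.
by rewrite leq_mul//; lia.
Qed.

Lemma airy_pair_f : airy_pair (@airy_f R)
  (entire_sum (fun k => airy_coef_f k * (3 * k)%N%:R) (fun k => (3 * k).-1)) /\
  @airy_f R = entire_sum airy_coef_f (fun k => 3 * k)%N.
Proof.
have b : airy_coef_bound airy_coef_f (fun k => 3 * k)%N 0.
  apply: airy_coef_rec_bound => [k||k|k].
  - by rewrite /airy_coef_f divr_ge0.
  - by rewrite /airy_coef_f big_ord0 muln0 fact0 divr1.
  - by rewrite addn0.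
  - exact: airy_coef_f_rec.
have e : @airy_f R = entire_sum airy_coef_f (fun k => 3 * k)%N.
  apply/funext => w; rewrite /airy_f; have ea := airy_entire b.
  have -> : (fun k : nat => (\prod_(j < k) (3 * j + 1))%N%:R / ((3 * k)`!)%:R * w ^+ (3 * k)) =
      (fun n => (airy_coef_f n)%:C * w ^+ (3 * n)).
    by apply/funext => n; rewrite /airy_coef_f rmorphM fmorphV !rmorph_nat.
  exact/ccvg_lim/csum_ccvg/entire_summable.
split=> //; rewrite e; apply: (airy_pair_series b) => //; exact: airy_coef_f_rec.
Qed.

Lemma airy_pair_g : airy_pair (@airy_g R)
  (entire_sum (fun k => airy_coef_g k * (3 * k + 1)%N%:R) (fun k => (3 * k + 1).-1)) /\
  @airy_g R = entire_sum airy_coef_g (fun k => 3 * k + 1)%N.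
Proof.
have b : airy_coef_bound airy_coef_g (fun k => 3 * k + 1)%N 1.
  apply: airy_coef_rec_bound => [k||k|k].
  - by rewrite /airy_coef_g divr_ge0.
  - by rewrite /airy_coef_g big_ord0 muln0 divr1.
  - by [].
  - exact: airy_coef_g_rec.
have e : @airy_g R = entire_sum airy_coef_g (fun k => 3 * k + 1)%N.
  apply/funext => w; rewrite /airy_g; have ea := airy_entire b.
  have -> : (fun k : nat => (\prod_(j < k) (3 * j + 2))%N%:R / ((3 * k + 1)`!)%:R * w ^+ (3 * k + 1)) =
      (fun n => (airy_coef_g n)%:C * w ^+ (3 * n + 1)).
    by apply/funext => n; rewrite /airy_coef_g rmorphM fmorphV !rmorph_nat.
  exact/ccvg_lim/csum_ccvg/entire_summable.
split=> //; rewrite e; apply: (airy_pair_series b) => //; exact: airy_coef_g_rec.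
Qed.

Lemma airy_solutions : exists f' g' : R[i] -> R[i],
  [/\ airy_pair (@airy_f R) f', airy_pair (@airy_g R) g',
      airy_f (0 : R[i]) = 1 /\ f' 0 = 0 & airy_g (0 : R[i]) = 0 /\ g' 0 = 1].
Proof.
have [pf ef] := airy_pair_f; have [pg eg] := airy_pair_g.
exists (entire_sum (fun k => airy_coef_f k * (3 * k)%N%:R) (fun k => (3 * k).-1)).
exists (entire_sum (fun k => airy_coef_g k * (3 * k + 1)%N%:R) (fun k => (3 * k + 1).-1)).
have z n : (0 < n)%N -> (0 : R[i]) ^+ n = 0 by move=> n0; rewrite expr0n eqn0Ngt n0.
split=> //; split; rewrite ?ef ?eg /entire_sum csum_single.
- by rewrite muln0 expr0 mulr1 /airy_coef_f big_ord0 muln0 fact0 divr1.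
- by move=> n; rewrite z ?mulr0//; lia.
- by rewrite muln0 mulr0 mul0r.
- by move=> n; rewrite z ?mulr0//; lia.
- by rewrite z ?mulr0.
- by move=> n; rewrite z ?mulr0//; lia.
- by rewrite muln0 add0n expr0 mulr1 /airy_coef_g big_ord0 muln0 divr1 mulr1.
- by move=> n; rewrite z ?mulr0//; lia.
Qed.

End AirySeries.

(** * Gaussian integrals of products of Airy functions *)

Section AiryGaussian.
Context {R : realType}.
Local Notation mu := (@lebesgue_measure R).
Implicit Types (w v : R[i]) (U : R[i] -> R[i]) (t : R).

Lemma cdiff_mulid U U' : cdiff U U' -> cdiff (fun w => w * U w) (fun w => U w + w * U' w).
Proof.
move=> dU p x p' dp; apply: (cderiv_transport (cderivM dp (dU _ _ _ dp))).
by ring.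
Qed.

Lemma cdiffD U U' U1 U1' : cdiff U U' -> cdiff U1 U1' ->
  cdiff (fun w => U w + U1 w) (fun w => U' w + U1' w).
Proof.
move=> dU dU1 p x p' dp; apply: (cderiv_transport (cderivD (dU _ _ _ dp) (dU1 _ _ _ dp))).
by ring.
Qed.

Lemma subgaussian_mulid U : subgaussian U -> subgaussian (fun w => w * U w).
Proof.
move=> gU c c0; have c20 : 0 < c / 2 by rewrite divr_gt0.
have [K K0 hK] := gU _ c20.
pose M := expR (1 / (2 * c)); exists (K * M); first by rewrite mulr_ge0// expR_ge0.
move=> w; rewrite Normc.normcM; set r := normc w; have r0 : 0 <= r by exact: normc_ge0.
have h1 : r <= expR r by have := exprn_le_expR 1 r0; rewrite mul1r.
apply: (@le_trans _ _ (expR r * (K * expR (c / 2 * r ^+ 2)))).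
  by rewrite ler_pM// ?normc_ge0//; exact: hK.
rewrite mulrCA -[leRHS]mulrA ler_wpM2l// -!expRD ler_expR -subr_ge0.
have -> : 1 / (2 * c) + c * r ^+ 2 - (r + c / 2 * r ^+ 2) = (1 - c * r) ^+ 2 / (2 * c).
  by field; rewrite gt_eqF.
by rewrite divr_ge0 ?sqr_ge0// mulr_ge0// ltW.
Qed.

Lemma subgaussianD U U1 : subgaussian U -> subgaussian U1 -> subgaussian (fun w => U w + U1 w).
Proof.
move=> g g1 c c0; have [K K0 hK] := g c c0; have [M M0 hM] := g1 c c0.
exists (K + M); first exact: addr_ge0.
by move=> w; rewrite (le_trans (le_normcD _ _))// mulrDl lerD.
Qed.

Definition gauss_term U1 U2 (V W s s' : R[i]) t : R[i] :=
  (expR (- t ^+ 2))%:C * (U1 (V + t%:C * s) * U2 (W + t%:C * s')).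

Definition gauss_int U1 U2 (V W s s' : R[i]) : R[i] :=
  cintegral mu setT (gauss_term U1 U2 V W s s').

Lemma normr_le_expR t : `|t| <= expR (t ^+ 2 / 4).
Proof.
apply: (@le_trans _ _ (1 + t ^+ 2 / 4)); last exact: expR_ge1Dx.
rewrite -subr_ge0 -[t ^+ 2]real_normK ?num_real//.
have -> : 1 + `|t| ^+ 2 / 4 - `|t| = (`|t| / 2 - 1) ^+ 2 by field.
exact: sqr_ge0.
Qed.

Lemma gauss_term_bound U1 U2 (M : R) : 0 <= M -> subgaussian U1 -> subgaussian U2 ->
  exists2 K : R, 0 <= K & forall V W s s', normc V <= M -> normc W <= M ->
    normc s <= M -> normc s' <= M -> forall t,
    normc (gauss_term U1 U2 V W s s' t) <= K * expR (- (1 / 2 * t ^+ 2)) /\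
    normc (t%:C * gauss_term U1 U2 V W s s' t) <= K * expR (- (1 / 2 * t ^+ 2)).
Proof.
(* With this c each of the two factors adds at most (1 + t^2) / 8 to the exponent. Together they
   consume a quarter of the Gaussian, and the factor t of the second bound consumes another
   quarter. *)
move=> M0 g1 g2; pose c := (16 * (M ^+ 2 + 1))^-1.
have m0 : 0 < M ^+ 2 + 1 by rewrite ltr_wpDl// sqr_ge0.
have c0 : 0 < c by rewrite invr_gt0 mulr_gt0.
have [K1 K10 h1] := g1 c c0; have [K2 K20 h2] := g2 c c0.
exists (K1 * K2 * expR (1 / 4)); first by rewrite !mulr_ge0// expR_ge0.
move=> V W s s' VM WM sM s'M t.
have q (v v' : R[i]) : normc v <= M -> normc v' <= M ->
    c * normc (v + t%:C * v') ^+ 2 <= (1 + t ^+ 2) / 8.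
  move=> vM v'M; have : normc (v + t%:C * v') <= M * (1 + `|t|).
    rewrite (le_trans (le_normcD _ _))// Normc.normcM normcR mulrDr mulr1 lerD// mulrC.
    by rewrite ler_wpM2r.
  move=> h; have h' : normc (v + t%:C * v') ^+ 2 <= (M * (1 + `|t|)) ^+ 2.
    by rewrite ler_pXn2r ?nnegrE ?normc_ge0// mulr_ge0// addr_ge0.
  have h3 : (M * (1 + `|t|)) ^+ 2 <= (M ^+ 2 + 1) * (2 * (1 + t ^+ 2)).
    rewrite exprMn ler_pM ?sqr_ge0// ?lerDl//.
    rewrite -[t ^+ 2]real_normK ?num_real// -subr_ge0.
    have -> : 2 * (1 + `|t| ^+ 2) - (1 + `|t|) ^+ 2 = (1 - `|t|) ^+ 2 by ring.
    exact: sqr_ge0.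
  rewrite /c mulrC ler_pdivrMr ?mulr_gt0// (le_trans h')// (le_trans h3)//.
  rewrite le_eqVlt; apply/orP; left; apply/eqP; by field.
have b : normc (gauss_term U1 U2 V W s s' t) <= K1 * K2 * expR (1 / 4) * expR (- (3 / 4 * t ^+ 2)).
  rewrite /gauss_term !Normc.normcM normcR ger0_norm ?expR_ge0//.
  apply: (@le_trans _ _ (expR (- t ^+ 2) * ((K1 * expR (c * normc (V + t%:C * s) ^+ 2)) *
     (K2 * expR (c * normc (W + t%:C * s') ^+ 2))))).
    by rewrite ler_wpM2l ?expR_ge0// ler_pM ?normc_ge0.
  rewrite (_ : _ * (_ * _) = K1 * K2 * expR (- t ^+ 2 + c * normc (V + t%:C * s) ^+ 2 +
      c * normc (W + t%:C * s') ^+ 2)); last by rewrite !expRD; ring.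
  rewrite -[leRHS]mulrA ler_wpM2l ?mulr_ge0// -expRD ler_expR.
  have := q V s VM sM; have := q W s' WM s'M; lra.
have K0 : 0 <= K1 * K2 * expR (1 / 4) by rewrite !mulr_ge0// expR_ge0.
split.
  by rewrite (le_trans b)// ler_wpM2l// ler_expR lerN2 ler_wpM2r ?sqr_ge0//; lra.
rewrite Normc.normcM normcR.
apply: (@le_trans _ _ (expR (t ^+ 2 / 4) * (K1 * K2 * expR (1 / 4) * expR (- (3 / 4 * t ^+ 2))))).
  by rewrite ler_pM ?normc_ge0// normr_le_expR.
rewrite mulrCA ler_wpM2l// -expRD ler_expR le_eqVlt; apply/orP; left; apply/eqP; by field.
Qed.

Lemma is_derive_Nsqr t : is_derive t 1 (fun t : R => - t ^+ 2) (- (2 * t)).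
Proof.
apply: (is_derive_transport (is_deriveN (is_deriveM (is_derive_id t 1) (is_derive_id t 1)))).
  by move=> u; rewrite expr2.
by rewrite /GRing.scale /=; ring.
Qed.

Lemma cderiv_affine (V s : R[i]) t : cderiv (fun t => V + t%:C * s) t s.
Proof.
apply: (cderiv_transport (cderivD (cderiv_cst V t) (cderivM (cderiv_id t) (cderiv_cst s t)))).
by ring.
Qed.

Lemma cderiv_gauss_term U1 U1' U2 U2' (V W s s' : R[i]) t : cdiff U1 U1' -> cdiff U2 U2' ->
  cderiv (gauss_term U1 U2 V W s s') t
    (- (2 * (t%:C * gauss_term U1 U2 V W s s' t)) +
     (s * gauss_term U1' U2 V W s s' t + s' * gauss_term U1 U2' V W s s' t)).
Proof.
move=> d1 d2.
have := cderivM (cderiv_expR (is_derive_Nsqr t))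
  (cderivM (d1 _ _ _ (cderiv_affine V s t)) (d2 _ _ _ (cderiv_affine W s' t))).
move/cderiv_transport; apply; rewrite /gauss_term.
have -> : (- (2 * t) * expR (- t ^+ 2))%:C = - (2 * t%:C) * (expR (- t ^+ 2))%:C :> R[i].
  by rewrite rmorphM rmorphN rmorphM rmorph_nat.
by ring.
Qed.

Lemma cmeasurable_gauss_term U1 U1' U2 U2' (V W s s' : R[i]) : cdiff U1 U1' -> cdiff U2 U2' ->
  cmeasurable (gauss_term U1 U2 V W s s').
Proof.
by move=> d1 d2; apply: cderiv_cmeasurable => t; exact: cderiv_gauss_term d1 d2.
Qed.

Lemma cmeasurable_tgauss_term U1 U1' U2 U2' (V W s s' : R[i]) : cdiff U1 U1' -> cdiff U2 U2' ->
  cmeasurable (fun t => t%:C * gauss_term U1 U2 V W s s' t).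
Proof.
move=> d1 d2; apply: cderiv_cmeasurable => t.
exact: cderivM (cderiv_id t) (cderiv_gauss_term _ _ _ _ t d1 d2).
Qed.

Lemma cintegrable_gauss_term U1 U1' U2 U2' (V W s s' : R[i]) : cdiff U1 U1' -> cdiff U2 U2' ->
  subgaussian U1 -> subgaussian U2 ->
  cintegrable mu setT (gauss_term U1 U2 V W s s') /\
  cintegrable mu setT (fun t => t%:C * gauss_term U1 U2 V W s s' t).
Proof.
move=> d1 d2 g1 g2.
pose M := normc V + normc W + normc s + normc s'.
have := (normc_ge0 V, normc_ge0 W, normc_ge0 s, normc_ge0 s') => -[[[n1 n2] n3] n4].
have M0 : 0 <= M by rewrite !addr_ge0.
have [K K0 hK] := gauss_term_bound M0 g1 g2.
have [h1 h2] : (forall t, normc (gauss_term U1 U2 V W s s' t) <= K * expR (- (1 / 2 * t ^+ 2))) /\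
    (forall t, normc (t%:C * gauss_term U1 U2 V W s s' t) <= K * expR (- (1 / 2 * t ^+ 2))).
  by split=> t; have [] := hK V W s s' _ _ _ _ t; rewrite /M; lra.
have c0 : (0:R) < 1 / 2 by rewrite divr_gt0.
split; first exact: (cintegrable_gaussian c0 (cmeasurable_gauss_term _ _ _ _ d1 d2) h1).
exact: (cintegrable_gaussian c0 (cmeasurable_tgauss_term _ _ _ _ d1 d2) h2).
Qed.

(** Integration by parts with 2 t exp (- t^2) = - (exp (- t^2))': the factor t is traded for
    derivatives of the two functions, weighted by their slopes s and s'. *)
Lemma cintegral_tgauss U1 U1' U1'' U2 U2' U2'' (V W s s' : R[i]) :
  cdiff U1 U1' -> cdiff U2 U2' -> cdiff U1' U1'' -> cdiff U2' U2'' ->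
  subgaussian U1 -> subgaussian U2 -> subgaussian U1' -> subgaussian U2' ->
  cintegral mu setT (fun t => t%:C * gauss_term U1 U2 V W s s' t) =
  2^-1 * (s * gauss_int U1' U2 V W s s' + s' * gauss_int U1 U2' V W s s').
Proof.
move=> d1 d2 e1 e2 g1 g2 g1' g2'.
have [i1 i2] := cintegrable_gauss_term V W s s' d1 d2 g1 g2.
have [i3 _] := cintegrable_gauss_term V W s s' e1 d2 g1' g2.
have [i4 _] := cintegrable_gauss_term V W s s' d1 e2 g1 g2'.
pose F := gauss_term U1 U2 V W s s'.
pose f t := - (2 * (t%:C * gauss_term U1 U2 V W s s' t)) +
  (s * gauss_term U1' U2 V W s s' t + s' * gauss_term U1 U2' V W s s' t).
have i5 : cintegrable mu setT (fun t => s * gauss_term U1' U2 V W s s' t + s' * gauss_term U1 U2' V W s s' t).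
  by apply: cintegrableD; exact: cintegrableZ.
have i6 : cintegrable mu setT (fun t => - 2 * (t%:C * gauss_term U1 U2 V W s s' t)).
  exact: cintegrableZ.
have iF : cintegrable mu setT f.
  have := cintegrableD i6 i5; congr cintegrable; apply/funext => t.
  by rewrite /f mulNr.
pose f' t := - (2 * (1 * F t + t%:C * f t)) +
  (s * (- (2 * (t%:C * gauss_term U1' U2 V W s s' t)) +
     (s * gauss_term U1'' U2 V W s s' t + s' * gauss_term U1' U2' V W s s' t)) +
   s' * (- (2 * (t%:C * gauss_term U1 U2' V W s s' t)) +
     (s * gauss_term U1' U2' V W s s' t + s' * gauss_term U1 U2'' V W s s' t))).
have dF t : cderiv F t (f t) by exact: cderiv_gauss_term.
have df t : cderiv f t (f' t).
  apply: cderivD.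
    by apply: cderivN; apply: cderivZ; exact: cderivM (cderiv_id t) (dF t).
  by apply: cderivD; apply: cderivZ; exact: cderiv_gauss_term.
pose M := normc V + normc W + normc s + normc s'.
have := (normc_ge0 V, normc_ge0 W, normc_ge0 s, normc_ge0 s') => -[[[n1 n2] n3] n4].
have M0 : 0 <= M by rewrite !addr_ge0.
have [K K0 hK] := gauss_term_bound M0 g1 g2.
have FK t : normc (F t) <= K * expR (- (1 / 2 * t ^+ 2)).
  by have [] := hK V W s s' _ _ _ _ t; rewrite /M; lra.
have c0 : (0:R) < 1 / 2 by rewrite divr_gt0.
have [z1 z2] := cintegral_deriv_vanish c0 dF df iF FK.
have z : cintegral mu setT f = 0 by apply: complexP.
have : cintegral mu setT f = - 2 * cintegral mu setT (fun t => t%:C * gauss_term U1 U2 V W s s' t)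
   + (s * gauss_int U1' U2 V W s s' + s' * gauss_int U1 U2' V W s s').
  rewrite /gauss_int -(cintegralZ _ i2) -(cintegralZ _ i3) -(cintegralZ _ i4).
  rewrite -(cintegralD (cintegrableZ _ i3) (cintegrableZ _ i4)) -(cintegralD i6 i5).
  by apply: cintegral_ext => t; rewrite /f mulNr.
rewrite z; set T := cintegral _ _ _; set Q := s * _ + _ => /esym/eqP.
rewrite mulNr addrC subr_eq0 => /eqP ->.
by rewrite mulKf// pnatr_eq0.
Qed.

(** Moving slopes bring a factor t into the integrand; it is kept here and removed afterwards by
    [airy_int_t]. *)
Lemma cderiv_gauss_int U1 U1' U1'' U2 U2' U2'' (V W s s' dV dW ds ds' ddV ddW dds dds' : R -> R[i]) u :
  cdiff U1 U1' -> cdiff U2 U2' -> cdiff U1' U1'' -> cdiff U2' U2'' ->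
  subgaussian U1 -> subgaussian U2 -> subgaussian U1' -> subgaussian U2' ->
  (forall x, cderiv V x (dV x)) -> (forall x, cderiv W x (dW x)) ->
  (forall x, cderiv s x (ds x)) -> (forall x, cderiv s' x (ds' x)) ->
  cderiv dV u (ddV u) -> cderiv dW u (ddW u) -> cderiv ds u (dds u) -> cderiv ds' u (dds' u) ->
  cderiv (fun x => gauss_int U1 U2 (V x) (W x) (s x) (s' x)) u
   (dV u * gauss_int U1' U2 (V u) (W u) (s u) (s' u)
  + dW u * gauss_int U1 U2' (V u) (W u) (s u) (s' u)
  + (ds u * cintegral mu setT (fun t => t%:C * gauss_term U1' U2 (V u) (W u) (s u) (s' u) t)
  + ds' u * cintegral mu setT (fun t => t%:C * gauss_term U1 U2' (V u) (W u) (s u) (s' u) t))).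
Proof.
move=> d1 d2 e1 e2 g1 g2 g1' g2' hV hW hs hs' hdV hdW hds hds'.
pose N (F : R -> R[i]) := normc (F u) + 2.
pose M := N V + N W + N s + N s' + N dV + N dW + N ds + N ds'.
have N0 F : 0 <= N F by rewrite addr_ge0// normc_ge0.
have M0 : 0 <= M by rewrite /M /N !addr_ge0 ?normc_ge0.
pose P y := [/\ normc (V y) <= M, normc (W y) <= M, normc (s y) <= M & normc (s' y) <= M] /\
  [/\ normc (dV y) <= M, normc (dW y) <= M, normc (ds y) <= M & normc (ds' y) <= M].
have [m1 m2 m3 m4] : [/\ N V <= M, N W <= M, N s <= M & N s' <= M].
  by have [] := (N0 V, N0 W); have [] := (N0 s, N0 s'); have [] := (N0 dV, N0 dW);
     have [] := (N0 ds, N0 ds'); rewrite /M; split; lra.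
have [m5 m6 m7 m8] : [/\ N dV <= M, N dW <= M, N ds <= M & N ds' <= M].
  by have [] := (N0 V, N0 W); have [] := (N0 s, N0 s'); have [] := (N0 dV, N0 dW);
     have [] := (N0 ds, N0 ds'); rewrite /M; split; lra.
have nP : \forall y \near u, P y.
  near=> y; split; split.
  - by apply: le_trans m1; near: y; exact: cderiv_near_bound (hV u).
  - by apply: le_trans m2; near: y; exact: cderiv_near_bound (hW u).
  - by apply: le_trans m3; near: y; exact: cderiv_near_bound (hs u).
  - by apply: le_trans m4; near: y; exact: cderiv_near_bound (hs' u).
  - by apply: le_trans m5; near: y; exact: cderiv_near_bound hdV.
  - by apply: le_trans m6; near: y; exact: cderiv_near_bound hdW.
  - by apply: le_trans m7; near: y; exact: cderiv_near_bound hds.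
  - by apply: le_trans m8; near: y; exact: cderiv_near_bound hds'.
have [u1 [u2 [u12 hP]]] := near_itv nP.
have [K1 K10 h1] := gauss_term_bound M0 g1' g2.
have [K2 K20 h2] := gauss_term_bound M0 g1 g2'.
pose dF x t := dV x * gauss_term U1' U2 (V x) (W x) (s x) (s' x) t
  + dW x * gauss_term U1 U2' (V x) (W x) (s x) (s' x) t
  + (ds x * (t%:C * gauss_term U1' U2 (V x) (W x) (s x) (s' x) t)
  + ds' x * (t%:C * gauss_term U1 U2' (V x) (W x) (s x) (s' x) t)).
have c0 : (0:R) < 1 / 2 by rewrite divr_gt0.
have := @cderiv_under_integral _ _ _ mu (fun x => gauss_term U1 U2 (V x) (W x) (s x) (s' x)) dF
  (fun t => M * (2 * (K1 + K2)) * expR (- (1 / 2 * t ^+ 2))) u u1 u2 u12.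
move=> /(_ _ _ _ _)/cderiv_transport; apply.
- by move=> x _; case: (cintegrable_gauss_term (V x) (W x) (s x) (s' x) d1 d2 g1 g2).
- move=> x t _.
  have a1 := cderivD (hV x) (cderivZ t%:C (hs x)).
  have a2 := cderivD (hW x) (cderivZ t%:C (hs' x)).
  have := cderivZ (expR (- t ^+ 2))%:C (cderivM (d1 _ _ _ a1) (d2 _ _ _ a2)).
  move/cderiv_transport; apply; rewrite /dF /gauss_term.
  by ring.
- exact: integrable_scale (integrable_gaussian c0).
- move=> x t /hP[[VM WM sM s'M] [dVM dWM dsM ds'M]].
  have [b1 b2] := h1 _ _ _ _ VM WM sM s'M t; have [b3 b4] := h2 _ _ _ _ VM WM sM s'M t.
  set g := expR _ in b1 b2 b3 b4 *.
  have -> : M * (2 * (K1 + K2)) * g = M * (K1 * g) + M * (K2 * g) + (M * (K1 * g) + M * (K2 * g)).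
    by ring.
  have bnd w T0 K : normc w <= M -> normc T0 <= K -> normc (w * T0) <= M * K.
    by move=> *; rewrite Normc.normcM ler_pM// normc_ge0.
  by rewrite /dF (le_trans (le_normcD _ _))// lerD// (le_trans (le_normcD _ _))// lerD// bnd.
- have [i1 i2] := cintegrable_gauss_term (V u) (W u) (s u) (s' u) e1 d2 g1' g2.
  have [i3 i4] := cintegrable_gauss_term (V u) (W u) (s u) (s' u) d1 e2 g1 g2'.
  have Z w f : cintegrable mu setT f -> cintegrable mu setT (fun t => w * f t) by exact: cintegrableZ.
  rewrite /dF /gauss_int cintegralD; last 2 first.
  + by apply: cintegrableD; apply: Z.
  + by apply: cintegrableD; apply: Z.
  by rewrite !cintegralD ?cintegralZ//; apply: Z.
Unshelve. all: end_near. Qed.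

End AiryGaussian.

(** * Rational identities behind the Airy solution *)

Section AiryAlgebra.
Variable F : numFieldType.

(* In these identities the H's stand for the Gaussian integrals of products of
   derivatives of Airy functions, scaled by powers of k with 12 k^3 = 1, and
   t stands for exp (i t0). *)
Section Reduced.
Variables (a X Y da dX dY t H00 H10 H01 H11 : F).
Let al := t^-1.
Let V := X + a ^+ 2 / 3 * (2 * t + al ^+ 2).
Let W := Y + a ^+ 2 / 3 * (2 * al + t ^+ 2).
Let dV := dX + 2 * a * da / 3 * (2 * t + al ^+ 2).
Let dW := dY + 2 * a * da / 3 * (2 * al + t ^+ 2).
Let H20 := - (V / 12) * H00 + a / 3 * (al * H10 + H01).
Let H02 := - (W / 12) * H00 + a / 3 * (H10 + t * H01).
Let H21 := - (V / 12) * H01 + a / 3 * (al * H11 + H02).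
Let H12 := - (W / 12) * H10 + a / 3 * (H20 + t * H11).
Let H30 := H00 / 12 + - (V / 12) * H10 + a / 3 * (al * H20 + H11).
Let H03 := H00 / 12 + - (W / 12) * H01 + a / 3 * (H11 + t * H02).
Let H31 := H01 / 12 + - (V / 12) * H11 + a / 3 * (al * H21 + H12).
Let H13 := H10 / 12 + - (W / 12) * H11 + a / 3 * (H21 + t * H12).
Let H22 := - (V / 12) * H02 + a / 3 * (al * H12 + H03).
Let D H1 H2 H20 H11 H02 := - dV * H1 - dW * H2 + 2 * da * (al * H20 + 2 * H11 + t * H02).
Let dp := da / 6 * (X * al + Y * t) + a / 6 * (dX * al + dY * t)
  + a ^+ 2 * da / 9 * (3 + (t ^+ 3 + al ^+ 3) / 2).
Let r0 := H00.
Let r1 := a * al / 6 * H00 - H10.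
Let r2 := a * t / 6 * H00 - H01.
Let r3 := a ^+ 2 / 36 * H00 - a * al / 6 * H01 - a * t / 6 * H10 + H11.
Let d00 := D H10 H01 H20 H11 H02.
Let d10 := D H20 H11 H30 H21 H12.
Let d01 := D H11 H02 H21 H12 H03.
Let d11 := D H21 H12 H31 H22 H13.
Let l20 := 2 / 3 * (2 * a * r2 + X * r0 / 2).
Let l02 := 2 / 3 * (2 * a * r1 + Y * r0 / 2).
Let l22 := - (4 / 9) * a * (- 4 * a * r3 - X * r1 - r0) + 1 / 3 * Y * l20.

Hypothesis t0 : t != 0.

(** The four identities are the rows of the system in the normalisation of [umb_field_real]. Here dp
    is the derivative of the exponent [airy_phase], D that of a scaled integral along the path, and
    r0, ..., r3 are the entries stripped of the exponential and of powers of 2 i. *)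
Lemma airy_reduced0 : dp * r0 + d00 = 4 * da * r3 + dX * r1 + dY * r2.
Proof.
rewrite /r0 /r1 /r2 /r3 /dp /d00 /D /dV /dW /H20 /H02 /V /W /al.
by field.
Qed.

Lemma airy_reduced1 : dp * r1 + (da * al / 6 * H00 + a * al / 6 * d00 - d10) =
  1 / 3 * da * (a * l02 - X * r2) - dX * l20 / 4 + dY * r3.
Proof.
rewrite /l20 /l02 /r0 /r1 /r2 /r3 /dp /d00 /d10 /D /dV /dW /H30 /H21 /H12 /H20 /H02 /V /W /al.
by field.
Qed.

Lemma airy_reduced2 : dp * r2 + (da * t / 6 * H00 + a * t / 6 * d00 - d01) =
  1 / 3 * da * (a * l20 - Y * r1) + dX * r3 - dY * l02 / 4.
Proof.
rewrite /l20 /l02 /r0 /r1 /r2 /r3 /dp /d00 /d01 /D /dV /dW /H03 /H21 /H12 /H20 /H02 /V /W /al.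
by field.
Qed.

Lemma airy_reduced3 : - 4 * (dp * r3 + (2 * a * da / 36 * H00 + a ^+ 2 / 36 * d00
    - da * al / 6 * H01 - a * al / 6 * d01 - da * t / 6 * H10 - a * t / 6 * d10 + d11)) =
  - (da * l22) - 1 / 3 * (dX * (a * l02 - X * r2) + dY * (a * l20 - Y * r1)).
Proof.
rewrite /l22 /l20 /l02 /r0 /r1 /r2 /r3 /dp /d00 /d01 /d10 /d11 /D /dV /dW.
rewrite /H22 /H31 /H13 /H03 /H30 /H21 /H12 /H20 /H02 /V /W /al.
by field.
Qed.

End Reduced.

Lemma scaled_step_l (k b S S' t V x0 x1 x2 : F) m : 12 * k ^+ 3 = 1 ->
  S * S = 8 * t^-1 -> S * S' = 8 ->
  k ^+ m.+2 * (- k * V * x0 + b * k * S / 2 * (b * k * S * x1 + b * k * S' * x2)) =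
  - (V / 12) * (k ^+ m * x0) + b ^+ 2 / 3 * (t^-1 * (k ^+ m.+1 * x1) + k ^+ m.+1 * x2).
Proof.
move=> k3 SS SS'; have k3' : k ^+ 3 = 12^-1.
  by apply: (mulfI (x := 12)); rewrite ?pnatr_eq0// k3 mulfV ?pnatr_eq0.
rewrite !exprS; set K := k ^+ m.
transitivity (- (k ^+ 3) * V * (K * x0) +
  b ^+ 2 / 2 * k ^+ 3 * (S * S * (k * K * x1) + S * S' * (k * K * x2))); first by field.
by rewrite k3' SS SS'; move: (t^-1) => al; field.
Qed.

Lemma scaled_step_r (k b S S' t W x0 x1 x2 : F) m : 12 * k ^+ 3 = 1 ->
  S' * S' = 8 * t -> S * S' = 8 ->
  k ^+ m.+2 * (- k * W * x0 + b * k * S' / 2 * (b * k * S * x1 + b * k * S' * x2)) =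
  - (W / 12) * (k ^+ m * x0) + b ^+ 2 / 3 * (k ^+ m.+1 * x1 + t * (k ^+ m.+1 * x2)).
Proof.
move=> k3 SS SS'; have k3' : k ^+ 3 = 12^-1.
  by apply: (mulfI (x := 12)); rewrite ?pnatr_eq0// k3 mulfV ?pnatr_eq0.
rewrite !exprS; set K := k ^+ m.
transitivity (- (k ^+ 3) * W * (K * x0) +
  b ^+ 2 / 2 * k ^+ 3 * (S * S' * (k * K * x1) + S' * S' * (k * K * x2))); first by field.
by rewrite k3' SS SS'; field.
Qed.

Lemma scaled_deriv (k b b' S S' t dV dW x1 x2 x20 x11 x02 : F) m :
  S * S = 8 * t^-1 -> S * S' = 8 -> S' * S' = 8 * t ->
  k ^+ m * (- k * dV * x1 + - k * dW * x2 +
    (b' * k * S * (2^-1 * (b * k * S * x20 + b * k * S' * x11))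
     + b' * k * S' * (2^-1 * (b * k * S * x11 + b * k * S' * x02)))) =
  - dV * (k ^+ m.+1 * x1) - dW * (k ^+ m.+1 * x2) + 2 * (2 * b * b') *
    (t^-1 * (k ^+ m.+2 * x20) + 2 * (k ^+ m.+2 * x11) + t * (k ^+ m.+2 * x02)).
Proof.
move=> SS SS' SS''; rewrite !exprS; set K := k ^+ m.
transitivity (- dV * (k * K * x1) - dW * (k * K * x2) + b * b' / 2 *
  (S * S * (k * (k * K) * x20) + 2 * (S * S') * (k * (k * K) * x11) + S' * S' * (k * (k * K) * x02))).
  by field.
by rewrite SS SS' SS''; move: (t^-1) => al; field.
Qed.

End AiryAlgebra.

(** * The Airy integrals as a solution of the moment system *)

Section AirySide.
Context {R : realType}.
Local Notation mu := (@lebesgue_measure R).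
Implicit Types (w v : R[i]) (t : R).
Variables (U U' : R[i] -> R[i]).
Hypothesis UU' : airy_pair U U'.

(* The successive derivatives of a solution of U'' = w U. *)
Definition airy_family (n : nat) : R[i] -> R[i] :=
  match n with
  | 0%N => U
  | 1%N => U'
  | 2%N => fun w => w * U w
  | 3%N => fun w => U w + w * U' w
  | _ => fun w => U' w + (U' w + w * (w * U w))
  end.

Lemma airy_family_diff n : (n < 4)%N -> cdiff (airy_family n) (airy_family n.+1).
Proof.
have [d1 d2 g1 g2] := UU'.
case: n => [|[|[|[|//]]]] _ //=; first exact: cdiff_mulid.
by apply: cdiffD => //; exact: cdiff_mulid.
Qed.

Lemma airy_family_subgaussian n : (n < 4)%N -> subgaussian (airy_family n).
Proof.
have [d1 d2 g1 g2] := UU'.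
case: n => [|[|[|[|//]]]] _ //=; first exact: subgaussian_mulid.
by apply: subgaussianD => //; exact: subgaussian_mulid.
Qed.

Definition airy_int (i j : nat) (V W s s' : R[i]) :=
  gauss_int (airy_family i) (airy_family j) V W s s'.

Lemma airy_int_t i j V W s s' : (i < 3)%N -> (j < 3)%N ->
  cintegral mu setT (fun t => t%:C * gauss_term (airy_family i) (airy_family j) V W s s' t) =
  2^-1 * (s * airy_int i.+1 j V W s s' + s' * airy_int i j.+1 V W s s').
Proof.
move=> i3 j3; apply: cintegral_tgauss;
  [apply: airy_family_diff|apply: airy_family_diff|apply: airy_family_diff|apply: airy_family_diff
  |apply: airy_family_subgaussian|apply: airy_family_subgaussian
  |apply: airy_family_subgaussian|apply: airy_family_subgaussian] => //;
  by rewrite ltnS ltnW.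
Qed.

Lemma cintegrable_airy i j V W s s' : (i < 4)%N -> (j < 4)%N ->
  cintegrable mu setT (gauss_term (airy_family i) (airy_family j) V W s s') /\
  cintegrable mu setT (fun t => t%:C * gauss_term (airy_family i) (airy_family j) V W s s' t).
Proof.
move=> i4 j4; apply: (cintegrable_gauss_term _ _ _ _ (airy_family_diff i4) (airy_family_diff j4));
exact: airy_family_subgaussian.
Qed.

Lemma gauss_intC (A B : R[i] -> R[i]) V W s s' : gauss_int A B V W s s' = gauss_int B A W V s' s.
Proof. by apply: cintegral_ext => t; rewrite /gauss_term [A _ * _]mulrC. Qed.

(** The equation U'' = w U is used at w = V + t s, and the resulting factor t is integrated by
    parts. *)
Lemma airy_int2l j V W s s' : (j < 3)%N -> airy_int 2 j V W s s' =
  V * airy_int 0 j V W s s' + s / 2 * (s * airy_int 1 j V W s s' + s' * airy_int 0 j.+1 V W s s').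
Proof.
move=> j3; have [i1 i2] := cintegrable_airy V W s s' (isT : (0 < 4)%N) (ltnW j3).
rewrite -mulrA -(airy_int_t V W s s' (isT : (0 < 3)%N) j3).
rewrite -(cintegralZ s i2) -(cintegralZ V i1) -cintegralD; try exact: cintegrableZ.
apply: cintegral_ext => t; rewrite /gauss_term /=.
by move: (expR _)%:C (U _) (airy_family j _) => A B C; ring.
Qed.

Lemma airy_int3l j V W s s' : (j < 3)%N -> airy_int 3 j V W s s' =
  airy_int 0 j V W s s' + V * airy_int 1 j V W s s'
  + s / 2 * (s * airy_int 2 j V W s s' + s' * airy_int 1 j.+1 V W s s').
Proof.
move=> j3; have [i1 i2] := cintegrable_airy V W s s' (isT : (1 < 4)%N) (ltnW j3).
have [i0 _] := cintegrable_airy V W s s' (isT : (0 < 4)%N) (ltnW j3).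
rewrite -mulrA -(airy_int_t V W s s' (isT : (1 < 3)%N) j3).
rewrite -(cintegralZ s i2) -(cintegralZ V i1) -(cintegralD i0 (cintegrableZ V i1)).
rewrite -(cintegralD (cintegrableD i0 (cintegrableZ V i1)) (cintegrableZ s i2)).
apply: cintegral_ext => t; rewrite /gauss_term /=.
by move: (expR _)%:C (U _) (U' _) (airy_family j _) => A B C D; ring.
Qed.

(** The left-hand reduction after exchanging the two factors, that is (V, s) with (W, s'). *)
Lemma airy_int2r i V W s s' : (i < 3)%N -> airy_int i 2 V W s s' =
  W * airy_int i 0 V W s s' + s' / 2 * (s * airy_int i.+1 0 V W s s' + s' * airy_int i 1 V W s s').
Proof.
move=> i3; rewrite /airy_int ![gauss_int (airy_family _) _ V W s s']gauss_intC.
by have := airy_int2l W V s' s i3; rewrite /airy_int => ->; rewrite [s' * _ + _]addrC.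
Qed.

Lemma airy_int3r i V W s s' : (i < 3)%N -> airy_int i 3 V W s s' =
  airy_int i 0 V W s s' + W * airy_int i 1 V W s s'
  + s' / 2 * (s * airy_int i.+1 1 V W s s' + s' * airy_int i 2 V W s s').
Proof.
move=> i3; rewrite /airy_int ![gauss_int (airy_family _) _ V W s s']gauss_intC.
by have := airy_int3l W V s' s i3; rewrite /airy_int => ->; rewrite [s' * _ + _]addrC.
Qed.

(** Taking 2 i, 2 i and -4 out of the entries removes the imaginary unit from the system by i^2 =
    -1, so that the comparison with the Airy side becomes rational. *)
Lemma umb_field_real (a X Y a' X' Y' r0 r1 r2 r3 : R[i]) (vec : nat -> R[i]) :
  vec 0%N = r0 -> vec 1%N = 2 * 'i * r1 -> vec 2%N = 2 * 'i * r2 -> vec 3%N = -4 * r3 ->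
  let l20 := 2 / 3 * (2 * a * r2 + X * r0 / 2) in
  let l02 := 2 / 3 * (2 * a * r1 + Y * r0 / 2) in
  let l22 := - (4 / 9) * a * (- 4 * a * r3 - X * r1 - r0) + 1 / 3 * Y * l20 in
  [/\ umb_field a X Y a' X' Y' vec 0 = 4 * a' * r3 + X' * r1 + Y' * r2,
      umb_field a X Y a' X' Y' vec 1 =
        2 * 'i * (1 / 3 * a' * (a * l02 - X * r2) - X' * l20 / 4 + Y' * r3),
      umb_field a X Y a' X' Y' vec 2 =
        2 * 'i * (1 / 3 * a' * (a * l20 - Y * r1) + X' * r3 - Y' * l02 / 4) &
      umb_field a X Y a' X' Y' vec 3 =
        - (a' * l22) - 1 / 3 * (X' * (a * l02 - X * r2) + Y' * (a * l20 - Y * r1))].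
Proof.
move=> v0 v1 v2 v3 /=; rewrite /umb_field /umb_kappa v0 v1 v2 v3.
have i2 : - ('i * 'i) = 1 :> R[i] by rewrite -expr2 sqrCi opprK.
set I := ('i)%R in i2 *.
have e20 : - (2 * I / 3) * (a * (2 * I * r2) + I / 2 * X * r0) =
    2 / 3 * (2 * a * r2 + X * r0 / 2).
  transitivity (- (I * I) * (2 / 3 * (2 * a * r2 + X * r0 / 2))); [by field|by rewrite i2 mul1r].
have e02 : - (2 * I / 3) * (a * (2 * I * r1) + I / 2 * Y * r0) =
    2 / 3 * (2 * a * r1 + Y * r0 / 2).
  transitivity (- (I * I) * (2 / 3 * (2 * a * r1 + Y * r0 / 2))); [by field|by rewrite i2 mul1r].
rewrite e20 e02.
set l20 := 2 / 3 * (2 * a * r2 + _); set l02 := 2 / 3 * (2 * a * r1 + _).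
have e12 : - (2 * I / 3) * (a * l20 + I / 2 * Y * (2 * I * r1)) = - (2 / 3) * I * (a * l20 - Y * r1).
  transitivity (- (2 / 3) * I * (a * l20 - - (I * I) * (Y * r1))); first by field.
  by rewrite i2 mul1r.
have e21 : - (2 * I / 3) * (a * l02 + I / 2 * X * (2 * I * r2)) = - (2 / 3) * I * (a * l02 - X * r2).
  transitivity (- (2 / 3) * I * (a * l02 - - (I * I) * (X * r2))); first by field.
  by rewrite i2 mul1r.
have e30 : - (2 * I / 3) * (a * (-4 * r3) + I / 2 * X * (2 * I * r1) - r0) =
    - (2 / 3) * I * (- 4 * a * r3 - X * r1 - r0).
  transitivity (- (2 / 3) * I * (- 4 * a * r3 - - (I * I) * (X * r1) - r0)); first by field.
  by rewrite i2 mul1r.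
rewrite e12 e21 e30.
have e22 : - (2 * I / 3) * (a * (- (2 / 3) * I * (- 4 * a * r3 - X * r1 - r0)) + I / 2 * Y * l20) =
    - (4 / 9) * a * (- 4 * a * r3 - X * r1 - r0) + 1 / 3 * Y * l20.
  transitivity (- (I * I) * (- (4 / 9) * a * (- 4 * a * r3 - X * r1 - r0) + 1 / 3 * Y * l20));
    [by field|by rewrite i2 [LHS]mul1r].
rewrite e22; split.
- transitivity (4 * a' * r3 + - (I * I) * (X' * r1 + Y' * r2)); first by field.
  by rewrite i2 mul1r addrA.
- by field.
- by field.
- set q1 := a * l02 - X * r2; set q2 := a * l20 - Y * r1; set q3 := _ + 1 / 3 * Y * l20.
  transitivity (- (a' * q3) - - (I * I) * (1 / 3 * (X' * q1 + Y' * q2))); first by field.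
  by rewrite i2 [1 * (1 / 3 * _)]mul1r.
Qed.

Section Path.
Variables (k tau S S' b0 b1 X1 Y1 : R[i]).
Hypothesis k3 : 12 * k ^+ 3 = 1.
Hypothesis tau0 : tau != 0.
Hypothesis SS : S * S = 8 * tau^-1.
Hypothesis SS' : S * S' = 8.
Hypothesis SS'' : S' * S' = 8 * tau.

(* Paths are straight in b = sqrt a, not in a, because the arguments of the Airy
   functions are affine in b. *)
Definition path_b u : R[i] := b0 + u%:C * b1.
Definition path_a u : R[i] := path_b u ^+ 2.
Definition path_a' u : R[i] := 2 * path_b u * b1.
Definition path_X u : R[i] := u%:C * X1.
Definition path_Y u : R[i] := u%:C * Y1.

(** With zeta and conj(zeta) independent, - i/2 times [airy_arg a X tau] is the derivative of
    [umb_phase] in conj(zeta) at zeta = i a tau / 3, conj(zeta) = i a / (3 tau). Exchanging X with Y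
    and tau with its inverse gives the derivative in zeta. *)
Definition airy_arg (a X t : R[i]) : R[i] := X + a ^+ 2 / 3 * (2 * t + t^-1 ^+ 2).
(** The value of [umb_phase] at the same formal point. *)
Definition airy_phase (a X Y t : R[i]) : R[i] :=
  a / 6 * (X * t^-1 + Y * t) + a ^+ 3 / 27 * (3 + (t ^+ 3 + t^-1 ^+ 3) / 2).

(** The factor k^(i + j) is what the chain rule produces when the arguments - k V and - k W are
    differentiated, up to sign; it makes the coefficients of all recurrences rational. *)
Definition airy_moment (a b X Y : R[i]) (i j : nat) : R[i] :=
  k ^+ (i + j) * airy_int i j (- k * airy_arg a X tau) (- k * airy_arg a Y tau^-1)
    (b * k * S) (b * k * S').

(* Entries 1, 2, 3 arise from entry 0 under the operators 2i d/dX, 2i d/dY and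
   their product, which raise the indices of the moments of the umbilic integrand. *)
Definition airy_vec (a b X Y : R[i]) (i : nat) : R[i] :=
  let T := airy_moment a b X Y in
  let e := cexp (airy_phase a X Y tau) in
  match i with
  | 0%N => e * T 0%N 0%N
  | 1%N => 2 * 'i * (e * (a * tau^-1 / 6 * T 0%N 0%N - T 1%N 0%N))
  | 2%N => 2 * 'i * (e * (a * tau / 6 * T 0%N 0%N - T 0%N 1%N))
  | _ => - 4 * (e * (a ^+ 2 / 36 * T 0%N 0%N - a * tau^-1 / 6 * T 0%N 1%N
                     - a * tau / 6 * T 1%N 0%N + T 1%N 1%N))
  end.

Let T i j u := airy_moment (path_a u) (path_b u) (path_X u) (path_Y u) i j.

Lemma cderiv_path_b u : cderiv path_b u b1.
Proof.
apply: (cderiv_transport (cderivD (cderiv_cst b0 u) (cderivM (cderiv_id u) (cderiv_cst b1 u)))).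
by ring.
Qed.

Lemma cderiv_path_a u : cderiv path_a u (path_a' u).
Proof.
apply: (cderiv_transport (cderivX 2 (cderiv_path_b u))).
by rewrite /path_a' /= expr1.
Qed.

Lemma cderiv_path_a' u : cderiv path_a' u (2 * b1 ^+ 2).
Proof.
apply: (cderiv_transport (cderivM (cderivZ 2 (cderiv_path_b u)) (cderiv_cst b1 u))).
by ring.
Qed.

Lemma cderiv_lin (w : R[i]) u : cderiv (fun t => t%:C * w) u w.
Proof.
by apply: (cderiv_transport (cderivM (cderiv_id u) (cderiv_cst w u))); ring.
Qed.

Definition airy_arg' (X1' t : R[i]) u : R[i] := X1' + 2 * path_a u * path_a' u / 3 * (2 * t + t^-1 ^+ 2).

Lemma cderiv_airy_arg (Z t : R[i]) u :
  cderiv (fun u => airy_arg (path_a u) (u%:C * Z) t) u (airy_arg' Z t u).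
Proof.
apply: (cderiv_transport (cderivD (cderiv_lin Z u)
  (cderivM (cderivM (cderivX 2 (cderiv_path_a u)) (cderiv_cst 3^-1 u)) (cderiv_cst (2 * t + t^-1 ^+ 2) u)))).
by rewrite /airy_arg' /= expr1; move: (2 * t + _) => q; field.
Qed.

Lemma cderiv_airy_arg' (Z t : R[i]) u : exists w, cderiv (airy_arg' Z t) u w.
Proof.
eexists; apply: cderivD; first exact: cderiv_cst.
apply: cderivM; last exact: cderiv_cst.
apply: cderivM; last exact: cderiv_cst.
apply: cderivM; last exact: cderiv_path_a'.
by apply: cderivM; [exact: cderiv_cst|exact: cderiv_path_a].
Qed.

Lemma cderiv_airy_moment i j u : (i < 2)%N -> (j < 2)%N -> cderiv (T i j) u
  (- airy_arg' X1 tau u * T i.+1 j u - airy_arg' Y1 tau^-1 u * T i j.+1 u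
   + 2 * path_a' u * (tau^-1 * T i.+2 j u + 2 * T i.+1 j.+1 u + tau * T i j.+2 u)).
Proof.
move=> i2 j2.
have lt n : (n < 2)%N -> (n < 4)%N by move=> h; exact: (leq_trans h).
have lt1 n : (n < 2)%N -> (n.+1 < 4)%N by move=> h; exact: (@leq_trans 3).
have dV x := cderivZ (- k) (cderiv_airy_arg X1 tau x).
have dW x := cderivZ (- k) (cderiv_airy_arg Y1 tau^-1 x).
have [ddV hV] := cderiv_airy_arg' X1 tau u; have [ddW hW] := cderiv_airy_arg' Y1 tau^-1 u.
have ds x : cderiv (fun x => path_b x * k * S) x (b1 * k * S).
  apply: (cderiv_transport (cderivM (cderivM (cderiv_path_b x) (cderiv_cst k x)) (cderiv_cst S x))).
  by ring.
have ds' x : cderiv (fun x => path_b x * k * S') x (b1 * k * S').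
  apply: (cderiv_transport (cderivM (cderivM (cderiv_path_b x) (cderiv_cst k x)) (cderiv_cst S' x))).
  by ring.
have := @cderiv_gauss_int R _ _ _ _ _ _ _ _ _ _ _ _ _ _ (fun=> - k * ddV) (fun=> - k * ddW)
  (fun=> 0) (fun=> 0) u (airy_family_diff (lt _ i2)) (airy_family_diff (lt _ j2))
  (airy_family_diff (lt1 _ i2)) (airy_family_diff (lt1 _ j2))
  (airy_family_subgaussian (lt _ i2)) (airy_family_subgaussian (lt _ j2))
  (airy_family_subgaussian (lt1 _ i2)) (airy_family_subgaussian (lt1 _ j2))
  dV dW ds ds' (cderivZ (- k) hV) (cderivZ (- k) hW) (cderiv_cst _ _) (cderiv_cst _ _).
move/(cderivZ (k ^+ (i + j)))/cderiv_transport; apply.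
rewrite !airy_int_t//; try exact: (leq_trans i2); try exact: (leq_trans j2).
rewrite -!/(airy_int _ _ _ _ _ _) (scaled_deriv _ _ _ _ _ _ _ _ _ _ _ SS SS' SS'').
by rewrite /T /airy_moment /path_a' !(addSn, addnS).
Qed.

Let Vt u := airy_arg (path_a u) (path_X u) tau.
Let Wt u := airy_arg (path_a u) (path_Y u) tau^-1.

Lemma airy_moment2l j u : (j < 3)%N -> T 2 j u = - (Vt u / 12) * T 0 j u
  + path_a u / 3 * (tau^-1 * T 1 j u + T 0 j.+1 u).
Proof.
move=> j3; rewrite /T /airy_moment airy_int2l//.
by rewrite !(addSn, addnS, add0n) (scaled_step_l _ _ _ _ _ _ k3 SS SS').
Qed.

Lemma airy_moment2r i u : (i < 3)%N -> T i 2 u = - (Wt u / 12) * T i 0 u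
  + path_a u / 3 * (T i.+1 0 u + tau * T i 1 u).
Proof.
move=> i3; rewrite /T /airy_moment airy_int2r//.
by rewrite !(addSn, addnS, addn0) (scaled_step_r _ _ _ _ _ _ k3 SS'' SS').
Qed.

Lemma airy_scale3 (w : R[i]) m : k ^+ m.+3 * w = k ^+ m * w / 12.
Proof.
have k3' : k ^+ 3 = 12^-1.
  by apply: (mulfI (x := 12)); rewrite ?pnatr_eq0// k3 mulfV ?pnatr_eq0.
by rewrite -addn3 exprD k3' mulrAC.
Qed.

Lemma airy_moment3l j u : (j < 3)%N -> T 3 j u = T 0 j u / 12 + - (Vt u / 12) * T 1 j u
  + path_a u / 3 * (tau^-1 * T 2 j u + T 1 j.+1 u).
Proof.
move=> j3; rewrite /T /airy_moment airy_int3l// -addrA mulrDr.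
rewrite !(addSn, addnS, add0n) (scaled_step_l _ _ _ _ _ _ k3 SS SS') airy_scale3.
by rewrite addrA.
Qed.

Lemma airy_moment3r i u : (i < 3)%N -> T i 3 u = T i 0 u / 12 + - (Wt u / 12) * T i 1 u
  + path_a u / 3 * (T i.+1 1 u + tau * T i 2 u).
Proof.
move=> i3; rewrite /T /airy_moment airy_int3r// -addrA mulrDr.
rewrite !(addSn, addnS, addn0) (scaled_step_r _ _ _ _ _ _ k3 SS'' SS') airy_scale3.
by rewrite addrA.
Qed.

Definition airy_phase' u : R[i] :=
  path_a' u / 6 * (path_X u * tau^-1 + path_Y u * tau)
  + path_a u / 6 * (X1 * tau^-1 + Y1 * tau)
  + path_a u ^+ 2 * path_a' u / 9 * (3 + (tau ^+ 3 + tau^-1 ^+ 3) / 2).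

Lemma cderiv_airy_phase u :
  cderiv (fun u => airy_phase (path_a u) (path_X u) (path_Y u) tau) u (airy_phase' u).
Proof.
apply: (cderiv_transport (cderivD
  (cderivM (cderivM (cderiv_path_a u) (cderiv_cst 6^-1 u))
     (cderivD (cderivM (cderiv_lin X1 u) (cderiv_cst tau^-1 u))
        (cderivM (cderiv_lin Y1 u) (cderiv_cst tau u))))
  (cderivM (cderivM (cderivX 3 (cderiv_path_a u)) (cderiv_cst 27^-1 u))
     (cderiv_cst (3 + (tau ^+ 3 + tau^-1 ^+ 3) / 2) u)))).
by rewrite /airy_phase' /path_X /path_Y /=; field; rewrite tau0.
Qed.

(** The derivatives involve integrals with an index up to 3. The Airy equation reduces them to the
    four with i, j <= 1, and each row becomes one of [airy_reduced0] to [airy_reduced3]. *)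
Lemma airy_vec_solution u :
  umb_solution path_a path_X path_Y path_a' (fun=> X1) (fun=> Y1)
    (fun i u => airy_vec (path_a u) (path_b u) (path_X u) (path_Y u) i) u.
Proof.
move=> i i4; pose E := cexp (airy_phase (path_a u) (path_X u) (path_Y u) tau).
have dE := cderiv_cexp (cderiv_airy_phase u).
have dT i j : (i < 2)%N -> (j < 2)%N -> _ := @cderiv_airy_moment i j u.
have da := cderiv_path_a u.
pose a := path_a u; pose H i j := T i j u.
have e20 := airy_moment2l u (isT : (0 < 3)%N); have e02 := airy_moment2r u (isT : (0 < 3)%N).
have e21 := airy_moment2l u (isT : (1 < 3)%N); have e12 := airy_moment2r u (isT : (1 < 3)%N).
have e30 := airy_moment3l u (isT : (0 < 3)%N); have e03 := airy_moment3r u (isT : (0 < 3)%N).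
have e31 := airy_moment3l u (isT : (1 < 3)%N); have e13 := airy_moment3r u (isT : (1 < 3)%N).
have e22 := airy_moment2l u (isT : (2 < 3)%N).
pose r0 := E * H 0%N 0%N; pose r1 := E * (a * tau^-1 / 6 * H 0%N 0%N - H 1%N 0%N).
pose r2 := E * (a * tau / 6 * H 0%N 0%N - H 0%N 1%N).
pose r3 := E * (a ^+ 2 / 36 * H 0%N 0%N - a * tau^-1 / 6 * H 0%N 1%N - a * tau / 6 * H 1%N 0%N + H 1%N 1%N).
have [f0 f1 f2 f3] := @umb_field_real a (path_X u) (path_Y u) (path_a' u) X1 Y1 r0 r1 r2 r3
  (fun j => airy_vec (path_a u) (path_b u) (path_X u) (path_Y u) j)
  erefl erefl erefl erefl.
have q0 := @airy_reduced0 _ a (path_X u) (path_Y u) (path_a' u) X1 Y1 tau (H 0%N 0%N) (H 1%N 0%N) (H 0%N 1%N) (H 1%N 1%N) tau0.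
have q1 := @airy_reduced1 _ a (path_X u) (path_Y u) (path_a' u) X1 Y1 tau (H 0%N 0%N) (H 1%N 0%N) (H 0%N 1%N) (H 1%N 1%N) tau0.
have q2 := @airy_reduced2 _ a (path_X u) (path_Y u) (path_a' u) X1 Y1 tau (H 0%N 0%N) (H 1%N 0%N) (H 0%N 1%N) (H 1%N 1%N) tau0.
have q3 := @airy_reduced3 _ a (path_X u) (path_Y u) (path_a' u) X1 Y1 tau (H 0%N 0%N) (H 1%N 0%N) (H 0%N 1%N) (H 1%N 1%N) tau0.
have WE : Wt u = path_Y u + a ^+ 2 / 3 * (2 * tau^-1 + tau ^+ 2) by rewrite /Wt /airy_arg invrK.
have VE : Vt u = path_X u + a ^+ 2 / 3 * (2 * tau + tau^-1 ^+ 2) by [].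
have V'E : airy_arg' X1 tau u = X1 + 2 * a * path_a' u / 3 * (2 * tau + tau^-1 ^+ 2) by [].
have W'E : airy_arg' Y1 tau^-1 u = Y1 + 2 * a * path_a' u / 3 * (2 * tau^-1 + tau ^+ 2).
  by rewrite /airy_arg' invrK.
have d00 := dT 0%N 0%N isT isT; have d10 := dT 1%N 0%N isT isT.
have d01 := dT 0%N 1%N isT isT; have d11 := dT 1%N 1%N isT isT.
rewrite V'E W'E e20 e02 VE WE in d00.
rewrite V'E W'E e30 e21 e12 e20 e02 VE WE in d10.
rewrite V'E W'E e03 e21 e12 e02 e20 VE WE in d01.
rewrite V'E W'E e31 e22 e13 e03 e21 e12 e02 e20 VE WE in d11.
pose Dr h1 h2 h20 h11 h02 : R[i] := - (X1 + 2 * a * path_a' u / 3 * (2 * tau + tau^-1 ^+ 2)) * h1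
  - (Y1 + 2 * a * path_a' u / 3 * (2 * tau^-1 + tau ^+ 2)) * h2
  + 2 * path_a' u * (tau^-1 * h20 + 2 * h11 + tau * h02).
pose H20 := - ((path_X u + a ^+ 2 / 3 * (2 * tau + tau^-1 ^+ 2)) / 12) * H 0%N 0%N
  + a / 3 * (tau^-1 * H 1%N 0%N + H 0%N 1%N).
pose H02 := - ((path_Y u + a ^+ 2 / 3 * (2 * tau^-1 + tau ^+ 2)) / 12) * H 0%N 0%N
  + a / 3 * (H 1%N 0%N + tau * H 0%N 1%N).
pose Vu := path_X u + a ^+ 2 / 3 * (2 * tau + tau^-1 ^+ 2).
pose Wu := path_Y u + a ^+ 2 / 3 * (2 * tau^-1 + tau ^+ 2).
pose H21 := - (Vu / 12) * H 0%N 1%N + a / 3 * (tau^-1 * H 1%N 1%N + H02).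
pose H12 := - (Wu / 12) * H 1%N 0%N + a / 3 * (H20 + tau * H 1%N 1%N).
pose H30 := H 0%N 0%N / 12 + - (Vu / 12) * H 1%N 0%N + a / 3 * (tau^-1 * H20 + H 1%N 1%N).
pose H03 := H 0%N 0%N / 12 + - (Wu / 12) * H 0%N 1%N + a / 3 * (H 1%N 1%N + tau * H02).
pose H31 := H 0%N 1%N / 12 + - (Vu / 12) * H 1%N 1%N + a / 3 * (tau^-1 * H21 + H12).
pose H13 := H 1%N 0%N / 12 + - (Wu / 12) * H 1%N 1%N + a / 3 * (H21 + tau * H12).
pose H22 := - (Vu / 12) * H02 + a / 3 * (tau^-1 * H12 + H03).
pose d1 := Dr H20 (H 1%N 1%N) H30 H21 H12.
pose d2 := Dr (H 1%N 1%N) H02 H21 H12 H03.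
pose d3 := Dr H21 H12 H31 H22 H13.
pose d0 := Dr (H 1%N 0%N) (H 0%N 1%N) H20 (H 1%N 1%N) H02.
case: i i4 => [|[|[|[|//]]]] _; rewrite /airy_vec.
- rewrite f0; apply: (cderiv_transport (cderivM dE d00)).
  transitivity (E * (airy_phase' u * H 0%N 0%N + d0)).
    by rewrite /d0 /Dr /H20 /H02 /H /E /a; ring.
  by rewrite /d0 /Dr /H20 /H02 q0 /r0 /r1 /r2 /r3; ring.
- rewrite f1; have c1 := cderivB (cderivM (cderivM (cderivM da (cderiv_cst tau^-1 u))
    (cderiv_cst 6^-1 u)) d00) d10.
  apply: (cderiv_transport (cderivZ (2 * 'i) (cderivM dE c1))); congr (_ * _).
  transitivity (E * (airy_phase' u * (a * tau^-1 / 6 * H 0%N 0%N - H 1%N 0%N)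
    + (path_a' u * tau^-1 / 6 * H 0%N 0%N + a * tau^-1 / 6 * d0 - d1))).
    by rewrite /d1 /d0 /Dr /H30 /H21 /H12 /H20 /H02 /Vu /Wu /H /E /a; ring.
  by rewrite /d1 /d0 /Dr /H30 /H21 /H12 /H20 /H02 /Vu /Wu q1 /r0 /r1 /r2 /r3; ring.
- rewrite f2; have c1 := cderivB (cderivM (cderivM (cderivM da (cderiv_cst tau u))
    (cderiv_cst 6^-1 u)) d00) d01.
  apply: (cderiv_transport (cderivZ (2 * 'i) (cderivM dE c1))); congr (_ * _).
  transitivity (E * (airy_phase' u * (a * tau / 6 * H 0%N 0%N - H 0%N 1%N)
    + (path_a' u * tau / 6 * H 0%N 0%N + a * tau / 6 * d0 - d2))).
    by rewrite /d2 /d0 /Dr /H03 /H21 /H12 /H20 /H02 /Vu /Wu /H /E /a; ring.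
  by rewrite /d2 /d0 /Dr /H03 /H21 /H12 /H20 /H02 /Vu /Wu q2 /r0 /r1 /r2 /r3; ring.
- rewrite f3; have c1 := cderivD (cderivB (cderivB
    (cderivM (cderivM (cderivX 2 da) (cderiv_cst 36^-1 u)) d00)
    (cderivM (cderivM (cderivM da (cderiv_cst tau^-1 u)) (cderiv_cst 6^-1 u)) d01))
    (cderivM (cderivM (cderivM da (cderiv_cst tau u)) (cderiv_cst 6^-1 u)) d10)) d11.
  apply: (cderiv_transport (cderivZ (-4) (cderivM dE c1))).
  transitivity (E * (-4 * (airy_phase' u * (a ^+ 2 / 36 * H 0%N 0%N - a * tau^-1 / 6 * H 0%N 1%N
       - a * tau / 6 * H 1%N 0%N + H 1%N 1%N)
    + (2 * a * path_a' u / 36 * H 0%N 0%N + a ^+ 2 / 36 * d0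
       - path_a' u * tau^-1 / 6 * H 0%N 1%N - a * tau^-1 / 6 * d2
       - path_a' u * tau / 6 * H 1%N 0%N - a * tau / 6 * d1 + d3)))).
    rewrite -/(d3) -/(d2) -/(d1) -/(d0).
    have -> : cexp (airy_phase (path_a u) (path_X u) (path_Y u) tau) = E by [].
    by rewrite /d3 /d2 /d1 /d0 /Dr /H22 /H31 /H13 /H03 /H30 /H21 /H12 /H20 /H02 /Vu /Wu /H /E /a /= expr1; ring.
  rewrite /d3 /d2 /d1 /d0 /Dr /H22 /H31 /H13 /H03 /H30 /H21 /H12 /H20 /H02 /Vu /Wu q3 /r0 /r1 /r2 /r3.
  by ring.
Qed.

End Path.
End AirySide.

(** * Special values of the Gamma function *)

Section HalfLine.
Context {R : realType}.
Local Notation mu := (@lebesgue_measure R).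
Local Notation pos := (`]0%R, +oo[%classic : set R).
Implicit Types (F G f g : R -> R) (x : R).

Lemma posE x : pos x = (0 < x) :> Prop.
Proof. by rewrite /= in_itv /= andbT. Qed.

Lemma near_seq_lt (a : nat -> R) (l e : R) : a n @[n --> \oo] --> l -> l < e ->
  \forall n \near \oo, a n < e.
Proof. by move=> al le; apply: cvgr_lt al _ le. Qed.

Lemma ge0_integral_pos_exhaust (a b : nat -> R) f :
  (forall n, 0 < a n) -> (forall n m, (n <= m)%N -> a m <= a n) ->
  (forall n m, (n <= m)%N -> b n <= b m) ->
  a n @[n --> \oo] --> (0:R) -> b n @[n --> \oo] --> +oo ->
  (forall x, 0 < x -> {for x, continuous f}) -> (forall x, 0 < x -> 0 <= f x) ->
  (\int[mu]_(x in `[a n, b n]) (f x)%:E)%E @[n --> \oo] --> (\int[mu]_(x in pos) (f x)%:E)%E.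
Proof.
move=> a0 aD bI a_0 b_y cf f0.
have -> : pos = \bigcup_n `[a n, b n]%classic.
  apply/seteqP; split=> [x|x [n _]].
    rewrite posE => x0.
    have h : \forall n \near \oo, a n < x /\ x <= b n.
      near=> n; split; first by near: n; exact: near_seq_lt a_0 x0.
      by near: n; move/cvgryPge : b_y; apply.
    by have [N _ /(_ N (leqnn N))[? ?]] := h; exists N => //=; rewrite in_itv /= ltW.
  by rewrite posE /= in_itv /= => /andP[/(lt_le_trans (a0 n))].
have mf n : measurable_fun `[a n, b n] (EFin \o f).
  apply/measurable_EFinP; apply: (measurable_funS (E := pos)) => //.
    by move=> x; rewrite posE /= in_itv /= => /andP[/(lt_le_trans (a0 n))].
  apply: open_continuous_measurable_fun; first exact: interval_open.
  by move=> x /set_mem; rewrite posE; exact: cf.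
apply: ge0_nondecreasing_set_cvg_integral => //.
- move=> n m nm; rewrite subsetEset => x /=; rewrite !in_itv /= => /andP[anx xbn].
  by rewrite (le_trans (aD _ _ nm))// (le_trans xbn)// bI.
- move=> n x /=; rewrite in_itv /= => /andP[/(lt_le_trans (a0 n)) x0 _].
  by rewrite lee_fin f0.
Unshelve. all: end_near. Qed.

Lemma inv_succ_cvg0 : n.+1%:R^-1 @[n --> \oo] --> (0:R).
Proof. exact: cvg_harmonic. Qed.

Lemma succ_cvgy : n.+1%:R @[n --> \oo] --> (+oo : set_system R).
Proof.
apply/cvgryPge => A; near=> n; rewrite (@le_trans _ _ n%:R) ?ler_nat//.
by near: n; exact: nbhs_infty_ger.
Unshelve. all: end_near. Qed.

(** Substitution on the intervals [1 / (n + 1), n + 1], followed by monotone convergence on both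
    sides. *)
Lemma ge0_substitution_pos F F' G :
  (forall x, 0 < x -> is_derive x 1 F (F' x)) ->
  (forall x, 0 < x -> {for x, continuous F'}) ->
  (forall x, 0 < x -> 0 < F' x) -> (forall x, 0 < x -> 0 < F x) ->
  F n.+1%:R^-1 @[n --> \oo] --> (0:R) -> F n.+1%:R @[n --> \oo] --> +oo ->
  (forall x, 0 < x -> {for x, continuous G}) -> (forall x, 0 < x -> 0 <= G x) ->
  (\int[mu]_(x in pos) (G x)%:E = \int[mu]_(x in pos) (G (F x) * F' x)%:E)%E.
Proof.
move=> dF cF' F'0 F0 Fa Fb cG G0.
have cF x : 0 < x -> {for x, continuous F}.
  by move=> /dF[h _]; apply/differentiable_continuous/derivable1_diffP.
have incF x y : 0 < x -> x < y -> F x < F y.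
  move=> x0 xy.
  have d z : z \in `]x, y[ -> is_derive z 1 F (F' z).
    by rewrite in_itv /= => /andP[/(lt_trans x0) /dF].
  have c : {within `[x, y], continuous F}.
    apply: continuous_in_subspaceT => z /set_mem; rewrite /= in_itv => /andP[/(lt_le_trans x0) z0 _].
    exact: cF.
  have [z zxy e] := MVT xy d c.
  rewrite -subr_gt0 e mulr_gt0 ?subr_gt0// F'0//.
  by move: zxy; rewrite in_itv /= => /andP[/(lt_trans x0)].
have leF x y : 0 < x -> x <= y -> F x <= F y.
  by move=> x0; rewrite le_eqVlt => /predU1P[->//|/(incF _ _ x0)/ltW].
have i0 n : (0:R) < n.+1%:R^-1 by rewrite invr_gt0.
have iD n m : (n <= m)%N -> (m.+1%:R^-1 : R) <= n.+1%:R^-1 by move=> nm; rewrite lef_pV2 ?posrE// ler_nat.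
have iI n m : (n <= m)%N -> (n.+1%:R : R) <= m.+1%:R by move=> nm; rewrite ler_nat.
have h1 := @ge0_integral_pos_exhaust (fun n => F n.+1%:R^-1) (fun n => F n.+1%:R) G
  (fun n => F0 _ (i0 n)) (fun n m nm => leF _ _ (i0 m) (iD _ _ nm)) _ Fa Fb cG G0.
have {}h1 := h1 (fun n m nm => leF _ _ (ltr0Sn _ _) (iI _ _ nm)).
pose A n : set R := `[n.+1%:R^-1, n.+1%:R]%classic.
have h2 : (\int[mu]_(x in A n) (G (F x) * F' x)%:E)%E @[n --> \oo] -->
   (\int[mu]_(x in pos) (G (F x) * F' x)%:E)%E.
  apply: (@ge0_integral_pos_exhaust _ _ (fun x => G (F x) * F' x)) => //.
  - exact: inv_succ_cvg0.
  - exact: succ_cvgy.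
  - move=> x x0; apply: cvgM; last exact: cF'.
    by apply: (@continuous_comp _ _ _ F G); [exact: cF|apply: cG; exact: F0].
  - by move=> x x0; rewrite mulr_ge0 ?G0 ?F0// ltW// F'0.
pose B n : set R := `[F n.+1%:R^-1, F n.+1%:R]%classic.
have e n : (\int[mu]_(x in A n) (G (F x) * F' x)%:E = \int[mu]_(x in B n) (G x)%:E)%E.
  have nn : (n.+1%:R^-1 : R) <= n.+1%:R by rewrite (@le_trans _ _ 1)// ?invf_le1// ler1n.
  have F'E x : 0 < x -> (F^`()%classic) x = F' x by move=> /dF[_ h]; rewrite derive1E.
  have p x : n.+1%:R^-1 <= x -> 0 < x by exact: lt_le_trans.
  have cF'' x : 0 < x -> {for x, continuous F^`()%classic}.
    move=> x0; suff : F^`()%classic y @[y --> x] --> F' x by rewrite -(F'E _ x0).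
    apply: (cvg_trans _ (cF' x x0)); apply: near_eq_cvg.
    by near=> y; rewrite F'E//; near: y; exact: lt_nbhsr.
  rewrite /B (@integration_by_substitution_increasing _ F G n.+1%:R^-1 n.+1%:R)//.
  - apply: eq_integral => x /set_mem; rewrite /A /= in_itv /= => /andP[/p x0 _].
    by congr EFin; rewrite -[RHS]/(G (F x) * F^`()%classic x) F'E.
  - by move=> x y; rewrite !in_itv /= => /andP[/p x0 _] _; exact: incF.
  - by move=> x; rewrite in_itv /= => /andP[/ltW/p x0 _]; exact: cF''.
  - by apply/cvg_ex; exists ((F^`()%classic) n.+1%:R^-1); apply: cvg_at_right_filter; exact: cF''.
  - by apply/cvg_ex; exists ((F^`()%classic) n.+1%:R); apply: cvg_at_left_filter; exact: cF''.
  - split.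
    + by move=> x; rewrite in_itv /= => /andP[/ltW/p/dF[h _] _].
    + by apply: cvg_at_right_filter; exact: cF.
    + by apply: cvg_at_left_filter; exact: cF.
  - apply: continuous_in_subspaceT => x /set_mem; rewrite /= in_itv /= => /andP[h _].
    by apply: cG; apply: lt_le_trans h; exact: F0.
have {}h1 : (\int[mu]_(x in A n) (G (F x) * F' x)%:E)%E @[n --> \oo] -->
    (\int[mu]_(x in pos) (G x)%:E)%E.
  by under eq_fun do rewrite e; exact: h1.
by apply: (cvg_unique _ h1 h2); exact: ereal_hausdorff.
Unshelve. all: end_near. Qed.

End HalfLine.

(** * Integrals of x^k exp (- x^n) over the half-line *)

Section GammaValues.
Context {R : realType}.
Local Notation mu := (@lebesgue_measure R).
Local Notation pos := (`]0%R, +oo[%classic : set R).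
Implicit Types (F G f g : R -> R) (x : R).

Lemma ge0_FTC_pos F f (la lb : R) :
  (forall x, 0 < x -> is_derive x 1 F (f x)) ->
  (forall x, 0 < x -> {for x, continuous f}) -> (forall x, 0 < x -> 0 <= f x) ->
  F x @[x --> 0^'+] --> la -> F x @[x --> +oo] --> lb ->
  (\int[mu]_(x in pos) (f x)%:E = (lb - la)%:E)%E.
Proof.
move=> dF cf f0 Fa Fb.
pose a n : R := n.+2%:R^-1; pose b n : R := n.+2%:R.
have a0 n : 0 < a n by rewrite invr_gt0.
have ab n : a n < b n by rewrite (@lt_trans _ _ 1)// ?invf_lt1// ltr1n.
have aD n m : (n <= m)%N -> a m <= a n by move=> nm; rewrite lef_pV2 ?posrE// ler_nat.
have bI n m : (n <= m)%N -> b n <= b m by move=> nm; rewrite ler_nat.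
have a_0 : a n @[n --> \oo] --> (0:R).
  by have := @inv_succ_cvg0 R; rewrite -(cvg_shiftS (fun n => n.+1%:R^-1 : R)).
have b_y : b n @[n --> \oo] --> (+oo : set_system R).
  by have := @succ_cvgy R; rewrite -(cvg_shiftS (fun n => n.+1%:R : R)).
have cF x : 0 < x -> {for x, continuous F}.
  by move=> /dF[h _]; apply/differentiable_continuous/derivable1_diffP.
have h1 := ge0_integral_pos_exhaust a0 aD bI a_0 b_y cf f0.
have e n : (\int[mu]_(x in `[a n, b n]) (f x)%:E = (F (b n) - F (a n))%:E)%E.
  have p x : a n <= x -> 0 < x by exact: lt_le_trans.
  rewrite (@continuous_FTC2 _ f F) //=.
  - apply/continuous_within_itvP => //; split.
    + by move=> x; rewrite in_itv /= => /andP[/ltW/p x0 _]; exact: cf.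
    + by apply: cvg_at_right_filter; apply: cf.
    + by apply: cvg_at_left_filter; apply: cf; apply: p; exact: ltW.
  - split.
    + by move=> x; rewrite in_itv /= => /andP[/ltW/p/dF[]].
    + by apply: cvg_at_right_filter; apply: cF.
    + by apply: cvg_at_left_filter; apply: cF; apply: p; exact: ltW.
  - by move=> x; rewrite in_itv /= => /andP[/ltW/p/dF[_ h] _]; rewrite derive1E.
have h2 : (F (b n) - F (a n))%:E @[n --> \oo] --> (lb - la)%:E.
  apply: cvg_EFin; first exact: nearW.
  apply: cvgB; first exact: cvg_comp b_y Fb.
  apply: (cvg_comp _ _ _ Fa) => A [d d0 dA].
  have [N _ h] : \forall n \near \oo, a n < d by exact: near_seq_lt a_0 d0.
  by exists N => // n Nn; apply: dA => //=; rewrite sub0r normrN gtr0_norm// h.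
rewrite (eq_cvg _ _ e) in h1.
by apply: (cvg_unique _ h1 h2); exact: ereal_hausdorff.
Qed.

Lemma tonelli_pos (h : R -> R -> R) : measurable_fun setT (fun p : R * R => h p.1 p.2) ->
  (forall x y, 0 < x -> 0 < y -> 0 <= h x y) ->
  (\int[mu]_(x in pos) \int[mu]_(y in pos) (h x y)%:E =
   \int[mu]_(y in pos) \int[mu]_(x in pos) (h x y)%:E)%E.
Proof.
move=> mh h0.
pose g := (fun p : R * R => (h p.1 p.2)%:E) \_ (pos `*` pos).
have mg : measurable_fun setT g.
  apply/(measurable_restrictT _ (measurableX _ _)) => //.
  by apply: (measurable_funS measurableT) => //; exact/measurable_EFinP.
have g0 p : (0 <= g p)%E.
  rewrite /g patchE; case: ifPn => // /set_mem[].
  by rewrite !posE => a b; rewrite lee_fin h0.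
rewrite integral_mkcond [RHS]integral_mkcond.
have := fubini_tonelli (m1 := mu) (m2 := mu) g mg g0.
have e1 : (fun x => \int[mu]_y g (x, y))%E =
   (fun x => \int[mu]_(y in pos) (h x y)%:E)%E \_ pos.
  apply/funext => x; rewrite patchE; case: ifPn => hx.
    rewrite [RHS]integral_mkcond; apply: eq_integral => y _; rewrite /g !patchE.
    by rewrite in_setX hx.
  by apply: integral0_eq => y _; rewrite /g patchE in_setX (negbTE hx).
have e2 : (fun y => \int[mu]_x g (x, y))%E =
   (fun y => \int[mu]_(x in pos) (h x y)%:E)%E \_ pos.
  apply/funext => y; rewrite patchE; case: ifPn => hy.
    rewrite [RHS]integral_mkcond; apply: eq_integral => x _; rewrite /g !patchE.
    by rewrite in_setX hy andbT.
  by apply: integral0_eq => x _; rewrite /g patchE in_setX (negbTE hy) andbF.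
by rewrite e1 e2.
Qed.

Lemma continuous_measurable_pos f : (forall x, 0 < x -> {for x, continuous f}) ->
  measurable_fun pos f.
Proof.
move=> cf; apply: open_continuous_measurable_fun; first exact: interval_open.
by move=> x /set_mem; rewrite posE; exact: cf.
Qed.

Lemma derivable_for_continuous F x (d : R) : is_derive x 1 F d -> {for x, continuous F}.
Proof. by case=> h _; apply/differentiable_continuous/derivable1_diffP. Qed.

(** This is Gamma ((k + 1) / n) / n, in a form where all exponents are natural numbers. *)
Definition stretched_moment k n : \bar R := (\int[mu]_(x in pos) (x ^+ k * expR (- x ^+ n))%:E)%E.

Lemma stretched_moment_ge0 k n : (0 <= stretched_moment k n)%E.
Proof.
apply: integral_ge0 => x; rewrite posE => x0.
by rewrite lee_fin mulr_ge0 ?exprn_ge0 ?expR_ge0// ltW.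
Qed.

Lemma is_derive_expr n x : is_derive x 1 (fun u : R => u ^+ n) (n%:R * x ^+ n.-1).
Proof.
have h := @is_deriveX _ _ (fun u : R => u) n x 1 1 (is_derive_id _ _).
apply: is_derive_transport h _ _; first by move=> u; rewrite exprfctE.
by rewrite /GRing.scale /= mulr1.
Qed.

Lemma continuous_stretched k n x : {for x, continuous (fun u : R => u ^+ k * expR (- u ^+ n))}.
Proof.
apply: (@cvgM _ _ _ _ (fun u : R => u ^+ k)); first exact: exprn_continuous.
apply: (@continuous_comp _ _ _ (fun u : R => - u ^+ n) expR); last exact: continuous_expR.
by apply: cvgN; exact: exprn_continuous.
Qed.

(** Comparing every power n >= 2 with the square gives one Gaussian majorant for all stretched
    exponentials. *)
Lemma sqr_subr1_le n x : (1 < n)%N -> 0 <= x -> x ^+ 2 - 1 <= x ^+ n.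
Proof.
move=> n1 x0; have [x1|x1] := leP x 1.
  by rewrite (@le_trans _ _ 0)// ?exprn_ge0// subr_le0 exprn_ile1.
by rewrite (@le_trans _ _ (x ^+ 2)) ?gerBl// ler_eXn2l.
Qed.

Lemma stretched_bound k n x : (1 < n)%N -> 0 <= x ->
  x ^+ k * expR (- x ^+ n) <= expR 1 * (k`!%:R * expR (1/2)) * expR (- (2^-1 * x ^+ 2)).
Proof.
move=> n1 x0.
have h1 : expR (- x ^+ n) <= expR 1 * expR (- x ^+ 2).
  by rewrite -expRD ler_expR lerNl opprD opprK addrC sqr_subr1_le.
have h2 : x ^+ k <= k`!%:R * expR x by exact: exprn_le_expR.
have h3 : expR x <= expR (1/2) * expR (2^-1 * x ^+ 2).
  rewrite -expRD ler_expR; have := sqr_ge0 (x - 1); nra.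
rewrite (@le_trans _ _ ((k`!%:R * (expR (1/2) * expR (2^-1 * x ^+ 2))) * (expR 1 * expR (- x ^+ 2))))//.
  rewrite ler_pM ?exprn_ge0 ?expR_ge0//.
  by apply: (le_trans h2); rewrite ler_wpM2l.
rewrite (_ : - x ^+ 2 = - (2^-1 * x ^+ 2) - 2^-1 * x ^+ 2); last by field.
rewrite expRD expRN.
have := expR_gt0 (2^-1 * x ^+ 2); set E := expR _ => E0.
by rewrite le_eqVlt; apply/orP; left; apply/eqP; field; exact: lt0r_neq0.
Qed.

Lemma integrable_stretched k n : (1 < n)%N ->
  mu.-integrable pos (EFin \o (fun x => x ^+ k * expR (- x ^+ n))).
Proof.
move=> n1.
have h := integrable_scale (expR 1 * (k`!%:R * expR (1/2))) measurableT (integrable_gaussian (c := 2^-1 : R) ltac:(by [])).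
have h' : mu.-integrable pos (EFin \o (fun x => expR 1 * (k`!%:R * expR (1/2)) * expR (- (2^-1 * x ^+ 2)))).
  by apply: integrableS h.
apply: integrable_le_norm h' _ => //.
  by apply: continuous_measurable_pos => x _; exact: continuous_stretched.
move=> x; rewrite posE => /ltW x0.
by rewrite ger0_norm ?stretched_bound// mulr_ge0 ?exprn_ge0 ?expR_ge0.
Qed.

Lemma fin_num_stretched k n : (1 < n)%N -> stretched_moment k n \is a fin_num.
Proof. by move=> n1; apply: integrable_fin_num => //; exact: integrable_stretched. Qed.

Lemma stretched_cube_exp b : 0 < b ->
  (\int[mu]_(w in pos) (w ^+ 2 * expR (- (b * w ^+ 3)))%:E = ((3 * b)^-1)%:E)%E.
Proof.
move=> b0.
pose F (w : R) := - (3 * b)^-1 * expR (- (b * w ^+ 3)).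
have dF (w : R) : is_derive w 1 F (w ^+ 2 * expR (- (b * w ^+ 3))).
  have h := is_deriveN (is_deriveZ b (is_derive_expr 3 w)).
  have h2 := is_deriveZ (- (3 * b)^-1) (is_derive1_comp (is_derive_expR _) h).
  apply: is_derive_transport h2 _ _ => //=.
  rewrite /GRing.scale /=; field; exact: lt0r_neq0.
have cw (w : R) : {for w, continuous (fun w : R => expR (- (b * w ^+ 3)))}.
  apply: (@continuous_comp _ _ _ (fun w : R => - (b * w ^+ 3)) expR); last exact: continuous_expR.
  by apply: cvgN; apply: cvgMl_tmp; exact: exprn_continuous.
rewrite (@ge0_FTC_pos F _ (- (3 * b)^-1) 0)//.
- by rewrite sub0r opprK.
- move=> w _; apply: (@cvgM _ _ _ _ (fun w : R => w ^+ 2)); [exact: exprn_continuous|exact: cw].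
- by move=> w w0; rewrite mulr_ge0 ?exprn_ge0 ?expR_ge0// ltW.
- have := derivable_for_continuous (dF 0); rewrite /prop_for /continuous_at {2}/F expr0n /= mulr0 oppr0 expR0 mulr1.
  by move=> h; apply: cvg_at_right_filter.
- suff : F w @[w --> +oo] --> (- (3 * b)^-1 * 0) by rewrite mulr0.
  apply: cvgMl_tmp => /=; apply: (@cvg_comp _ _ _ (fun w : R => b * w ^+ 3) (fun y => expR (- y)) _ +oo).
    apply/cvgryPge => A; near=> w.
    have w1 : 1 <= w by near: w; exact: nbhs_pinfty_ge.
    have wA : A / b <= w by near: w; apply: nbhs_pinfty_ge; rewrite num_real.
    rewrite -ler_pdivrMl// mulrC (le_trans wA)//.
    by rewrite -[leLHS]expr1 ler_weXn2l.
  exact: cvgr_expR.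
Unshelve. all: end_near. Qed.

End GammaValues.

(** * The Cauchy-Schlomilch integral and changes of variable *)

Section GammaRelations.
Context {R : realType}.
Local Notation mu := (@lebesgue_measure R).
Local Notation pos := (`]0%R, +oo[%classic : set R).
Implicit Types (F G f g : R -> R) (x : R).

Lemma continuous_gauss_comp x : {for x, continuous (fun u : R => expR (- u ^+ 2))}.
Proof.
apply: (@continuous_comp _ _ _ (fun u : R => - u ^+ 2) expR); last exact: continuous_expR.
by apply: cvgN; exact: exprn_continuous.
Qed.

Lemma gauss_primitive : exists P : R -> R, [/\ forall y : R, is_derive y 1 P (expR (- y ^+ 2)),
  P y @[y --> +oo] --> Num.sqrt pi & P y @[y --> -oo] --> (0 : R)].
Proof.
pose f (t : R) := expR (- t ^+ 2).
have i_f : mu.-integrable setT (EFin \o f) by exact: integrableT_gauss.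
have mf : measurable_fun setT f by exact: measurable_gauss_fun.
exists (fun y => Rintegral mu `]-oo, y] f); split.
- move=> y.
  have [] := @continuous_FTC1 R f -oo%O y (y + 1).
  + by rewrite ltrDl.
  + by apply: integrableS i_f.
  + by rewrite ltNyr.
  + exact: continuous_gauss_comp.
  by move=> d e; split; [exact: d|rewrite -derive1E; exact: e].
- apply/cvg_pinftyP => u uy.
  have -> : Num.sqrt pi = Rintegral mu setT f by rewrite /Rintegral integralT_gauss.
  apply: Rintegral_cvg_sets => // x _.
  near=> n; rewrite /= in_itv /=; near: n.
  by move/cvgryPge : uy; apply.
- apply/cvg_ninftyP => u uy.
  have h n : Rintegral mu `]-oo, u n] f = Rintegral mu setT (f \_ `]-oo, u n]).
    by rewrite -Rintegral_mkcondr setTI.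
  under eq_fun do rewrite h.
  have <- : Rintegral mu setT (fun=> 0 : R) = 0 by rewrite /Rintegral integral0.
  apply: (@Rintegral_dominated_cvg _ _ _ mu setT (fun n => f \_ `]-oo, u n]) (fun=> 0) f) => //.
  + move=> n; have h0 : measurable_fun `]-oo, u n] f by apply: (measurable_funS measurableT) mf.
    by apply: (measurable_restrictT f _).1.
  + move=> x _; apply: cvg_near_cst; near=> n.
    rewrite patchE ifF//; apply/negbTE/negP => /set_mem; rewrite /= in_itv /= => xu.
    suff : u n < x by rewrite ltNge xu.
    apply: (@le_lt_trans _ _ (x - 1)); last by rewrite ltrBlDr ltrDl.
    by near: n; move/cvgrNyPle : uy; apply.
  + move=> n x _; rewrite patchE; case: ifP => _; last by rewrite normr0 expR_ge0.
    by rewrite ger0_norm// expR_ge0.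
Unshelve. all: end_near. Qed.

Lemma cauchy_schlomilch (c : R) : 0 < c ->
  (\int[mu]_(p in pos) (expR (- p ^+ 2 - (c / p) ^+ 2))%:E =
   (Num.sqrt pi / 2 * expR (- (2 * c)))%:E)%E.
Proof.
move=> c0; have [P [dP Py PNy]] := gauss_primitive.
have cP (y : R) : {for y, continuous P} by exact: derivable_for_continuous (dP y).
(* An explicit primitive. As (p + c/p)^2 and (p - c/p)^2 are p^2 + (c/p)^2 plus or minus 2 c, the
   weights cancel the cross terms, and the contributions of the derivative of c/p cancel each other.
   At 0 the two arguments tend to +oo and -oo, at +oo both tend to +oo, so only the second summand
   changes. *)
pose F p := 2^-1 * (expR (2 * c) * P (p + c / p) + expR (- (2 * c)) * P (p - c / p)).
have dV (p : R) : 0 < p -> is_derive p 1 (fun p => c / p) (- (c / p ^+ 2)).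
  move=> p0; have := is_deriveZ c (is_deriveV (lt0r_neq0 p0) (is_derive_id p (1:R))).
  move=> h; apply: is_derive_transport h _ _ => //.
  by rewrite /GRing.scale /= mulr1 mulrN.
have dF (p : R) : 0 < p -> is_derive p 1 F (expR (- p ^+ 2 - (c / p) ^+ 2)).
  move=> p0; have p0' := lt0r_neq0 p0.
  have d1 := is_derive1_comp (dP _) (is_deriveD (is_derive_id p (1:R)) (dV p p0)).
  have d2 := is_derive1_comp (dP _) (is_deriveB (is_derive_id p (1:R)) (dV p p0)).
  have := is_deriveZ 2^-1 (is_deriveD (is_deriveZ (expR (2 * c)) d1) (is_deriveZ (expR (- (2 * c))) d2)).
  move=> h; apply: is_derive_transport h _ _ => //.
  rewrite /GRing.scale /=.
  rewrite (_ : - (id p + c / p) ^+ 2 = - p ^+ 2 - (c / p) ^+ 2 - 2 * c); last by rewrite /=; field.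
  rewrite (_ : - (id p - c / p) ^+ 2 = - p ^+ 2 - (c / p) ^+ 2 + 2 * c); last by rewrite /=; field.
  rewrite [expR (_ - 2 * c)]expRD [expR (_ + 2 * c)]expRD expRN.
  by have := expR_gt0 (2 * c); set E := expR (2 * c) => E0; field; rewrite p0' lt0r_neq0.
have vy : p + c / p @[p --> +oo] --> (+oo : set_system R).
  apply/cvgryPge => A; near=> p.
  have p0 : 0 < p by near: p; exact: nbhs_pinfty_gt.
  have pA : A <= p by near: p; apply: nbhs_pinfty_ge; rewrite num_real.
  rewrite (le_trans pA)//.
  by rewrite lerDl ltW// divr_gt0.
have wy : p - c / p @[p --> +oo] --> (+oo : set_system R).
  apply/cvgryPge => A; near=> p.
  have p1 : 1 <= p by near: p; apply: nbhs_pinfty_ge; rewrite num_real.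
  have p0 : 0 < p by exact: lt_le_trans p1.
  have pA : A + c <= p by near: p; apply: nbhs_pinfty_ge; rewrite num_real.
  have : c / p <= c by rewrite ler_pdivrMr// ler_peMr// ltW.
  lra.
have v0 : p + c / p @[p --> 0^'+] --> (+oo : set_system R).
  apply/cvgryPge => A; near=> p.
  have p0 : 0 < p by near: p; exact: nbhs_right_gt.
  have pA : p < c / (`|A| + 1).
    by near: p; apply: nbhs_right_lt; rewrite divr_gt0// ltr_wpDl.
  suff h : A <= c / p by rewrite (le_trans h)// lerDr ltW.
  rewrite ler_pdivlMr//; move: pA; rewrite ltr_pdivlMr ?ltr_wpDl//.
  by have := ler_norm A; nra.
have w0 : p - c / p @[p --> 0^'+] --> (-oo : set_system R).
  apply/cvgrNyPle => A; near=> p.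
  have p0 : 0 < p by near: p; exact: nbhs_right_gt.
  have pA : p < c / (`|A| + 2).
    by near: p; apply: nbhs_right_lt; rewrite divr_gt0// ltr_wpDl.
  have p1 : p < 1 by near: p; exact: nbhs_right_lt.
  have : `|A| + 2 <= c / p.
    by rewrite ler_pdivlMr// ltW// mulrC; move: pA; rewrite ltr_pdivlMr ?ltr_wpDl.
  have := ler_norm (- A); rewrite normrN; lra.
rewrite (@ge0_FTC_pos _ F _ (2^-1 * (expR (2 * c) * Num.sqrt pi + expR (- (2 * c)) * 0))
  (2^-1 * (expR (2 * c) * Num.sqrt pi + expR (- (2 * c)) * Num.sqrt pi)))//.
- by congr EFin; field.
- move=> p p0; apply: (@continuous_comp _ _ _ (fun p : R => - p ^+ 2 - (c / p) ^+ 2) expR); last exact: continuous_expR.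
  apply: cvgB; first by apply: cvgN; exact: exprn_continuous.
  apply: (@continuous_comp _ _ _ (fun p : R => c / p) (fun y => y ^+ 2)); last exact: exprn_continuous.
  exact: derivable_for_continuous (dV p p0).
- apply: cvgMl_tmp; apply: cvgD; apply: cvgMl_tmp; [exact: cvg_comp v0 Py|exact: cvg_comp w0 PNy].
- apply: cvgMl_tmp; apply: cvgD; apply: cvgMl_tmp; [exact: cvg_comp vy Py|exact: cvg_comp wy Py].
Unshelve. all: end_near. Qed.

Lemma scale_pos (c : R) G : 0 < c -> (forall x, 0 < x -> {for x, continuous G}) ->
  (forall x, 0 < x -> 0 <= G x) ->
  (\int[mu]_(x in pos) (G x)%:E = \int[mu]_(x in pos) (G (c * x) * c)%:E)%E.
Proof.
move=> c0 cG G0.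
apply: (@ge0_substitution_pos _ (fun x => c * x) (fun=> c)) => //.
- move=> x _; have := is_deriveZ c (is_derive_id x (1:R)).
  by move=> h; apply: is_derive_transport h _ _ => //; rewrite /GRing.scale /= mulr1.
- by move=> x _; exact: cvg_cst.
- by move=> x x0; rewrite mulr_gt0.
- suff : c * n.+1%:R^-1 @[n --> \oo] --> (c * 0) by rewrite mulr0.
  by apply: cvgMl_tmp; exact: inv_succ_cvg0.
- apply/cvgryPge => A; near=> n; rewrite -ler_pdivrMl// mulrC; near: n.
  by have /cvgryPge := @succ_cvgy R; apply.
Unshelve. all: end_near. Qed.

Lemma power_pos n G : (forall x, 0 < x -> {for x, continuous G}) ->
  (forall x, 0 < x -> 0 <= G x) ->
  (\int[mu]_(x in pos) (G x)%:E = \int[mu]_(x in pos) (G (x ^+ n.+1) * (n.+1%:R * x ^+ n))%:E)%E.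
Proof.
move=> cG G0.
apply: (@ge0_substitution_pos _ (fun x => x ^+ n.+1) (fun x => n.+1%:R * x ^+ n)) => //.
- by move=> x _; exact: is_derive_expr.
- by move=> x _; apply: cvgMl_tmp; exact: exprn_continuous.
- by move=> x x0; rewrite mulr_gt0// exprn_gt0.
- by move=> x x0; rewrite exprn_gt0.
- suff : (m.+1%:R^-1) ^+ n.+1 @[m --> \oo] --> ((0:R) ^+ n.+1) by rewrite expr0n.
  apply: (@cvg_comp _ _ _ (fun m : nat => m.+1%:R^-1) (fun x : R => x ^+ n.+1)).
    exact: inv_succ_cvg0.
  exact: exprn_continuous.
- apply/cvgryPge => A; near=> m; rewrite (@le_trans _ _ m.+1%:R)//.
    by near: m; have /cvgryPge := @succ_cvgy R; apply.
  by rewrite -[leLHS]expr1 ler_weXn2l// ler1n.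
Unshelve. all: end_near. Qed.

End GammaRelations.

(** * Products of stretched moments as double integrals *)

Section StretchedProducts.
Context {R : realType}.
Local Notation mu := (@lebesgue_measure R).
Local Notation pos := (`]0%R, +oo[%classic : set R).
Local Notation sm := (@stretched_moment R).
Implicit Types (F G f g : R -> R) (x : R).

Lemma measurable_stretched k n : measurable_fun pos (fun x : R => (x ^+ k * expR (- x ^+ n))%:E).
Proof.
by apply/measurable_EFinP; apply: continuous_measurable_pos => x _; exact: continuous_stretched.
Qed.

Lemma stretched_pos_ge0 k n x : 0 < x -> 0 <= x ^+ k * expR (- x ^+ n).
Proof. by move=> /ltW x0; rewrite mulr_ge0 ?exprn_ge0 ?expR_ge0. Qed.

(** The variable of the second integral is rescaled by h w. Taking h w = w leads to the reflection
    formula, h w = 1/w to the duplication formula. *)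
Lemma stretched_mul i n (j m : nat) (h : R -> R) : (forall x, 0 < x -> 0 < h x) ->
  (sm i n * sm j m = \int[mu]_(w in pos) \int[mu]_(q in pos)
    (w ^+ i * expR (- w ^+ n) * ((h w * q) ^+ j * expR (- (h w * q) ^+ m) * h w))%:E)%E.
Proof.
move=> h0; rewrite /sm -ge0_integralZr//.
- apply: eq_integral => w /set_mem; rewrite posE => w0.
  rewrite (@scale_pos _ (h w) (fun x => x ^+ j * expR (- x ^+ m)) (h0 _ w0))//.
  + rewrite -ge0_integralZl_EFin//.
    * by move=> q; rewrite posE => q0; rewrite lee_fin mulr_ge0 ?(ltW (h0 _ w0))// stretched_pos_ge0// mulr_gt0// h0.
    * apply/measurable_EFinP/measurable_funM => //.
      apply: continuous_measurable_pos => q _.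
      apply: (@continuous_comp _ _ _ (fun q => h w * q) (fun u => u ^+ j * expR (- u ^+ m))).
        by apply: cvgMl_tmp; exact: cvg_id.
      exact: continuous_stretched.
    * by rewrite stretched_pos_ge0.
  + by move=> q _; exact: continuous_stretched.
  + exact: stretched_pos_ge0.
- exact: measurable_stretched.
- by move=> w; rewrite posE => w0; rewrite lee_fin stretched_pos_ge0.
- exact: stretched_moment_ge0.
Qed.

Lemma measurable_expR_comp d (T : measurableType d) (f : T -> R) : measurable_fun setT f ->
  measurable_fun setT (fun u => expR (f u)).
Proof. by move=> mf; apply: (measurableT_comp (@measurable_expR R)). Qed.

(** For i + j = 1 the rescaling by w produces exactly w^2 exp (- (1 + q^3) w^3), elementary in w
    once the order of integration is exchanged. *)
Lemma stretched_mul3 i j : (i + j = 1)%N ->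
  (sm i 3 * sm j 3 = \int[mu]_(q in pos) (q ^+ j / (3 * (1 + q ^+ 3)))%:E)%E.
Proof.
move=> ij; rewrite (@stretched_mul i 3 j 3 id)//.
rewrite (@tonelli_pos _ (fun w q => w ^+ i * expR (- w ^+ 3) * ((w * q) ^+ j * expR (- (w * q) ^+ 3) * w))).
- apply: eq_integral => q /set_mem; rewrite posE => q0.
  have q1 : 0 < 1 + q ^+ 3 by rewrite ltr_wpDr// ltW// exprn_gt0.
  rewrite EFinM -(stretched_cube_exp q1) -ge0_integralZl_EFin//.
  + apply: eq_integral => w _; rewrite -EFinM; congr EFin.
    rewrite (_ : - ((1 + q ^+ 3) * w ^+ 3) = - w ^+ 3 - (w * q) ^+ 3); last by ring.
    rewrite expRD exprMn.
    have -> : w ^+ 2 = w * (w ^+ i * w ^+ j) by rewrite -exprD ij expr1 expr2.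
    by move: (w ^+ i) (w ^+ j) (q ^+ j) (expR _) (expR _) => a b c d e; ring.
  + by move=> w; rewrite posE => /ltW w0; rewrite lee_fin mulr_ge0 ?exprn_ge0 ?expR_ge0.
  + apply/measurable_EFinP; apply: (measurable_funS measurableT) => //.
    apply: measurable_funM => //; apply: measurable_expR_comp.
    by apply: measurableT_comp => //; apply: measurable_funM.
  + by rewrite exprn_ge0// ltW.
- have m1 : measurable_fun setT (fun p : R * R => p.1 * p.2).
    by apply: measurable_funM; [exact: measurable_fst|exact: measurable_snd].
  have m2 n : measurable_fun setT (fun p : R * R => p.1 ^+ n) by apply: measurable_funX; exact: measurable_fst.
  apply: measurable_funM; [apply: measurable_funM|apply: measurable_funM; [apply: measurable_funM|]].
  + exact: m2.
  + by apply: measurable_expR_comp; apply: measurableT_comp => //; exact: m2.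
  + exact: measurable_funX.
  + by apply: measurable_expR_comp; apply: measurableT_comp => //; exact: measurable_funX.
  + exact: measurable_fst.
- by move=> w q w0 q0; rewrite !mulr_ge0 ?expR_ge0 ?exprn_ge0 ?mulr_ge0// ltW.
Qed.

(** Legendre's duplication for Gamma ((j + 1) / 6). Rescaling by 1/w gives the exponent - w^6 - (q /
    w)^6, which in the variable p = w^3 is the Cauchy-Schlomilch integral with c = q^3. *)
Lemma stretched_dupl j : (sm (3 + j) 6 * sm j 6 =
   (Num.sqrt pi / 6)%:E * \int[mu]_(t in pos) (t ^+ j * expR (- (2 * t ^+ 3)))%:E)%E.
Proof.
(* The inverse on the positive half-line, written so that positivity and measurability on the whole
   line are immediate. *)
pose h w : R := expR (- ln w).
have hE w : 0 < w -> h w = w^-1 by move=> w0; rewrite /h expRN lnK.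
rewrite (@stretched_mul (3 + j) 6 j 6 h); last by move=> x _; exact: expR_gt0.
rewrite (@tonelli_pos _ (fun w q => w ^+ (3 + j) * expR (- w ^+ 6) * ((h w * q) ^+ j * expR (- (h w * q) ^+ 6) * h w))).
- rewrite -ge0_integralZl_EFin//.
  + apply: eq_integral => t /set_mem; rewrite posE => t0.
    have t3 : 0 < t ^+ 3 by exact: exprn_gt0.
    have := cauchy_schlomilch t3.
    rewrite (@power_pos _ 2 (fun p => expR (- p ^+ 2 - (t ^+ 3 / p) ^+ 2))).
    * move=> e.
      transitivity ((t ^+ j / 3)%:E * \int[mu]_(x in pos) (expR (- (x ^+ 3) ^+ 2 - (t ^+ 3 / x ^+ 3) ^+ 2) * (3 * x ^+ 2))%:E)%E.
        rewrite -ge0_integralZl_EFin//.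
        - apply: eq_integral => w /set_mem; rewrite posE => w0; rewrite -EFinM; congr EFin.
          rewrite hE// -!exprM expRD -exprVn -exprMn -exprM mulnC [w^-1 * t]mulrC.
          rewrite exprMn exprVn exprD; field.
          by rewrite expf_eq0 (gt_eqF w0) andbF.
        - by move=> w; rewrite posE => /ltW w0; rewrite lee_fin !mulr_ge0 ?exprn_ge0 ?expR_ge0.
        - apply/measurable_EFinP; apply: continuous_measurable_pos => w w0.
          apply: cvgM; last by apply: cvgMl_tmp; exact: exprn_continuous.
          apply: (@continuous_comp _ _ _ (fun p : R => - (p ^+ 3) ^+ 2 - (t ^+ 3 / p ^+ 3) ^+ 2) expR); last exact: continuous_expR.
          apply: cvgB.
            apply: cvgN; apply: (@continuous_comp _ _ _ (fun p : R => p ^+ 3) (fun y => y ^+ 2)); exact: exprn_continuous.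
          apply: (@continuous_comp _ _ _ (fun p : R => t ^+ 3 / p ^+ 3) (fun y => y ^+ 2)); last exact: exprn_continuous.
          apply: cvgMl_tmp; apply: cvgV; first by rewrite lt0r_neq0 ?exprn_gt0.
          exact: exprn_continuous.
        - by rewrite divr_ge0// exprn_ge0// ltW.
      by rewrite e -!EFinM; congr EFin; field.
    * move=> p p0; apply: (@continuous_comp _ _ _ (fun p : R => - p ^+ 2 - (t ^+ 3 / p) ^+ 2) expR); last exact: continuous_expR.
      apply: cvgB; first by apply: cvgN; exact: exprn_continuous.
      apply: (@continuous_comp _ _ _ (fun p : R => t ^+ 3 / p) (fun y => y ^+ 2)); last exact: exprn_continuous.
      by apply: cvgMl_tmp; apply: cvgV; [exact: lt0r_neq0|exact: cvg_id].
    * by move=> p _; exact: expR_ge0.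
  + by move=> w; rewrite posE => /ltW w0; rewrite lee_fin !mulr_ge0 ?exprn_ge0 ?expR_ge0.
  + apply/measurable_EFinP; apply: (measurable_funS measurableT) => //.
    apply: measurable_funM => //; apply: measurable_expR_comp.
    by apply: measurableT_comp => //; apply: measurable_funM.
- have mh : measurable_fun setT (fun p : R * R => h p.1).
    apply: measurable_expR_comp; apply: measurableT_comp => //.
    by apply: (measurableT_comp (@measurable_ln R)); exact: measurable_fst.
  have m1 : measurable_fun setT (fun p : R * R => h p.1 * p.2).
    by apply: measurable_funM => //; exact: measurable_snd.
  have m2 n : measurable_fun setT (fun p : R * R => p.1 ^+ n) by apply: measurable_funX; exact: measurable_fst.
  apply: measurable_funM; [apply: measurable_funM|apply: measurable_funM; [apply: measurable_funM|]].
  + exact: m2.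
  + by apply: measurable_expR_comp; apply: measurableT_comp => //; exact: m2.
  + exact: measurable_funX.
  + by apply: measurable_expR_comp; apply: measurableT_comp => //; exact: measurable_funX.
  + exact: mh.
- move=> w q /ltW w0 /ltW q0.
  have hw : 0 <= h w by exact: expR_ge0.
  have hq : 0 <= h w * q by exact: mulr_ge0.
  apply: mulr_ge0; [apply: mulr_ge0|apply: mulr_ge0; [apply: mulr_ge0|]] => //; by [exact: exprn_ge0|exact: expR_ge0].
Qed.

End StretchedProducts.

(** * Duplication and reflection formulas *)

Section GammaFinal.
Context {R : realType}.
Local Notation mu := (@lebesgue_measure R).
Local Notation pos := (`]0%R, +oo[%classic : set R).
Local Notation sm := (@stretched_moment R).
Implicit Types (F G f g : R -> R) (x : R).

Definition stretched k n : R := fine (sm k n).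

Lemma stretchedE k n : (1 < n)%N -> sm k n = (stretched k n)%:E.
Proof. by move=> n1; rewrite fineK//; exact: fin_num_stretched. Qed.

(** Expanding cos (pi / 2) as the cosine of three times pi / 6 gives 1 - 4 sin^2 = 0 at pi / 6. *)
Lemma atan_inv_sqrt3 : atan (Num.sqrt (3:R))^-1 = pi / 6.
Proof.
have pi0 := pi_gt0 R.
have h3 : cos (pi / 6 + pi / 6 + pi / 6 : R) = 0.
  by rewrite (_ : _ + _ + _ = pi / 2); [rewrite cos_pihalf|field].
have c0 : 0 < cos (pi / 6 : R) by apply: cos_gt0_pihalf; lra.
have s0 : 0 < sin (pi / 6 : R) by apply: sin_gt0_pi; lra.
have cs := cos2Dsin2 (pi / 6 : R).
move: h3; rewrite !cosD sinD => h3.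
have s2 : sin (pi / 6 : R) = 1 / 2.
  have : cos (pi / 6 : R) * (1 - 4 * sin (pi / 6) ^+ 2) = 0.
    move: (sin (pi / 6 : R)) (cos (pi / 6 : R)) cs h3 => S C cs <-; rewrite (_ : 1 - _ = C ^+ 2 - 3 * S ^+ 2); [ring|lra].
  by move/eqP; rewrite mulf_eq0 (gt_eqF c0)/= => /eqP h; nra.
have c2 : cos (pi / 6 : R) ^+ 2 = 3 / 4 by nra.
have q0 : 0 < Num.sqrt 3 :> R by rewrite sqrtr_gt0.
have q2 : Num.sqrt 3 ^+ 2 = 3 :> R by rewrite sqr_sqrtr.
have c1 : cos (pi / 6 : R) = Num.sqrt 3 / 2 by nra.
have <- : tan (pi / 6) = (Num.sqrt 3)^-1 :> R.
  by rewrite /tan s2 c1; field; exact: lt0r_neq0.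
by apply: tanK; rewrite in_itv/=; lra.
Qed.

(** Substitution t = x^3; j = 0 and j = 1 give Gamma (1/3) and Gamma (2/3). *)
Lemma Gamma_stretched j (a : R) : 3 * a = j.+1%:R -> Gamma a = 3 * stretched j 3.
Proof.
move=> aj; rewrite /Gamma /Rintegral.
pose G (t : R) := expR ((a - 1) * ln t) * expR (- t).
have cG (t : R) : 0 < t -> {for t, continuous G}.
  move=> t0; apply: cvgM.
    apply: (@continuous_comp _ _ _ (fun t : R => (a - 1) * ln t) expR); last exact: continuous_expR.
    by apply: cvgMl_tmp; exact: continuous_ln.
  apply: (@continuous_comp _ _ _ (fun t : R => - t) expR); last exact: continuous_expR.
  by apply: cvgN; exact: cvg_id.
have -> : (\int[mu]_(t in pos) (t `^ (a - 1) * expR (- t))%:E = \int[mu]_(t in pos) (G t)%:E)%E.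
  apply: eq_integral => t /set_mem; rewrite posE => t0.
  by rewrite /G /powR gt_eqF.
rewrite (@power_pos _ 2 G)//; last by move=> t _; rewrite /G mulr_ge0 ?expR_ge0.
have -> : (\int[mu]_(x in pos) (G (x ^+ 3) * (3 * x ^+ 2))%:E = 3%:E * sm j 3)%E.
  rewrite -ge0_integralZl_EFin//.
  - apply: eq_integral => x /set_mem; rewrite posE => x0; rewrite -EFinM; congr EFin.
    rewrite /G lnXn// (_ : (a - 1) * (ln x *+ 3) = (ln x *+ j.+1) - (ln x *+ 3)); last first.
      by rewrite -![ln x *+ _]mulr_natr -aj; ring.
    rewrite expRD expRN -!lnXn// !lnK ?posrE ?exprn_gt0// exprS.
    by field; exact: lt0r_neq0.
  - by move=> x; rewrite posE => x0; rewrite lee_fin stretched_pos_ge0.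
  - exact: measurable_stretched.
by rewrite stretchedE.
Qed.

Lemma stretched_half i : stretched i 3 = 2 * stretched (2 * i + 1) 6.
Proof.
apply: EFin_inj; rewrite EFinM -!stretchedE// /sm.
rewrite (@power_pos _ 1 (fun x => x ^+ i * expR (- x ^+ 3))).
- rewrite -ge0_integralZl_EFin//.
  + apply: eq_integral => x _; rewrite -EFinM; congr EFin.
    by rewrite -!exprM exprD mulnC expr1; ring.
  + by move=> x; rewrite posE => x0; rewrite lee_fin stretched_pos_ge0.
  + exact: measurable_stretched.
- by move=> x _; exact: continuous_stretched.
- exact: stretched_pos_ge0.
Qed.

Lemma stretched_scale j (r : R) : 0 < r -> r ^+ 3 = 2 ->
  (\int[mu]_(t in pos) (t ^+ j * expR (- (2 * t ^+ 3)))%:E = (stretched j 3 / r ^+ j.+1)%:E)%E.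
Proof.
move=> r0 r3.
have -> : stretched j 3 / r ^+ j.+1 = r ^- j.+1 * stretched j 3 by rewrite mulrC.
rewrite EFinM -stretchedE// /stretched_moment.
rewrite (@scale_pos _ r (fun x => x ^+ j * expR (- x ^+ 3)))//.
- rewrite -ge0_integralZl_EFin//.
  + apply: eq_integral => x _; rewrite -EFinM; congr EFin.
    rewrite !exprMn r3 [r ^+ j.+1]exprS; field.
    by rewrite (gt_eqF r0) expf_eq0 (gt_eqF r0) andbF.
  + by move=> x; rewrite posE => x0; rewrite lee_fin mulr_ge0 ?(ltW r0)// stretched_pos_ge0// mulr_gt0.
  + apply/measurable_EFinP; apply: (measurable_funS measurableT) => //.
    apply: measurable_funM => //; apply: measurable_funM.
      by apply: measurable_funX; exact: measurable_funM.
    apply: measurable_expR_comp; apply: measurableT_comp => //; apply: measurable_funX.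
    exact: measurable_funM.
  + by rewrite invr_ge0 exprn_ge0// ltW.
- by move=> x _; exact: continuous_stretched.
- exact: stretched_pos_ge0.
Qed.

Lemma stretched_duplication j (r : R) : 0 < r -> r ^+ 3 = 2 ->
  stretched (3 + j) 6 * stretched j 6 = Num.sqrt pi / 6 * (stretched j 3 / r ^+ j.+1).
Proof.
move=> r0 r3; have h := @stretched_dupl R j.
rewrite (stretched_scale _ r0 r3) !stretchedE// -!EFinM in h.
exact: EFin_inj h.
Qed.

Lemma sub_sqr_gt0 (q : R) : 0 < 1 - q + q ^+ 2.
Proof. by have := sqr_ge0 (q - 1/2); nra. Qed.

Lemma stretched_reflection : stretched 0 3 * stretched 1 3 = 2 * pi / (9 * Num.sqrt 3).
Proof.
have s0 : 0 < Num.sqrt 3 :> R by rewrite sqrtr_gt0.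
have s2 : Num.sqrt 3 ^+ 2 = 3 :> R by rewrite sqr_sqrtr.
(* The product is written once with q and once with 1 in the numerator over 3 (1 + q^3). Adding the
   two cancels the factor 1 + q and leaves 1 / (3 (1 - q + q^2)), whose primitive is an
   arctangent. *)
suff h : stretched 0 3 * stretched 1 3 + stretched 0 3 * stretched 1 3 = 4 * pi / (9 * Num.sqrt 3).
  move: h; rewrite -mulr2n -[LHS]mulr_natl => h.
  by apply: (mulfI (x := 2)); [rewrite pnatr_eq0|rewrite h; field; exact: lt0r_neq0].
apply: EFin_inj; rewrite EFinD {2}mulrC !EFinM -!stretchedE// !stretched_mul3//.
have m j : measurable_fun pos (fun q : R => (q ^+ j / (3 * (1 + q ^+ 3)))%:E).
  apply/measurable_EFinP; apply: continuous_measurable_pos => q q0.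
  apply: cvgM; first exact: exprn_continuous.
  apply: cvgV; first by rewrite lt0r_neq0// mulr_gt0// addr_gt0// exprn_gt0.
  by apply: cvgMl_tmp; apply: cvgD; [exact: cvg_cst|exact: exprn_continuous].
have p j (q : R) : pos q -> (0%E <= (q ^+ j / (3 * (1 + q ^+ 3)))%:E)%E.
  by rewrite posE => /ltW q0; rewrite lee_fin divr_ge0// ?mulr_ge0// ?addr_ge0// exprn_ge0.
rewrite -(ge0_integralD mu (measurable_itv _) (p 1%N) (m 1%N) (p 0%N) (m 0%N)).
have -> : (\int[mu]_(q in pos) ((q ^+ 1 / (3 * (1 + q ^+ 3)))%:E + (q ^+ 0 / (3 * (1 + q ^+ 3)))%:E) =
   \int[mu]_(q in pos) ((3 * (1 - q + q ^+ 2))^-1)%:E)%E.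
  apply: eq_integral => q /set_mem; rewrite posE => q0; rewrite -EFinD; congr EFin.
  have q1 := sub_sqr_gt0 q; have q3 : 0 < 1 + q ^+ 3 by rewrite addr_gt0// exprn_gt0.
  by rewrite expr1 expr0; field; rewrite !lt0r_neq0.
pose F q : R := 2 / (3 * Num.sqrt 3) * atan ((2 * q - 1) / Num.sqrt 3).
have dF (q : R) : is_derive q 1 F ((3 * (1 - q + q ^+ 2))^-1).
  have h0 : is_derive q 1 (fun q : R => (2 * q - 1) / Num.sqrt 3) (2 / Num.sqrt 3).
    have h := is_deriveZ (Num.sqrt 3)^-1 (is_deriveB (is_deriveZ (2:R) (is_derive_id q (1:R))) (is_derive_cst (1:R) q (1:R))).
    apply: is_derive_transport h _ _ => [u|]; first by rewrite /GRing.scale /= mulrC.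
    by rewrite /GRing.scale /= mulr1 subr0 mulrC.
  have h1 := is_deriveZ (2 / (3 * Num.sqrt 3)) (is_derive1_comp (is_derive1_atan _) h0).
  apply: is_derive_transport h1 _ _ => //.
  rewrite /GRing.scale /= exprMn exprVn s2.
  have q1 := sub_sqr_gt0 q.
  rewrite (_ : 1 + (2 * q - 1) ^+ 2 * 3^-1 = 4 / 3 * (1 - q + q ^+ 2)); last by field.
  rewrite -[in RHS]s2; move: q1 s0; move: (1 - q + q ^+ 2) (Num.sqrt 3) => P s q1 s0.
  by field; rewrite !lt0r_neq0.
have at0 : atan (- (Num.sqrt 3)^-1) = - (pi / 6) :> R by rewrite atanN atan_inv_sqrt3.
rewrite (@ge0_FTC_pos _ F _ (2 / (3 * Num.sqrt 3) * - (pi / 6)) (2 / (3 * Num.sqrt 3) * (pi / 2)))//.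
- by congr EFin; field; exact: lt0r_neq0.
- move=> q _; apply: cvgV; first by rewrite lt0r_neq0// mulr_gt0// sub_sqr_gt0.
  apply: cvgMl_tmp; apply: cvgD; last exact: exprn_continuous.
  by apply: cvgB; [exact: cvg_cst|exact: cvg_id].
- by move=> q _; rewrite invr_ge0 mulr_ge0// ltW// sub_sqr_gt0.
- have := derivable_for_continuous (dF 0); rewrite /prop_for /continuous_at {2}/F.
  rewrite mulr0 sub0r mulN1r at0.
  by move=> h; apply: cvg_at_right_filter.
- apply: cvgMl_tmp; apply: (@cvg_comp _ _ _ (fun q : R => (2 * q - 1) / Num.sqrt 3) atan _ +oo); last exact: cvgy_atan.
  apply/cvgryPge => A; near=> q; rewrite ler_pdivlMr//.
  have : (A * Num.sqrt 3 + 1) / 2 <= q by near: q; apply: nbhs_pinfty_ge; rewrite num_real.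
  by rewrite ler_pdivrMr// => h; lra.
Unshelve. all: end_near. Qed.

End GammaFinal.

(** * The Airy constants matched with the initial values at a = 0 *)

Section AiryConstants.
Context {R : realType}.

Lemma gam_gt0 : 0 < gam R. Proof. by rewrite /gam powR_gt0// divr_gt0. Qed.

Lemma powR_exprn (x a : R) n : (x `^ a) ^+ n = x `^ (a * n%:R).
Proof. by rewrite -powR_mulrn ?powR_ge0// -powRrM. Qed.

Lemma gam_cube : gam R ^+ 3 = 4 / 9.
Proof.
rewrite /gam powR_exprn (_ : 2 / 3 * 3 = 2%:R); last by field.
by rewrite powR_mulrn ?divr_ge0//; field.
Qed.

Lemma cbrt3_gt0 : 0 < (3:R) `^ (1/3). Proof. by rewrite powR_gt0. Qed.

Lemma cbrt3_cube : ((3:R) `^ (1/3)) ^+ 3 = 3.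
Proof. by rewrite powR_exprn divrK ?unitfE// powRr1. Qed.

Lemma stretched3_gt0 : 0 < @stretched R 0 3 /\ 0 < @stretched R 1 3.
Proof.
have h : 0 < @stretched R 0 3 * @stretched R 1 3.
  by rewrite stretched_reflection divr_gt0 ?mulr_gt0 ?pi_gt0 ?sqrtr_gt0.
have p k : 0 <= @stretched R k 3 by rewrite fine_ge0// stretched_moment_ge0.
move: h (p 0%N) (p 1%N); set a := stretched _ _; set b := stretched _ _ => ab a0 b0.
by split; rewrite lt_neqAle ?a0 ?b0 andbT; apply/negP => /eqP e; move: ab; rewrite -e ?mul0r ?mulr0 ltxx.
Qed.

Lemma airy_c1E : airy_c1 R = (((3:R) `^ (1/3)) ^+ 2 * (3 * stretched 1 3))^-1.
Proof.
rewrite /airy_c1 (@Gamma_stretched R 1); last by field.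
by rewrite powR_exprn (_ : 1 / 3 * 2 = 2 / 3)//; field.
Qed.

Lemma airy_c2E : airy_c2 R = ((3:R) `^ (1/3) * (3 * stretched 0 3))^-1.
Proof. by rewrite /airy_c2 (@Gamma_stretched R 0)//; field. Qed.

(** The cube root of 2 required by the duplication formula, written through 3^(1/3) and gamma by
    gamma^3 = 4/9, so that the comparison of constants stays algebraic. *)
Lemma cbrt2E (r := 2 * (3:R) `^ (1/3) / (3 * gam R)) : 0 < r /\ r ^+ 3 = 2.
Proof.
have g0 := gam_gt0; have b0 := cbrt3_gt0; split; first by rewrite divr_gt0 ?mulr_gt0.
rewrite /r expr_div_n !exprMn cbrt3_cube gam_cube.
by field.
Qed.

(** The left side is [umb_weight (airy_c1 R)] and the right side is [sextic_moment 0 0], that is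
    Gamma (1/6) / 3. Duplication with j = 0 pairs Gamma (1/6) with Gamma (2/3). *)
Lemma airy_c1_value :
  2 * pi * Num.sqrt pi * Num.sqrt 3 * gam R * airy_c1 R ^+ 2 = 2 * stretched 0 6.
Proof.
have [r0 r3] := cbrt2E; have [I1 I2] := stretched3_gt0.
have := stretched_duplication 0 r0 r3; rewrite expr1.
have := @stretched_half R 1; rewrite airy_c1E => h2 h1.
have h3 := @stretched_reflection R.
have b0 := cbrt3_gt0; have b3 := cbrt3_cube; have g0 := gam_gt0.
have s0 : 0 < Num.sqrt 3 :> R by rewrite sqrtr_gt0.
have s2 : Num.sqrt 3 ^+ 2 = 3 :> R by rewrite sqr_sqrtr.
have e6 : stretched (3 + 0) 6 = stretched 1 3 / 2 :> R by rewrite h2; field.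
move: h1; rewrite {}e6 {h2} => h1.
have p0 : 0 < Num.sqrt pi :> R by rewrite sqrtr_gt0 pi_gt0.
have -> : stretched 0 6 = Num.sqrt pi * gam R * stretched 0 3 / (2 * 3 `^ (1/3) * stretched 1 3).
  apply: (mulfI (x := stretched 1 3 / 2)); first by rewrite lt0r_neq0 ?divr_gt0.
  by rewrite h1; field; rewrite !lt0r_neq0.
(* The reflection formula read backwards eliminates pi outside the square root; sqrt pi remains as a
   common factor. *)
have ep : pi = stretched 0 3 * stretched 1 3 * 9 * Num.sqrt 3 / 2 :> R.
  by rewrite h3; field; rewrite lt0r_neq0.
move: (Num.sqrt pi) => P in p0 h1 *; rewrite {}ep {h1 h3}.
move: s2 b3 s0 b0 g0 I1 I2; move: (Num.sqrt 3) (3 `^ (1/3)) (gam R) (stretched 0 3) (stretched 1 3).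
move=> s b g J1 J2 s2 b3 s0 b0 g0 I1 I2.
transitivity (s ^+ 2 * (J1 * P * g / (b ^+ 4 * J2))); first by field; rewrite !lt0r_neq0.
by rewrite s2 -b3; field; rewrite !lt0r_neq0.
Qed.

(** The factor (3 gam)^-2 is the k^2 carried by entry 3 of [airy_vec], and the right side is a
    quarter of [sextic_slope 0]. Duplication with j = 1 pairs Gamma (5/6) with Gamma (1/3). *)
Lemma airy_c2_value :
  2 * pi * Num.sqrt pi * Num.sqrt 3 * gam R * airy_c2 R ^+ 2 * (3 * gam R)^-1 ^+ 2 = stretched 4 6.
Proof.
have [r0 r3] := cbrt2E; have [I1 I2] := stretched3_gt0.
have := stretched_duplication 1 r0 r3.
have := @stretched_half R 0; rewrite airy_c2E => h2 h1.
have h3 := @stretched_reflection R.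
have b0 := cbrt3_gt0; have b3 := cbrt3_cube; have g0 := gam_gt0; have g3 := gam_cube.
have s0 : 0 < Num.sqrt 3 :> R by rewrite sqrtr_gt0.
have s2 : Num.sqrt 3 ^+ 2 = 3 :> R by rewrite sqr_sqrtr.
have e6 : stretched 1 6 = stretched 0 3 / 2 :> R by rewrite h2; field.
move: h1; rewrite {}e6 {h2} => h1.
have p0 : 0 < Num.sqrt pi :> R by rewrite sqrtr_gt0 pi_gt0.
have -> : stretched 4 6 = Num.sqrt pi * 3 * gam R ^+ 2 * stretched 1 3 / (4 * (3 `^ (1/3)) ^+ 2 * stretched 0 3).
  apply: (mulIf (x := stretched 0 3 / 2)); first by rewrite lt0r_neq0 ?divr_gt0.
  by rewrite h1; field; rewrite !lt0r_neq0.
have ep : pi = stretched 0 3 * stretched 1 3 * 9 * Num.sqrt 3 / 2 :> R.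
  by rewrite h3; field; rewrite lt0r_neq0.
move: (Num.sqrt pi) => P in p0 h1 *; rewrite {}ep {h1 h3}.
move: s2 b3 g3 s0 b0 g0 I1 I2; move: (Num.sqrt 3) (3 `^ (1/3)) (gam R) (stretched 0 3) (stretched 1 3).
move=> s b g J1 J2 s2 b3 g3 s0 b0 g0 I1 I2.
transitivity (s ^+ 2 * (P * J2 / (9 * b ^+ 2 * J1 * g))); first by field; rewrite !lt0r_neq0.
rewrite s2; transitivity (P * 3 * J2 / (4 * b ^+ 2 * J1 * g) * (4 / 9)); first by field; rewrite !lt0r_neq0.
by rewrite -g3; field; rewrite !lt0r_neq0.
Qed.

End AiryConstants.

(** * The umbilic integral on the axis x = y = z = 0 *)

Section SexticIntegral.
Context {R : realType}.
Local Notation mu := (@lebesgue_measure R).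
Implicit Types (a v A : R) (k : nat).

(* sextic a v = v^2 (v^2 + a)^2. Up to constants, sextic_moment 0 a is
   sqrt a * exp w * K_{1/6}(w) with w = 2 a^3 / 27: substitute v / sqrt a for a
   multiple of sinh (t / 6) in the integral of exp (- w cosh t) * cosh (t / 6). *)
Definition sextic a v : R := v ^+ 6 + 2 * a * v ^+ 4 + a ^+ 2 * v ^+ 2.

Definition sextic_term a k v : R := v ^+ k * expR (- sextic a v).

Definition sextic_moment k a : R := Rintegral mu setT (sextic_term a k).

(** If v^2 <= A + 1 the left side is at most 0; otherwise v^2 + a >= 1 and the sextic is at least
    v^2. *)
Lemma sextic_ge A a v : `|a| <= A -> v ^+ 2 - (A + 1) <= sextic a v.
Proof.
move=> aA; have aA' : - A <= a by have := ler_norm (- a); rewrite normrN; lra.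
have -> : sextic a v = v ^+ 2 * (v ^+ 2 + a) ^+ 2 by rewrite /sextic; ring.
have t0 := sqr_ge0 v; move: (v ^+ 2) t0 => t t0.
have [h|h] := leP t (A + 1).
  by have := mulr_ge0 t0 (sqr_ge0 (t + a)); lra.
have h1 : 1 <= (t + a) ^+ 2 by rewrite exprn_ege1//; lra.
have A0 : 0 <= A by exact: le_trans (normr_ge0 a) aA.
nra.
Qed.

Lemma sextic_term_bound A k : exists K : R, forall a v, `|a| <= A ->
  `|sextic_term a k v| <= K * expR (- (2^-1 * v ^+ 2)).
Proof.
exists (k`!%:R * expR (1/2) * expR (A + 1)) => a v aA.
rewrite /sextic_term normrM [`|expR _|]ger0_norm ?expR_ge0// normrX.
have h1 : `|v| ^+ k <= k`!%:R * expR `|v| by exact: exprn_le_expR.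
have h2 : expR `|v| <= expR (1/2) * expR (2^-1 * v ^+ 2).
  rewrite -expRD ler_expR; have := sqr_ge0 (`|v| - 1); have := real_normK (num_real v); nra.
have h3 : expR (- sextic a v) <= expR (A + 1) * expR (- v ^+ 2).
  by rewrite -expRD ler_expR; have := sextic_ge v aA; lra.
apply: (@le_trans _ _ (k`!%:R * (expR (1/2) * expR (2^-1 * v ^+ 2)) * (expR (A + 1) * expR (- v ^+ 2)))).
  rewrite ler_pM ?exprn_ge0 ?expR_ge0//.
  by apply: (le_trans h1); rewrite ler_wpM2l.
have e : expR (- (2^-1 * v ^+ 2)) = expR (2^-1 * v ^+ 2) * expR (- v ^+ 2).
  by rewrite -expRD; congr expR; field.
by rewrite e le_eqVlt; apply/orP; left; apply/eqP; ring.
Qed.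

Lemma is_derive_sextic_v a v :
  is_derive v 1 (sextic a) (6 * v ^+ 5 + 8 * a * v ^+ 3 + 2 * a ^+ 2 * v).
Proof.
have h := is_deriveD (is_deriveD (is_derive_expr 6 v) (is_deriveZ (2 * a) (is_derive_expr 4 v)))
  (is_deriveZ (a ^+ 2) (is_derive_expr 2 v)).
by apply: is_derive_transport h _ _ => //; rewrite /GRing.scale /= expr1; ring.
Qed.

Lemma is_derive_sextic_a a v :
  is_derive a 1 (sextic ^~ v) (2 * v ^+ 4 + 2 * a * v ^+ 2).
Proof.
have h := is_deriveD (is_deriveD (is_derive_cst (v ^+ 6) a (1:R)) (is_deriveZ (2 * v ^+ 4) (is_derive_id a (1:R))))
  (is_deriveZ (v ^+ 2) (is_derive_expr 2 a)).
apply: is_derive_transport h _ _ => [u|]; 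
  first by transitivity (v ^+ 6 + (2 * v ^+ 4) * u + v ^+ 2 * u ^+ 2) => //; rewrite /sextic; ring.
by rewrite /GRing.scale /= expr1; ring.
Qed.

Lemma is_derive_sextic_term_v a k v : is_derive v 1 (sextic_term a k.+1)
  (k.+1%:R * sextic_term a k v - 6 * sextic_term a (k + 6) v - 8 * a * sextic_term a (k + 4) v
   - 2 * a ^+ 2 * sextic_term a (k + 2) v).
Proof.
have h := is_deriveM (is_derive_expr k.+1 v) (is_derive1_comp (is_derive_expR _) (is_deriveN (is_derive_sextic_v a v))).
apply: is_derive_transport h _ _ => //.
rewrite /GRing.scale /= /sextic_term !exprD exprS.
by move: (expR _) (v ^+ k) => E V; ring.
Qed.

Lemma is_derive_sextic_term_a a k v : is_derive a 1 (fun u => sextic_term u k v)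
  (- 2 * sextic_term a (k + 4) v - 2 * a * sextic_term a (k + 2) v).
Proof.
have h := is_deriveZ (v ^+ k) (is_derive1_comp (is_derive_expR _) (is_deriveN (is_derive_sextic_a a v))).
apply: is_derive_transport h _ _ => //.
by rewrite /GRing.scale /= /sextic_term !exprD; move: (expR _) (v ^+ k) => E V; ring.
Qed.

Lemma continuous_sextic_term a k : continuous (sextic_term a k).
Proof.
case: k => [|k] v; last exact: derivable_for_continuous (is_derive_sextic_term_v a k v).
have h := is_derive1_comp (is_derive_expR _) (is_deriveN (is_derive_sextic_v a v)).
rewrite (_ : sextic_term a 0 = expR \o (fun v => - sextic a v)); first exact: derivable_for_continuous h.
by apply/funext => u; rewrite /sextic_term mul1r.
Qed.

Lemma integrable_sextic_term a k : mu.-integrable setT (EFin \o sextic_term a k).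
Proof.
have [K hK] := sextic_term_bound `|a| k.
have h := integrable_scale K measurableT (integrable_gaussian (c := 2^-1 : R) ltac:(by [])).
apply: integrable_le_norm h _ => //; first by apply: continuous_measurable_fun; exact: continuous_sextic_term.
by move=> v _; exact: hK.
Qed.

Lemma Rintegral_linear2 (c d : R) (f g : R -> R) : mu.-integrable setT (EFin \o f) ->
  mu.-integrable setT (EFin \o g) ->
  Rintegral mu setT (fun v => c * f v + d * g v) = c * Rintegral mu setT f + d * Rintegral mu setT g.
Proof.
move=> hf hg; rewrite (@RintegralD _ _ _ mu setT (fun v => c * f v) (fun v => d * g v))//.
- by rewrite !RintegralZl.
- exact: integrable_scale.
- exact: integrable_scale.
Qed.

Lemma is_derive_sextic_moment k a : is_derive a 1 (sextic_moment k)
  (- 2 * sextic_moment (k + 4) a - 2 * a * sextic_moment (k + 2) a).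
Proof.
have [K1 h1] := sextic_term_bound (`|a| + 1) (k + 4).
have [K2 h2] := sextic_term_bound (`|a| + 1) (k + 2).
have ig := integrable_scale (2 * K1 + 2 * (`|a| + 1) * K2) measurableT (integrable_gaussian (c := 2^-1 : R) ltac:(by [])).
have e : - 2 * sextic_moment (k + 4) a - 2 * a * sextic_moment (k + 2) a =
  Rintegral mu setT (fun v => - 2 * sextic_term a (k + 4) v - 2 * a * sextic_term a (k + 2) v).
  rewrite /sextic_moment -mulNr -Rintegral_linear2; try exact: integrable_sextic_term.
  by apply: eq_Rintegral => v _; ring.
rewrite e.
apply: (@is_derive_under_integral _ _ _ mu (fun u => sextic_term u k)
  (fun a v => - 2 * sextic_term a (k + 4) v - 2 * a * sextic_term a (k + 2) v) _ a (a - 1) (a + 1)) ig _.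
- by rewrite gtrBl ltrDl ltr01.
- by move=> u _; exact: integrable_sextic_term.
- by move=> u v _; exact: is_derive_sextic_term_a.
- move=> u v uI.
  have uA : `|u| <= `|a| + 1.
    rewrite -[u](subrK a) addrC (le_trans (ler_normD _ _))// lerD2l ler_norml; lra.
  apply: (le_trans (ler_normB _ _)); rewrite [leRHS]mulrDl; apply: lerD.
    by rewrite normrM normrN normr_nat -mulrA ler_wpM2l// h1.
  rewrite !normrM normr_nat -!mulrA ler_wpM2l// ler_pM//.
  by rewrite -normrM; exact: h2.
Qed.

Lemma sextic_moment_ibp k a : k.+1%:R * sextic_moment k a - 6 * sextic_moment (k + 6) a
  - 8 * a * sextic_moment (k + 4) a - 2 * a ^+ 2 * sextic_moment (k + 2) a = 0.
Proof.
have i j := integrable_sextic_term a j.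
have i2 c d j l : mu.-integrable setT (EFin \o (fun v => c * sextic_term a j v + d * sextic_term a l v)).
  by apply: (@integrableD _ _ _ mu setT measurableT (fun v => (c * sextic_term a j v)%:E) (fun v => (d * sextic_term a l v)%:E)); apply: integrable_scale.
have e v : k.+1%:R * sextic_term a k v - 6 * sextic_term a (k + 6) v - 8 * a * sextic_term a (k + 4) v
   - 2 * a ^+ 2 * sextic_term a (k + 2) v =
   1 * (k.+1%:R * sextic_term a k v + - 6 * sextic_term a (k + 6) v)
   + 1 * (- (8 * a) * sextic_term a (k + 4) v + - (2 * a ^+ 2) * sextic_term a (k + 2) v) by ring.
have [K hK] := sextic_term_bound `|a| k.+1.
have hK' v : `|sextic_term a k.+1 v| <= K * expR (- (2^-1 * v ^+ 2)) by exact: hK.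
have c2 : 0 < 2^-1 :> R by rewrite invr_gt0.
have := @Rintegral_deriv_vanish R (sextic_term a k.+1) _ _ (is_derive_sextic_term_v a k) _
  (cvg0_le_gaussian c2 sqr_cvgy hK') (cvg0_le_gaussian c2 sqr_cvgNy hK').
under [X in Rintegral mu setT X]eq_fun do rewrite e.
rewrite !Rintegral_linear2 ?i2// => h.
rewrite -[RHS]h; first by rewrite /sextic_moment; ring.
- rewrite (_ : _ \o _ = EFin \o (fun v => 1 * (k.+1%:R * sextic_term a k v + - 6 * sextic_term a (k + 6) v)
   + 1 * (- (8 * a) * sextic_term a (k + 4) v + - (2 * a ^+ 2) * sextic_term a (k + 2) v))); last first.
    by apply/funext => v /=; rewrite e.
  by apply: (@integrableD _ _ _ mu setT measurableT (fun v => (1 * (k.+1%:R * sextic_term a k v + - 6 * sextic_term a (k + 6) v))%:E) (fun v => (1 * (- (8 * a) * sextic_term a (k + 4) v + - (2 * a ^+ 2) * sextic_term a (k + 2) v))%:E)); apply: integrable_scale.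
- by move=> v; apply: cvgB; [apply: cvgB; [apply: cvgB|]|]; apply: cvgMl_tmp; exact: continuous_sextic_term.
Qed.

(** Minus the derivative of [sextic_moment 0], the counterpart of the moment of index (1,1), which
    is minus the derivative of the zeroth moment for real a. *)
Definition sextic_slope a : R := 2 * sextic_moment 4 a + 2 * a * sextic_moment 2 a.

Lemma is_derive_sextic0 a : is_derive a 1 (sextic_moment 0) (- sextic_slope a).
Proof.
by apply: is_derive_transport (is_derive_sextic_moment 0 a) _ _ => //; rewrite /sextic_slope; ring.
Qed.

(** Integration by parts for k = 0 and k = 2 eliminates the moments of order 6 and 8. With
    [is_derive_sextic0] this is the system that [umb_vec_real0] and [umb_vec_real3] state for the
    plane moments. *)
Lemma is_derive_sextic_slope a :
  is_derive a 1 sextic_slope (4 / 9 * a * (a * sextic_slope a - sextic_moment 0 a)).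
Proof.
have h := is_deriveD (is_deriveZ (2:R) (is_derive_sextic_moment 4 a))
  (is_deriveM (is_deriveZ (2:R) (is_derive_id a (1:R))) (is_derive_sextic_moment 2 a)).
apply: is_derive_transport h _ _ => //.
have e0 := sextic_moment_ibp 0 a; have e2 := sextic_moment_ibp 2 a.
rewrite /GRing.scale /= mulr1 /sextic_slope.
move: e0 e2; rewrite !add0n -[(2 + 6)%N]/8%N -[(2 + 4)%N]/6%N -[(2 + 2)%N]/4%N -[(4 + 4)%N]/8%N -[(4 + 2)%N]/6%N.
move: (sextic_moment 0 a) (sextic_moment 2 a) (sextic_moment 4 a) (sextic_moment 6 a) (sextic_moment 8 a).
move=> m0 m2 m4 m6 m8 e0 e2.
have -> : m8 = (3 * m2 - 8 * a * m6 - 2 * a ^+ 2 * m4) / 6 by lra.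
have -> : m6 = (m0 - 8 * a * m4 - 2 * a ^+ 2 * m2) / 6 by lra.
by rewrite -[2 *: a]/(2 * a); field.
Qed.

Lemma Rintegral_gaussian (b : R) : 0 < b ->
  Rintegral mu setT (fun t => expR (- (b ^+ 2 * t ^+ 2))) = Num.sqrt pi / b.
Proof.
move=> b0; pose s : R := (b * Num.sqrt 2)^-1.
have r2 : 0 < Num.sqrt 2 :> R by rewrite sqrtr_gt0.
have q2 : Num.sqrt 2 ^+ 2 = 2 :> R by rewrite sqr_sqrtr.
have s0 : 0 < s by rewrite invr_gt0 mulr_gt0.
have s2 : s ^+ 2 = (2 * b ^+ 2)^-1 by rewrite /s exprVn exprMn q2 mulrC.
have p0 := pi_gt0 R.
have nE : normal_peak s = b / Num.sqrt pi.
  rewrite /normal_peak s2 (_ : _ *+ 2 = pi / b ^+ 2); last first.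
    by rewrite -mulr_natr; field; exact: lt0r_neq0.
  rewrite sqrtrM ?ltW// sqrtrV ?exprn_ge0 ?ltW// sqrtr_sqr gtr0_norm// invfM invrK mulrC//.
have := integral_normal_pdf 0 s.
have -> : (\int[mu]_x (normal_pdf 0 s x)%:E = (b / Num.sqrt pi)%:E *
    \int[mu]_x (expR (- (b ^+ 2 * x ^+ 2)))%:E)%E.
  rewrite -integralZl//; last by apply: integrable_gaussian; rewrite exprn_gt0.
  apply: eq_integral => x _; rewrite -EFinM /normal_pdf (gt_eqF s0) nE; congr (_ * _)%:E.
  rewrite /normal_fun subr0 s2; congr expR; rewrite -mulr_natr; field; exact: lt0r_neq0.
have ig := integrable_gaussian (exprn_gt0 2 b0).
have -> : (\int[mu]_x (expR (- (b ^+ 2 * x ^+ 2)))%:E = (Rintegral mu setT (fun t => expR (- (b ^+ 2 * t ^+ 2))))%:E)%E.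
  by rewrite /Rintegral fineK//; exact: integrable_fin_num.
rewrite -EFinM => /eqP; rewrite eqe => /eqP h.
have sp : 0 < Num.sqrt pi :> R by rewrite sqrtr_gt0.
apply: (mulfI (x := b / Num.sqrt pi)); first by rewrite lt0r_neq0 ?divr_gt0.
by rewrite h; field; rewrite !lt0r_neq0.
Qed.

Lemma sextic_moment_gt0 a : 0 < sextic_moment 0 a.
Proof.
(* On [0, 1] the sextic is at most the sum of the absolute values of its coefficients. *)
pose M := expR (- (1 + 2 * `|a| + a ^+ 2)).
pose I : set R := `[0, 1]%classic.
have M0 : 0 < M by exact: expR_gt0.
have mI : measurable I by exact: measurable_itv.
have i0 := integrable_sextic_term a 0.
have f0 v : 0 <= sextic_term a 0 v by rewrite /sextic_term mul1r expR_ge0.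
have h1 : ((M%:E : \bar R) <= \int[mu]_(v in I) (sextic_term a 0 v)%:E)%E.
  have -> : (M%:E = \int[mu]_(v in I) M%:E :> \bar R)%E.
    rewrite (integral_cst mu mI) [X in (_ * X)%E](_ : _ = 1%E) ?mule1//.
    by have := @lebesgue_measure_itv R `[0, 1]; rewrite /= lte01 sube0.
  apply: ge0_le_integral => //.
  - by move=> v _; rewrite lee_fin ltW.
  - apply/measurable_EFinP; apply: (measurable_funS measurableT) => //.
    by apply: continuous_measurable_fun; exact: continuous_sextic_term.
  - move=> v; rewrite /I /= in_itv /= => /andP[v0 v1].
    rewrite lee_fin /sextic_term mul1r ler_expR lerN2 /sextic.
    have k n : 0 <= v ^+ n <= 1 by rewrite exprn_ge0//= exprn_ile1.
    have := k 6%N; have := k 4%N; have := k 2%N; have := ler_norm a; have := normr_ge0 a; have := sqr_ge0 a.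
    by nra.
rewrite -lte_fin /sextic_moment /Rintegral fineK; last exact: integrable_fin_num.
apply: (@lt_le_trans _ _ M%:E); first by rewrite lte_fin.
have f0' v : setT v -> (0 <= (sextic_term a 0 v)%:E)%E by rewrite lee_fin.
apply: (le_trans h1); apply: ge0_subset_integral => //; try exact: f0'.
by apply/measurable_EFinP; apply: continuous_measurable_fun; exact: continuous_sextic_term.
Qed.

(** For a >= 1 the polynomial in the slope is at most 3 S, where S is the sextic, and 3 S exp (- S)
    = 6 (S/2) exp (- S/2) exp (- S/2) <= 6 exp (- S/2). Boundedness is what excludes the solution
    growing like exp (4 a^3 / 27). *)
Lemma sextic_bounded : exists K : R, forall a, 1 <= a ->
  `|sextic_moment 0 a| <= K /\ `|sextic_slope a| <= K.
Proof.
pose g (v : R) := 6 * expR (- (2^-1 * v ^+ 2)).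
have ig : mu.-integrable setT (EFin \o g).
  by apply: integrable_scale => //; apply: integrable_gaussian; rewrite invr_gt0.
exists (Rintegral mu setT g) => a a1.
have q v : v ^+ 2 <= sextic a v /\ 2 * v ^+ 4 + 2 * a * v ^+ 2 <= 3 * sextic a v.
  rewrite /sextic; have -> : v ^+ 6 = (v ^+ 2) ^+ 3 by rewrite -exprM.
  have -> : v ^+ 4 = (v ^+ 2) ^+ 2 by rewrite -exprM.
  have t0 := sqr_ge0 v; move: (v ^+ 2) t0 => t t0.
  have h3 : 0 <= t ^+ 3 by exact: exprn_ge0.
  have h2 : 0 <= t ^+ 2 by exact: exprn_ge0.
  have h4 : 0 <= (a - 1) * t ^+ 2 by rewrite mulr_ge0// subr_ge0.
  have h5 : 0 <= (a - 1) * t by rewrite mulr_ge0// subr_ge0.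
  have h6 : 0 <= (a - 1) * ((a - 1) * t) by rewrite mulr_ge0// subr_ge0.
  by split; lra.
have bound f : mu.-integrable setT (EFin \o f) -> (forall v, `|f v| <= g v) -> `|Rintegral mu setT f| <= Rintegral mu setT g.
  move=> i_f fg; apply: (le_trans (le_normr_Rintegral _ i_f)) => //; apply: le_Rintegral => //.
  exact: integrable_norm.
split.
  apply: bound => [|v]; first exact: integrable_sextic_term.
  have [q1 _] := q v; rewrite /sextic_term mul1r ger0_norm ?expR_ge0// /g.
  have h : expR (- sextic a v) <= expR (- (2^-1 * v ^+ 2)) by rewrite ler_expR; have := sqr_ge0 v; lra.
  by have := expR_gt0 (- (2^-1 * v ^+ 2)); lra.
have -> : sextic_slope a = Rintegral mu setT (fun v => 2 * sextic_term a 4 v + 2 * a * sextic_term a 2 v).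
  by rewrite Rintegral_linear2//; exact: integrable_sextic_term.
apply: bound => [|v].
  by apply: (@integrableD _ _ _ mu setT measurableT (fun v => (2 * sextic_term a 4 v)%:E) (fun v => (2 * a * sextic_term a 2 v)%:E)); apply: integrable_scale => //; exact: integrable_sextic_term.
have [q1 q2] := q v; rewrite /sextic_term /g.
have v2 := sqr_ge0 v; have v4 : 0 <= v ^+ 4 by rewrite exprn_even_ge0.
rewrite [2 * (_ * _)]mulrA [2 * a * (_ * _)]mulrA -mulrDl ger0_norm; last first.
  apply: mulr_ge0; last exact: expR_ge0.
  by have := mulr_ge0 (le_trans ler01 a1) v2; lra.
apply: (@le_trans _ _ (3 * sextic a v * expR (- sextic a v))).
  by apply: ler_wpM2r; [exact: expR_ge0|lra].
have h : sextic a v / 2 <= expR (sextic a v / 2) by have := expR_ge1Dx (sextic a v / 2); lra.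
have e : expR (- sextic a v) = expR (- (sextic a v / 2)) * expR (- (sextic a v / 2)).
  by rewrite -expRD; congr expR; field.
have h' : expR (- (sextic a v / 2)) <= expR (- (2^-1 * v ^+ 2)) by rewrite ler_expR; lra.
have h2 : sextic a v / 2 * expR (- (sextic a v / 2)) <= 1.
  by rewrite -[leRHS](expRxMexpNx_1 (sextic a v / 2)); apply: ler_wpM2r; rewrite ?expR_ge0.
have h3 := ler_wpM2r (expR_ge0 (- (sextic a v / 2))) h2; rewrite e.
set E := expR (- (sextic a v / 2)) in h3 h' *.
have -> : 3 * sextic a v * (E * E) = 6 * (sextic a v / 2 * E * E) by field.
by apply: ler_wpM2l => //; apply: (le_trans h3); rewrite mul1r.
Qed.

End SexticIntegral.

Section SexticValues.
Context {R : realType}.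
Local Notation mu := (@lebesgue_measure R).
Local Notation pos := (`]0%R, +oo[%classic : set R).
Implicit Types (a v : R).

(** With s = a^2 v^2 / 2 the part of the sextic beyond a^2 v^2 equals 8 s^3 / a^6 + 8 s^2 / a^3. The
    bounds s^3 <= 6 exp s and s^2 <= 2 exp s give 48 + 16 = 64, and exp s uses up half of the
    Gaussian. *)
Lemma sextic_term_bound_asymp a v : 1 <= a ->
  `|sextic_term a 0 v - expR (- (a ^+ 2 * v ^+ 2))| <=
    64 / a ^+ 3 * expR (- ((a / Num.sqrt 2) ^+ 2 * v ^+ 2)).
Proof.
move=> a1; have a0 : 0 < a by exact: lt_le_trans a1.
rewrite /sextic_term mul1r expr_div_n sqr_sqrtr//.
pose s := a ^+ 2 * v ^+ 2 / 2.
have s0 : 0 <= s by rewrite /s divr_ge0// mulr_ge0// sqr_ge0.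
have p k : s ^+ k <= k`!%:R * expR s by exact: exprn_le_expR.
pose y := v ^+ 6 + 2 * a * v ^+ 4.
have v6 : 0 <= v ^+ 6 by rewrite exprn_even_ge0.
have v4 : 0 <= v ^+ 4 by rewrite exprn_even_ge0.
have y0 : 0 <= y by have := mulr_ge0 (ltW a0) v4; rewrite /y; lra.
have -> : sextic a v = y + s + s by rewrite /sextic /y /s; field.
have -> : a ^+ 2 / 2 * v ^+ 2 = s by rewrite /s; field.
have -> : a ^+ 2 * v ^+ 2 = s + s by rewrite /s; field.
have E2 : expR (- (s + s)) = expR (- s) * expR (- s) by rewrite -expRD; congr expR; ring.
have -> : expR (- (y + s + s)) = expR (- (s + s)) * expR (- y) by rewrite -expRD; congr expR; ring.
rewrite -{2}[expR (- (s + s))]mulr1 -mulrBr normrM ger0_norm ?expR_ge0//.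
have e1 : `|expR (- y) - 1| <= y.
  have h1 : expR (- y) <= 1 by rewrite -expR0 ler_expR oppr_le0.
  by rewrite ler0_norm ?subr_le0//; have := expR_ge1Dx (- y); lra.
have yE : y <= 64 / a ^+ 3 * expR s.
  have -> : y = 8 * s ^+ 3 / a ^+ 6 + 8 * s ^+ 2 / a ^+ 3.
    by rewrite /y /s; field; exact: lt0r_neq0.
  have i3 : 0 < (a ^+ 3)^-1 by rewrite invr_gt0 exprn_gt0.
  have i6 : (a ^+ 6)^-1 <= (a ^+ 3)^-1 by rewrite lef_pV2 ?posrE ?exprn_gt0// ler_weXn2l.
  have := p 3%N; have := p 2%N; rewrite -[3`!]/6%N -[2`!]/2%N => p2 p3.
  have E0 := expR_gt0 s.
  have q3 : 8 * s ^+ 3 / a ^+ 6 <= 8 * (6 * expR s) / a ^+ 3.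
    by apply: ler_pM => //; [rewrite mulr_ge0// exprn_ge0|rewrite invr_ge0 exprn_ge0// ltW|rewrite ler_wpM2l].
  have q2 : 8 * s ^+ 2 / a ^+ 3 <= 8 * (2 * expR s) / a ^+ 3.
    by apply: (ler_wpM2r (ltW i3)); apply: ler_wpM2l.
  by move: q2 q3; move: ((a ^+ 3)^-1) (expR s) => I E; lra.
rewrite E2; apply: (@le_trans _ _ (expR (- s) * expR (- s) * (64 / a ^+ 3 * expR s))).
  by apply: ler_wpM2l; [rewrite mulr_ge0 ?expR_ge0|exact: le_trans yE].
rewrite le_eqVlt; apply/orP; left; apply/eqP; rewrite expRN.
by have := expR_gt0 s; move: (expR s) => E E0; field; rewrite !lt0r_neq0.
Qed.

Lemma sextic_moment_asymp : a * sextic_moment 0 a @[a --> +oo] --> Num.sqrt (pi : R).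
Proof.
have r2 : 0 < Num.sqrt 2 :> R by rewrite sqrtr_gt0.
have q2 : Num.sqrt 2 ^+ 2 = 2 :> R by rewrite sqr_sqrtr.
have sp : 0 < Num.sqrt pi :> R by rewrite sqrtr_gt0 pi_gt0.
pose K : R := 64 * (Num.sqrt pi * Num.sqrt 2).
have h a : 1 <= a -> `|a * sextic_moment 0 a - Num.sqrt pi| <= K / a.
  move=> a1; have a0 : 0 < a by exact: lt_le_trans a1.
  have b0 : 0 < a / Num.sqrt 2 by rewrite divr_gt0.
  have i1 := integrable_sextic_term a 0.
  have i2 := integrable_gaussian (exprn_gt0 2 a0).
  have i3 := integrable_scale (64 / a ^+ 3) measurableT (integrable_gaussian (exprn_gt0 2 b0)).
  have e : sextic_moment 0 a - Num.sqrt pi / a =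
      Rintegral mu setT (fun v => sextic_term a 0 v - expR (- (a ^+ 2 * v ^+ 2))).
    by rewrite RintegralB// Rintegral_gaussian.
  have b : `|sextic_moment 0 a - Num.sqrt pi / a| <= 64 / a ^+ 3 * (Num.sqrt pi / (a / Num.sqrt 2)).
    rewrite -(Rintegral_gaussian b0) -RintegralZl//; last exact: integrable_gaussian (exprn_gt0 2 b0).
    have i4 : mu.-integrable setT (EFin \o (fun v => sextic_term a 0 v - expR (- (a ^+ 2 * v ^+ 2)))).
      exact: (@integrableB _ _ _ mu setT measurableT (fun v => (sextic_term a 0 v)%:E) (fun v => (expR (- (a ^+ 2 * v ^+ 2)))%:E)).
    rewrite e; apply: (le_trans (le_normr_Rintegral _ i4)) => //; apply: le_Rintegral => //.
      exact: integrable_norm.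
    by move=> v _; exact: sextic_term_bound_asymp.
  have -> : a * sextic_moment 0 a - Num.sqrt pi = a * (sextic_moment 0 a - Num.sqrt pi / a).
    by field; exact: lt0r_neq0.
  rewrite normrM gtr0_norm//; apply: (le_trans (ler_wpM2l (ltW a0) b)).
  have -> : a * (64 / a ^+ 3 * (Num.sqrt pi / (a / Num.sqrt 2))) = K / a * (a ^+ 2)^-1.
    by rewrite /K; field; rewrite !lt0r_neq0.
  rewrite -[leRHS]mulr1 ler_wpM2l//; first by rewrite divr_ge0 ?mulr_ge0// ltW.
  by rewrite invf_le1 ?exprn_gt0// exprn_ege1.
apply/cvgrPdist_le => e e0; near=> a.
have a1 : 1 <= a by near: a; apply: nbhs_pinfty_ge; rewrite num_real.
rewrite distrC (le_trans (h a a1))// ler_pdivrMr ?(lt_le_trans ltr01)//.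
rewrite mulrC -ler_pdivrMr//; near: a; apply: nbhs_pinfty_ge; rewrite num_real.
Unshelve. all: end_near. Qed.

Lemma Rintegral_even (f : R -> R) (l : R) : continuous f -> (forall v, 0 <= f v) ->
  (forall v, f (- v) = f v) -> (\int[mu]_(v in pos) (f v)%:E = l%:E)%E ->
  Rintegral mu setT f = 2 * l.
Proof.
move=> cf f0 fN fl; have ev : f =1 f \o -%R by move=> v /=; rewrite fN.
rewrite /Rintegral (ge0_symfun_integralT f0 cf ev).
rewrite (_ : [set x | _] = `[0, +oo[%classic); last first.
  by apply/seteqP; split => x/=; rewrite in_itv/= andbT.
have m : measurable_fun pos (EFin \o f).
  apply/measurable_EFinP; apply: (measurable_funS measurableT) => //.
  exact: continuous_measurable_fun.
by rewrite -(integral_itv_obnd_cbnd m) fl.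
Qed.

Lemma sextic_moment_at0 k : ~~ odd k -> sextic_moment k 0 = 2 * stretched k 6 :> R.
Proof.
move=> ek; apply: Rintegral_even; first exact: continuous_sextic_term.
- by move=> v; rewrite /sextic_term mulr_ge0 ?expR_ge0// exprn_even_ge0.
- move=> v; rewrite /sextic_term /sextic.
  have e n : ~~ odd n -> (- v) ^+ n = v ^+ n by move=> on; rewrite exprNn -signr_odd (negbTE on) mul1r.
  by rewrite !e.
- rewrite -stretchedE//; apply: eq_integral => v _.
  by rewrite /sextic_term /sextic mulr0 expr0n/= !mul0r !addr0.
Qed.

Lemma sextic_slope_at0 : sextic_slope 0 = 4 * stretched 4 6 :> R.
Proof. by rewrite /sextic_slope mulr0 mul0r addr0 sextic_moment_at0//; ring. Qed.

End SexticValues.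

(** * The zeroth moment for large real a *)

Section GaussianComparison.
Context {R : realType}.
Local Notation mu := (@lebesgue_measure R).
Local Notation mu2 := (@lebesgue_measure R \x @lebesgue_measure R)%E.
Implicit Types (a : R) (p : R * R).

Lemma lipschitz1_norm (f f' : R -> R) (x : R) : (forall u : R, is_derive u 1 f (f' u)) ->
  (forall u, `|f' u| <= 1) -> `|f x - f 0| <= `|x|.
Proof.
move=> df f1.
have h (a b : R) : a <= b -> `|f b - f a| <= b - a.
  move=> ab; have [c _ ->] := MVT_segment ab (fun u _ => df u) (is_derive_within (fun u _ => df u)).
  by rewrite normrM [`|b - a|]ger0_norm ?subr_ge0// ler_piMl// subr_ge0.
have [x0|/ltW x0] := leP 0 x; first by rewrite [leRHS]ger0_norm// -[leRHS]subr0 h.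
by rewrite [leRHS]ler0_norm// distrC -[leRHS]sub0r h.
Qed.

Lemma normc_cexp_sub1 (x : R) : normc (cexp (x *i) - 1) <= 2 * `|x|.
Proof.
apply: (le_trans (normc_le_ReIm _)); rewrite mulr2n mulrDl mul1r ReB ImB /= expR0 !mul1r subr0.
rewrite lerD//.
  have -> : cos x - 1 = cos x - cos 0 by rewrite cos0.
  by apply: (@lipschitz1_norm _ (fun u => - sin u)) => // u; rewrite normrN ler_norml sin_geN1 sin_le1.
have -> : sin x = sin x - sin 0 by rewrite sin0 subr0.
by apply: (@lipschitz1_norm _ cos) => // u; rewrite ler_norml cos_geN1 cos_le1.
Qed.

Lemma Rintegral_gaussian2 (b : R) : 0 < b ->
  Rintegral mu2 setT (fun p => expR (- (b ^+ 2 * (p.1 ^+ 2 + p.2 ^+ 2)))) = pi / b ^+ 2.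
Proof.
move=> b0; have b2 : 0 < b ^+ 2 by exact: exprn_gt0.
pose g (t : R) := expR (- (b ^+ 2 * t ^+ 2)).
have ig := integrable_gaussian b2; have i2 := integrable_gaussian2 b2.
have gI : (\int[mu]_t (g t)%:E = (Num.sqrt pi / b)%:E)%E.
  by rewrite -Rintegral_gaussian// /Rintegral fineK//; exact: integrable_fin_num.
rewrite /Rintegral fubini_tonelli1.
- rewrite /fubini_F /=.
  have e (x : R) : (\int[mu]_y (expR (- (b ^+ 2 * (x ^+ 2 + y ^+ 2))))%:E = (g x)%:E * (Num.sqrt pi / b)%:E)%E.
    rewrite -gI -integralZl//; apply: eq_integral => y _; rewrite -EFinM /g -expRD; congr (expR _)%:E; ring.
  under eq_integral do rewrite e.
  rewrite integralZr// gI -EFinM /=.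
  by rewrite -[pi in RHS](sqr_sqrtr (pi_ge0 R)); field; exact: lt0r_neq0.
- by case/integrableP : i2.
- by move=> p; rewrite lee_fin expR_ge0.
Qed.

Lemma umb_phase_real a p : umb_phase a%:C 0 0 p =
  (- (a * (p.1 ^+ 2 + p.2 ^+ 2)))%:C + (p.1 ^+ 3 - 3 * p.1 * p.2 ^+ 2)*i.
Proof.
rewrite /umb_phase !mul0r addr0 mulr0 subr0.
have zz : zbar p * zvar p = (p.1 ^+ 2 + p.2 ^+ 2)%:C.
  by apply: complexP; rewrite ?ReM ?ImM /=; ring.
have -> : zvar p ^+ 3 + zbar p ^+ 3 = (2 * (p.1 ^+ 3 - 3 * p.1 * p.2 ^+ 2))%:C.
  by rewrite !exprS expr0; apply: complexP; rewrite ?(ReD, ImD, ReM, ImM) /=; ring.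
have -> : ('i / 2 : R[i]) = 'i * (2^-1)%:C by rewrite fmorphV rmorphMn rmorph1.
rewrite zz; apply: complexP; rewrite ?(ReD, ImD, ReN, ImN, ReM, ImM) /=; last by field.
by ring.
Qed.

(** Replacing the cubic oscillation by 1 costs at most 20 / a times a Gaussian of half the rate,
    whose integral is 2 pi / a. The factor 2 of [normc_cintegral_le] and the factor a in front give
    80 pi / a. *)
Lemma umb_moment_gaussian a : 1 <= a ->
  normc (a%:C * umb_moment a%:C 0 0 0 0 - pi%:C) <= 80 * pi / a.
Proof.
move=> a1; have a0 : 0 < a by exact: lt_le_trans a1.
pose b := Num.sqrt a; have b0 : 0 < b by rewrite sqrtr_gt0.
have b2 : b ^+ 2 = a by rewrite sqr_sqrtr// ltW.
pose c := Num.sqrt (a / 2); have c0 : 0 < c by rewrite sqrtr_gt0 divr_gt0.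
have c2 : c ^+ 2 = a / 2 by rewrite sqr_sqrtr// divr_ge0// ltW.
pose G p : R := expR (- (a * (p.1 ^+ 2 + p.2 ^+ 2))).
have iG : mu2.-integrable setT (EFin \o G) by exact: integrable_gaussian2.
have GI : Rintegral mu2 setT G = pi / a by have := Rintegral_gaussian2 b0; rewrite b2.
have HI : Rintegral mu2 setT (fun p => expR (- (a / 2 * (p.1 ^+ 2 + p.2 ^+ 2)))) = pi / (a / 2).
  by have := Rintegral_gaussian2 c0; rewrite c2.
have iH : mu2.-integrable setT (EFin \o (fun p => expR (- (a / 2 * (p.1 ^+ 2 + p.2 ^+ 2))))).
  by apply: integrable_gaussian2; rewrite divr_gt0.
have ciG : cintegrable mu2 setT (fun p => (G p)%:C).
  by apply/cintegrableP; split => //=; exact: integrable0.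
have cG : cintegral mu2 setT (fun p => (G p)%:C) = (pi / a)%:C.
  by rewrite /cintegral /= GI /Rintegral integral0.
have iU := @cintegrable_umb_term R a%:C 0 0 0 0 a0.
have bnd p : normc (umb_term a%:C 0 0 0 0 p - (G p)%:C) <= 20 / a * expR (- (a / 2 * (p.1 ^+ 2 + p.2 ^+ 2))).
  rewrite /umb_term !expr0 !mul1r umb_phase_real cexpD cexpR -/(G p).
  rewrite -[X in _ - X]mulr1 -mulrBr Normc.normcM normcR ger0_norm ?expR_ge0//.
  set th := p.1 ^+ 3 - _; set r2 := p.1 ^+ 2 + p.2 ^+ 2.
  have r0 : 0 <= r2 by rewrite addr_ge0 ?sqr_ge0.
  (* th is the real part of zeta^3, so |zeta|^6 - th^2 is the square of the imaginary part. Then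
     |zeta|^3 <= |zeta|^2 + |zeta|^4. *)
  have th2 : `|th| <= r2 + r2 ^+ 2.
    have h : th ^+ 2 <= r2 ^+ 3.
      rewrite -subr_ge0 /th /r2.
      rewrite (_ : _ - _ = (3 * p.1 ^+ 2 * p.2 - p.2 ^+ 3) ^+ 2); last by ring.
      exact: sqr_ge0.
    rewrite -(@ler_pXn2r _ 2)// ?nnegrE ?addr_ge0 ?sqr_ge0// real_normK ?num_real//.
    apply: (le_trans h); have := exprn_ge0 4 r0; have := exprn_ge0 3 r0; have := exprn_ge0 2 r0.
    by move: (r2) => r; rewrite !exprS expr0; lra.
  pose s := a * r2 / 2.
  have s0 : 0 <= s by rewrite divr_ge0// mulr_ge0// ltW.
  have p1 : s <= expR s by have := expR_ge1Dx s; lra.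
  have p2 : s ^+ 2 <= 2 * expR s by exact: (exprn_le_expR 2 s0).
  have rs : r2 + r2 ^+ 2 <= 10 / a * expR s.
    have -> : r2 + r2 ^+ 2 = 2 * s / a + 4 * s ^+ 2 / a ^+ 2 by rewrite /s; field; exact: lt0r_neq0.
    have i1 : 0 < a^-1 by rewrite invr_gt0.
    have i2 : (a ^+ 2)^-1 <= a^-1 by rewrite lef_pV2 ?posrE ?exprn_gt0// -[leLHS]expr1 ler_weXn2l.
    have q2 : 4 * s ^+ 2 / a ^+ 2 <= 4 * (2 * expR s) / a.
      by apply: ler_pM => //; [rewrite mulr_ge0// exprn_ge0|rewrite invr_ge0 exprn_ge0// ltW|rewrite ler_wpM2l].
    have q1 : 2 * s / a <= 2 * expR s / a by apply: (ler_wpM2r (ltW i1)); apply: ler_wpM2l.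
    by move: q1 q2; move: (a^-1) (expR s) => I E; lra.
  have E1 : G p = expR (- s) * expR (- s) by rewrite /G -expRD; congr expR; rewrite /s /r2; field.
  have E2 : expR (- (a / 2 * r2)) = expR (- s) by congr expR; rewrite /s; field.
  rewrite E1 E2; apply: (@le_trans _ _ (expR (- s) * expR (- s) * (2 * (10 / a * expR s)))).
    apply: ler_wpM2l; first by rewrite mulr_ge0 ?expR_ge0.
    by apply: (le_trans (normc_cexp_sub1 _)); rewrite ler_wpM2l// (le_trans th2).
  rewrite le_eqVlt; apply/orP; left; apply/eqP; rewrite expRN.
  by have := expR_gt0 s; move: (expR s) => E E0; field; rewrite !lt0r_neq0.
have e : a%:C * umb_moment a%:C 0 0 0 0 - pi%:C =
   a%:C * cintegral mu2 setT (fun p => umb_term a%:C 0 0 0 0 p - (G p)%:C).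
  rewrite cintegralB// cG mulrBr /umb_moment -rmorphM; congr (_ - _%:C); field; exact: lt0r_neq0.
have iB := integrable_scale (20 / a) measurableT iH.
have := normc_cintegral_le (cintegrable_cmeasurable (cintegrableB iU ciG)) iB bnd.
rewrite RintegralZl// HI e Normc.normcM normcR gtr0_norm// => h.
apply: (le_trans (ler_wpM2l (ltW a0) h)).
by rewrite le_eqVlt; apply/orP; left; apply/eqP; field; exact: lt0r_neq0.
Qed.

End GaussianComparison.

(** * The four moments for X = Y = 0 and real a *)

Section RealMoments.
Context {R : realType}.
Local Notation mu := (@lebesgue_measure R).
Local Notation mu2 := (@lebesgue_measure R \x @lebesgue_measure R)%E.
Implicit Types (a : R) (F : R -> R[i]).

Lemma expRN_cvg_cube (c : R) : 0 < c -> expR (- (c * a ^+ 3)) @[a --> +oo] --> (0:R).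
Proof.
move=> c0; apply: (@cvg_comp _ _ _ (fun a : R => c * a ^+ 3) (fun y => expR (- y)) _ +oo); last exact: cvgr_expR.
apply/cvgryPge => A; near=> w.
have w1 : 1 <= w by near: w; apply: nbhs_pinfty_ge; rewrite num_real.
have wA : A / c <= w by near: w; apply: nbhs_pinfty_ge; rewrite num_real.
rewrite -ler_pdivrMl// mulrC (le_trans wA)//.
by rewrite -[leLHS]expr1 ler_weXn2l.
Unshelve. all: end_near. Qed.

(** F is a constant multiple of exp (4 a^3 / 27), which is bounded only if the constant is 0. *)
Lemma exp_growth_bounded_zero F : (forall a, 0 < a -> cderiv F a ((4 / 9 * a ^+ 2)%:C * F a)) ->
  (exists K : R, forall a, 1 <= a -> normc (F a) <= K) -> forall a, 0 < a -> F a = 0.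
Proof.
move=> dF [K FK] a a0.
pose e (a : R) := expR (- (4 / 27 * a ^+ 3)).
have de (u : R) : is_derive u 1 e (- (4 / 9 * u ^+ 2) * e u).
  have h := is_derive1_comp (is_derive_expR _) (is_deriveN (is_deriveZ (4 / 27) (is_derive_expr 3 u))).
  by apply: is_derive_transport h _ _ => //; rewrite /GRing.scale /= /e; field.
have d0 u : 0 < u -> cderiv (fun u => (e u)%:C * F u) u 0.
  move=> u0; apply: (cderiv_transport (cderivM (cderiv_real (de u)) (dF u u0))).
  by rewrite rmorphM /= rmorphN /=; ring.
have const b : a <= b -> (e a)%:C * F a = (e b)%:C * F b.
  by move=> ab; apply: (cderiv0_eq (F := fun u => (e u)%:C * F u) ab) => u /andP[/(lt_le_trans a0)/d0].
have e0 u : 0 < e u by exact: expR_gt0.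
have lim0 : e b * K @[b --> +oo] --> (0:R).
  by rewrite -[X in _ --> X](mul0r K); apply: cvgM; [apply: expRN_cvg_cube; rewrite divr_gt0|exact: cvg_cst].
have : normc ((e a)%:C * F a) <= 0.
  rewrite -(cvg_lim _ lim0)//; apply: limr_ge; first by apply/cvg_ex; exists 0.
  near=> b.
  have ab : a <= b by near: b; apply: nbhs_pinfty_ge; rewrite num_real.
  have b1 : 1 <= b by near: b; apply: nbhs_pinfty_ge; rewrite num_real.
  rewrite (const b ab) Normc.normcM normcR gtr0_norm//.
  by apply: ler_wpM2l; [exact: ltW|exact: FK].
rewrite Normc.normcM normcR gtr0_norm// pmulr_rle0// => h.
apply: Normc.eq0_normc; apply/eqP; rewrite eq_le h; exact: normc_ge0.
Unshelve. all: end_near. Qed.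

Lemma umb_moment_bounded m n : exists K : R, forall a, 1 <= a -> normc (umb_moment a%:C 0 0 m n) <= K.
Proof.
have c0 : 0 < 2^-1 :> R by rewrite invr_gt0.
have [K _ hK] := @umb_term_bound R 2^-1 0 m n c0.
exists (2 * Rintegral mu2 setT (fun p => K * expR (- (2^-1 * (p.1 ^+ 2 + p.2 ^+ 2))))) => a a1.
apply: normc_cintegral_le.
- exact: cmeasurable_umb_term.
- exact: integrable_scale (integrable_gaussian2 c0).
- by move=> p; apply: hK; rewrite ?normcR ?normr0//= divff.
Qed.

Let L i := umb_vec (fun u : R => u%:C) (fun=> 0) (fun=> 0) i.

Lemma umb_vec_real_deriv a i : 0 < a -> (i < 4)%N ->
  cderiv (L i) a (umb_field a%:C 0 0 1 0 0 (fun j => L j a) i).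
Proof.
move=> a0 i4.
have := @umb_vec_solution R (fun u => u%:C) (fun=> 0) (fun=> 0) (fun=> 1) (fun=> 0) (fun=> 0)
  (fun=> 0) (fun=> 0) (fun=> 0) a (fun u => cderiv_id u) (fun u => cderiv_cst 0 u)
  (fun u => cderiv_cst 0 u) (fun u => cderiv_cst 1 u) (fun u => cderiv_cst 0 u) (fun u => cderiv_cst 0 u) a0.
exact.
Qed.

Lemma sqr_umb_kappa : (umb_kappa : R[i]) * umb_kappa = - (4 / 9).
Proof.
rewrite /umb_kappa; have i2 : 'i * 'i = -1 :> R[i] by rewrite -expr2 sqrCi.
by transitivity ('i * 'i * (4 / 9) : R[i]); [field|rewrite i2 mulN1r].
Qed.

Lemma realC_neq0 (u : R) : 0 < u -> u%:C != 0 :> R[i].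
Proof. by move=> u0; rewrite fmorph_eq0 gt_eqF. Qed.

Lemma realC_49 (a : R) : ((4 / 9 * a ^+ 2)%:C : R[i]) = 4 / 9 * a%:C ^+ 2.
Proof. by rewrite rmorphM rmorphXn fmorph_div !rmorph_nat. Qed.

(** At X = Y = 0 each of these moments decouples into F' = (4/9) a^2 F and is bounded. Their
    vanishing reflects the threefold symmetry of the phase, here obtained without a rotation of the
    plane. *)
Lemma umb_moment_real_odd a : 0 < a ->
  umb_moment a%:C 0 0 1 0 = 0 /\ umb_moment a%:C 0 0 0 1 = 0.
Proof.
move=> a0; split.
  apply: (exp_growth_bounded_zero (F := L 1)) a0; last exact: umb_moment_bounded.
  move=> u u0; apply: (cderiv_transport (umb_vec_real_deriv (i := 1) u0 isT)).
  rewrite /umb_field realC_49; cbv beta iota zeta; rewrite !(mulr0, mul0r, addr0, subr0).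
  transitivity (- (umb_kappa * umb_kappa) * u%:C ^+ 2 * L 1 u); first by ring.
  by rewrite sqr_umb_kappa opprK.
apply: (exp_growth_bounded_zero (F := L 2)) a0; last exact: umb_moment_bounded.
move=> u u0; apply: (cderiv_transport (umb_vec_real_deriv (i := 2) u0 isT)).
rewrite /umb_field realC_49; cbv beta iota zeta; rewrite !(mulr0, mul0r, addr0, subr0).
transitivity (- (umb_kappa * umb_kappa) * u%:C ^+ 2 * L 2 u); first by ring.
by rewrite sqr_umb_kappa opprK.
Qed.

Lemma umb_vec_real0 a : 0 < a -> cderiv (L 0) a (- L 3 a).
Proof.
move=> u0; apply: (cderiv_transport (umb_vec_real_deriv (i := 0) u0 isT)).
by rewrite /umb_field; cbv beta iota zeta; rewrite !(mulr0, mul0r, addr0, subr0) mul1r.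
Qed.

Lemma umb_vec_real3 a : 0 < a -> cderiv (L 3) a (4 / 9 * a%:C * (a%:C * L 3 a - L 0 a)).
Proof.
move=> u0; apply: (cderiv_transport (umb_vec_real_deriv (i := 3) u0 isT)).
rewrite /umb_field; cbv beta iota zeta; rewrite !(mulr0, mul0r, addr0, subr0).
transitivity (- (umb_kappa * umb_kappa) * a%:C * (a%:C * L 3 a - L 0 a)); first by ring.
by rewrite sqr_umb_kappa opprK.
Qed.

(** The system for entries 0 and 3 has trace (4/9) a^2, so the Wronskian of two solutions is a
    multiple of exp (4 a^3 / 27). For two bounded solutions it vanishes, and they are
    proportional. *)
Lemma umb_moment_wronskian a : 0 < a ->
  L 0 a * (sextic_slope a)%:C = L 3 a * (sextic_moment 0 a)%:C.
Proof.
move=> a0; apply/eqP; rewrite -subr_eq0; apply/eqP.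
apply: (exp_growth_bounded_zero (F := fun a => L 0 a * (sextic_slope a)%:C - L 3 a * (sextic_moment 0 a)%:C)) a0.
  move=> u u0.
  have h := cderivB (cderivM (umb_vec_real0 u0) (cderiv_real (is_derive_sextic_slope u)))
    (cderivM (umb_vec_real3 u0) (cderiv_real (is_derive_sextic0 u))).
  apply: (cderiv_transport h).
  rewrite realC_49 !rmorphM rmorphB rmorphN rmorphM fmorphV !rmorph_nat.
  by field.
have [K0 h0] := umb_moment_bounded 0 0; have [K3 h3] := umb_moment_bounded 1 1.
have [K hK] := @sextic_bounded R; exists (K0 * K + K3 * K) => u u1.
have [b1 b2] := hK u u1.
rewrite (le_trans (le_normcB _ _))// !Normc.normcM !normcR lerD// ler_pM ?normc_ge0//.
  exact: h0.
exact: h3.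
Qed.

Lemma umb_moment_real a : 0 < a ->
  umb_moment a%:C 0 0 0 0 = (Num.sqrt pi * sextic_moment 0 a)%:C /\
  umb_moment a%:C 0 0 1 1 = (Num.sqrt pi * sextic_slope a)%:C.
Proof.
move=> a0; have D0 u : (sextic_moment 0 u)%:C != 0 :> R[i].
  exact: realC_neq0 (sextic_moment_gt0 u).
(* The ratio of the two solutions, constant by the vanishing Wronskian. After multiplication by a
   their limits at infinity are pi and sqrt pi, which makes the constant sqrt pi. *)
pose Q u := L 0 u * ((sextic_moment 0 u)^-1)%:C.
have dQ u : 0 < u -> cderiv Q u 0.
  move=> u0; have Du := sextic_moment_gt0 u.
  have di := is_deriveV (lt0r_neq0 Du) (is_derive_sextic0 u).
  apply: (cderiv_transport (cderivM (umb_vec_real0 u0) (cderiv_real di))).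
  rewrite /GRing.scale /= !rmorphM !rmorphN !fmorphV rmorphXn /=.
  have w := umb_moment_wronskian u0; have D0u := D0 u.
  apply: (mulIf (x := (sextic_moment 0 u)%:C ^+ 2)); first by rewrite expf_neq0.
  rewrite mul0r; transitivity (L 0 u * (sextic_slope u)%:C - L 3 u * (sextic_moment 0 u)%:C); first by rewrite -[umb_moment _ _ _ 1 1]/(L 3 u) -[umb_moment _ _ _ 0 0]/(L 0 u); field.
  by rewrite w subrr.
have Qc u : a <= u -> Q a = Q u.
  by move=> au; apply: (cderiv0_eq au) => t /andP[/(lt_le_trans a0)/dQ].
have QL u : L 0 u = Q u * (sextic_moment 0 u)%:C.
  by rewrite /Q fmorphV; move: (D0 u) => D0u; field.
have lim1 : ccvg (fun u => u%:C * L 0 u) +oo pi%:C.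
  have h (f : R[i] -> R) : (forall w, `|f w| <= normc w) -> (forall w v, f (w - v) = f w - f v) ->
      f (u%:C * L 0 u) @[u --> +oo] --> f pi%:C.
    move=> fn fB; apply/cvgrPdist_le => e e0; near=> u.
    have u1 : 1 <= u by near: u; apply: nbhs_pinfty_ge; rewrite num_real.
    have uB : 80 * pi / e <= u by near: u; apply: nbhs_pinfty_ge; rewrite num_real.
    have u0 : 0 < u by exact: lt_le_trans u1.
    rewrite distrC -fB; apply: (le_trans (fn _)); apply: (le_trans (umb_moment_gaussian u1)).
    by rewrite ler_pdivrMr// -ler_pdivrMl// mulrC.
  by split; apply: h => [w|w v]; [exact: normr_Re_le|exact: ReB|exact: normr_Im_le|exact: ImB].
have lim2 : ccvg (fun u => u%:C * L 0 u) +oo (Q a * (Num.sqrt pi)%:C).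
  have h : ccvg (fun u => Q a * (u * sextic_moment 0 u)%:C) +oo (Q a * (Num.sqrt pi)%:C).
    by apply: ccvgM; [exact: ccvg_cst|exact: ccvg_real (@sextic_moment_asymp R)].
  have eqn : {near +oo, (fun u => Q a * (u * sextic_moment 0 u)%:C) =1 (fun u => u%:C * L 0 u)}.
    near=> u; have au : a <= u by near: u; apply: nbhs_pinfty_ge; rewrite num_real.
    by rewrite QL -(Qc _ au) rmorphM; ring.
  case: h => h1 h2; split.
    apply: (cvg_trans _ h1); apply: near_eq_cvg; near=> u; congr Re; near: u; exact: eqn.
  apply: (cvg_trans _ h2); apply: near_eq_cvg; near=> u; congr Im; near: u; exact: eqn.
have sp : 0 < Num.sqrt pi :> R by rewrite sqrtr_gt0 pi_gt0.
have Qa : Q a = (Num.sqrt pi)%:C.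
  have h := ccvg_unique lim2 lim1.
  have s0 := realC_neq0 sp.
  by apply: (mulIf s0); rewrite h -rmorphM -expr2 sqr_sqrtr// pi_ge0.
have e0 : L 0 a = (Num.sqrt pi * sextic_moment 0 a)%:C by rewrite QL Qa rmorphM.
split => //.
apply: (mulIf (D0 a)); rewrite -[LHS]/(L 3 a * _) -umb_moment_wronskian// e0 -!rmorphM.
by congr _%:C; ring.
Unshelve. all: end_near. Qed.

End RealMoments.

(** * Comparison of the two sides *)

Section GaussIntContinuity.
Context {R : realType}.
Local Notation mu := (@lebesgue_measure R).
Implicit Types (V W s : R[i]) (U : R[i] -> R[i]).

Lemma cderiv_bound_diff (F F' : R -> R[i]) (B : R) : (forall u, cderiv F u (F' u)) ->
  (forall u, 0 <= u <= 1 -> normc (F' u) <= B) -> normc (F 1 - F 0) <= 2 * B.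
Proof.
move=> dF FB; apply: (le_trans (normc_le_ReIm _)); rewrite ReB ImB mulr2n mulrDl mul1r.
have dR u := (dF u).1; have dI u := (dF u).2.
apply: lerD.
  have [c c01 ->] := MVT_segment ler01 (fun u _ => dR u) (is_derive_within (fun u _ => dR u)).
  by rewrite subr0 mulr1 (le_trans (normr_Re_le _))// FB//; move: c01; rewrite in_itv.
have [c c01 ->] := MVT_segment ler01 (fun u _ => dI u) (is_derive_within (fun u _ => dI u)).
by rewrite subr0 mulr1 (le_trans (normr_Im_le _))// FB//; move: c01; rewrite in_itv.
Qed.

Lemma normc_segment (V0 V1 : R[i]) (M u : R) : normc V0 <= M -> normc V1 <= M -> 0 <= u <= 1 ->
  normc (V0 + u%:C * (V1 - V0)) <= M.
Proof.
move=> h0 h1 /andP[u0 u1].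
rewrite (_ : V0 + _ = (1 - u)%:C * V0 + u%:C * V1); last by rewrite rmorphB rmorph1; ring.
rewrite (le_trans (le_normcD _ _))// !Normc.normcM !normcR !ger0_norm ?subr_ge0//.
have := ler_wpM2l u0 h1; have u1' : 0 <= 1 - u by rewrite subr_ge0.
have := ler_wpM2l u1' h0; lra.
Qed.

(** The two parameter points are joined by a segment, which stays in the ball of radius M; there
    [gauss_term_bound] controls every term of the derivative given by [cderiv_gauss_int]. *)
Lemma gauss_int_lipschitz U1 U1' U1'' U2 U2' U2'' (M : R) : 0 <= M ->
  cdiff U1 U1' -> cdiff U2 U2' -> cdiff U1' U1'' -> cdiff U2' U2'' ->
  subgaussian U1 -> subgaussian U2 -> subgaussian U1' -> subgaussian U2' ->
  exists2 K : R, 0 <= K & forall V0 W0 s0 s0' V1 W1 s1 s1',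
  [/\ normc V0 <= M, normc W0 <= M, normc s0 <= M & normc s0' <= M] ->
  [/\ normc V1 <= M, normc W1 <= M, normc s1 <= M & normc s1' <= M] ->
  normc (gauss_int U1 U2 V1 W1 s1 s1' - gauss_int U1 U2 V0 W0 s0 s0') <=
    K * (normc (V1 - V0) + normc (W1 - W0) + (normc (s1 - s0) + normc (s1' - s0'))).
Proof.
move=> M0 d1 d2 e1 e2 g1 g2 g1' g2'.
have [K1 K10 h1] := gauss_term_bound M0 g1' g2.
have [K2 K20 h2] := gauss_term_bound M0 g1 g2'.
have c0 : (0:R) < 1 / 2 by rewrite divr_gt0.
have ig := integrable_gaussian c0.
pose I := Rintegral mu setT (fun t => expR (- (1 / 2 * t ^+ 2))).
have I0 : 0 <= I by apply: Rintegral_ge0 => t _; exact: expR_ge0.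
exists (2 * (2 * ((K1 + K2) * I))); first by rewrite !mulr_ge0// addr_ge0.
move=> V0 W0 s0 s0' V1 W1 s1 s1' [hV0 hW0 hs0 hs0'] [hV1 hW1 hs1 hs1'].
pose P (a b : R[i]) (u : R) := a + u%:C * (b - a).
have dP a b u : cderiv (P a b) u (b - a) by exact: cderiv_affine.
have cst w u : cderiv (fun=> w : R[i]) u 0 by exact: cderiv_cst.
have d u := cderiv_gauss_int d1 d2 e1 e2 g1 g2 g1' g2' (dP V0 V1) (dP W0 W1) (dP s0 s1) (dP s0' s1')
  (cst _ u) (cst _ u) (cst _ u) (cst _ u).
have P1 a b : P a b 1 = b by rewrite /P mul1r addrC subrK.
have P0 a b : P a b 0 = a by rewrite /P mul0r addr0.
pose S := normc (V1 - V0) + normc (W1 - W0) + (normc (s1 - s0) + normc (s1' - s0')).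
have hb := @cderiv_bound_diff _ _ (2 * ((K1 + K2) * I) * S) d.
rewrite /= !P1 !P0 in hb; rewrite -[leRHS]mulrA; apply: hb => u u01.
have [bV bW bs bs'] : [/\ normc (P V0 V1 u) <= M, normc (P W0 W1 u) <= M,
   normc (P s0 s1 u) <= M & normc (P s0' s1' u) <= M] by split; exact: normc_segment.
have K12 : K1 <= K1 + K2 /\ K2 <= K1 + K2 by rewrite lerDl lerDr.
have b (f : R -> R[i]) (K : R) : cmeasurable f -> K <= K1 + K2 ->
    (forall t, normc (f t) <= K * expR (- (1 / 2 * t ^+ 2))) ->
    normc (cintegral mu setT f) <= 2 * ((K1 + K2) * I).
  move=> mf KK hf; have h := @normc_cintegral_le _ _ _ mu f _ mf (integrable_scale K measurableT ig) hf.
  apply: (le_trans h).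
  by rewrite RintegralZl// ler_wpM2l// ler_wpM2r.
have B1 : normc (gauss_int U1' U2 (P V0 V1 u) (P W0 W1 u) (P s0 s1 u) (P s0' s1' u)) <= 2 * ((K1 + K2) * I).
  apply: (b _ K1) => [||t]; [exact: cmeasurable_gauss_term e1 d2|exact: K12.1|].
  by have [] := h1 _ _ _ _ bV bW bs bs' t.
have B2 : normc (gauss_int U1 U2' (P V0 V1 u) (P W0 W1 u) (P s0 s1 u) (P s0' s1' u)) <= 2 * ((K1 + K2) * I).
  apply: (b _ K2) => [||t]; [exact: cmeasurable_gauss_term d1 e2|exact: K12.2|].
  by have [] := h2 _ _ _ _ bV bW bs bs' t.
have B3 : normc (cintegral mu setT (fun t => t%:C * gauss_term U1' U2 (P V0 V1 u) (P W0 W1 u) (P s0 s1 u) (P s0' s1' u) t)) <= 2 * ((K1 + K2) * I).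
  apply: (b _ K1) => [||t]; [exact: cmeasurable_tgauss_term e1 d2|exact: K12.1|].
  by have [] := h1 _ _ _ _ bV bW bs bs' t.
have B4 : normc (cintegral mu setT (fun t => t%:C * gauss_term U1 U2' (P V0 V1 u) (P W0 W1 u) (P s0 s1 u) (P s0' s1' u) t)) <= 2 * ((K1 + K2) * I).
  apply: (b _ K2) => [||t]; [exact: cmeasurable_tgauss_term d1 e2|exact: K12.2|].
  by have [] := h2 _ _ _ _ bV bW bs bs' t.
rewrite /S [leRHS]mulrDr !mulrDr.
rewrite (le_trans (le_normcD _ _))// lerD// (le_trans (le_normcD _ _))// lerD// Normc.normcM mulrC;
  by rewrite ler_wpM2r// normc_ge0.
Qed.

Lemma ccvg_normc (T : Type) (fl : set_system T) {FF : Filter fl} (F : T -> R[i]) w :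
  ccvg F fl w -> normc (F t - w) @[t --> fl] --> (0:R).
Proof.
move=> [hr hi].
have h : `|Re (F t) - Re w| + `|Im (F t) - Im w| @[t --> fl] --> (0:R).
  rewrite -[X in _ --> X](addr0 0); by apply: cvgD; apply/norm_cvg0P/subr_cvg0.
apply: (squeeze_cvgr _ (cvg_cst 0) h).
by apply: nearW => t; rewrite normc_ge0 /= -ReB -ImB normc_le_ReIm.
Qed.

Lemma gauss_int_ccvg U1 U1' U1'' U2 U2' U2'' (T : Type) (fl : set_system T) {FF : Filter fl}
   (V W s s' : T -> R[i]) V0 W0 s0 s0' :
  cdiff U1 U1' -> cdiff U2 U2' -> cdiff U1' U1'' -> cdiff U2' U2'' ->
  subgaussian U1 -> subgaussian U2 -> subgaussian U1' -> subgaussian U2' ->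
  ccvg V fl V0 -> ccvg W fl W0 -> ccvg s fl s0 -> ccvg s' fl s0' ->
  ccvg (fun t => gauss_int U1 U2 (V t) (W t) (s t) (s' t)) fl (gauss_int U1 U2 V0 W0 s0 s0').
Proof.
move=> d1 d2 e1 e2 g1 g2 g1' g2' cV cW cs cs'.
have nn := @normc_ge0 R.
pose M := normc V0 + normc W0 + normc s0 + normc s0' + 1.
have M0 : 0 <= M by rewrite !addr_ge0.
have [K K0 hK] := gauss_int_lipschitz M0 d1 d2 e1 e2 g1 g2 g1' g2'.
have [nV nW] := (ccvg_normc cV, ccvg_normc cW); have [ns ns'] := (ccvg_normc cs, ccvg_normc cs').
have lim : K * (normc (V t - V0) + normc (W t - W0) + (normc (s t - s0) + normc (s' t - s0')))
    @[t --> fl] --> (0:R).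
  rewrite -[X in _ --> X](mulr0 K); apply: cvgMl_tmp.
  rewrite -[X in _ --> X](addr0 0); apply: cvgD.
    by rewrite -[X in _ --> X](addr0 0); exact: cvgD.
  by rewrite -[X in _ --> X](addr0 0); exact: cvgD.
have near1 (F : T -> R[i]) w : normc (F t - w) @[t --> fl] --> (0:R) ->
    \forall t \near fl, normc (F t) <= normc w + 1.
  move=> h; have : \forall t \near fl, normc (F t - w) < 1 by apply: cvgr_lt h _ ltr01.
  apply: filterS => t h1; rewrite -[F t](subrK w) addrC (le_trans (le_normcD _ _))//.
  by rewrite lerD2l ltW.
have h : \forall t \near fl, normc (gauss_int U1 U2 (V t) (W t) (s t) (s' t) - gauss_int U1 U2 V0 W0 s0 s0') <=
    K * (normc (V t - V0) + normc (W t - W0) + (normc (s t - s0) + normc (s' t - s0'))).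
  near=> t; apply: hK; split.
  - by have := (nn V0, nn W0); have := (nn s0, nn s0'); rewrite /M => -[a b] [c d]; lra.
  - by have := (nn V0, nn W0); have := (nn s0, nn s0'); rewrite /M => -[a b] [c d]; lra.
  - by have := (nn V0, nn W0); have := (nn s0, nn s0'); rewrite /M => -[a b] [c d]; lra.
  - by have := (nn V0, nn W0); have := (nn s0, nn s0'); rewrite /M => -[a b] [c d]; lra.
  - have : normc (V t) <= normc V0 + 1 by near: t; exact: near1.
    by have := (nn V0, nn W0); have := (nn s0, nn s0'); rewrite /M => -[a b] [c d]; lra.
  - have : normc (W t) <= normc W0 + 1 by near: t; exact: near1.
    by have := (nn V0, nn W0); have := (nn s0, nn s0'); rewrite /M => -[a b] [c d]; lra.
  - have : normc (s t) <= normc s0 + 1 by near: t; exact: near1.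
    by have := (nn V0, nn W0); have := (nn s0, nn s0'); rewrite /M => -[a b] [c d]; lra.
  - have : normc (s' t) <= normc s0' + 1 by near: t; exact: near1.
    by have := (nn V0, nn W0); have := (nn s0, nn s0'); rewrite /M => -[a b] [c d]; lra.
have sq (f : R[i] -> R) : (forall w, `|f w| <= normc w) -> (forall w v, f (w - v) = f w - f v) ->
    f (gauss_int U1 U2 (V t) (W t) (s t) (s' t)) @[t --> fl] --> f (gauss_int U1 U2 V0 W0 s0 s0').
  move=> fn fB; apply/subr_cvg0/norm_cvg0P; apply: (squeeze_cvgr _ (cvg_cst 0) lim).
  by near=> t; rewrite normr_ge0 /= -fB (le_trans (fn _))//; near: t.
by split; apply: sq => [w|w v]; [exact: normr_Re_le|exact: ReB|exact: normr_Im_le|exact: ImB].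
Unshelve. all: end_near. Qed.

End GaussIntContinuity.

(** * Identification of the moments with the Airy side *)

Section Connection.
Context {R : realType}.
Local Notation mu := (@lebesgue_measure R).
Implicit Types (u : R) (X Y p : R[i]).

Lemma umb_solution_comb (a X Y a' X' Y' : R -> R[i]) (l k : nat -> R -> R[i]) (c d : R[i]) u :
  umb_solution a X Y a' X' Y' l u -> umb_solution a X Y a' X' Y' k u ->
  umb_solution a X Y a' X' Y' (fun i u => c * l i u - d * k i u) u.
Proof.
move=> hl hk i i4; rewrite -umb_fieldB !umb_fieldZ.
by apply: cderivB; apply: cderivZ; [exact: hl|exact: hk].
Qed.

Lemma gauss_int_zero (U1 U2 : R[i] -> R[i]) :
  gauss_int U1 U2 0 0 0 0 = U1 0 * U2 0 * (Num.sqrt pi)%:C.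
Proof.
have ig : mu.-integrable setT (EFin \o (fun t => expR (- t ^+ 2))) by exact: integrableT_gauss.
have ci : cintegrable mu setT (fun t => (expR (- t ^+ 2))%:C).
  by apply/cintegrableP; split => //=; exact: integrable0.
transitivity (cintegral mu setT (fun t => U1 0 * U2 0 * (expR (- t ^+ 2))%:C)).
  by apply: cintegral_ext => t; rewrite /gauss_term mulr0 addr0 mulrC.
rewrite cintegralZ//; congr (_ * _).
rewrite /cintegral /= [X in _ +i* X](_ : _ = 0); last by rewrite /Rintegral integral0.
by rewrite /Rintegral integralT_gauss.
Qed.

(** At a = X = Y = 0 the Airy arguments no longer depend on t, so the integral is just sqrt pi; tau,
    and with it t0, disappears. *)
Lemma airy_vec_zero (U U' : R[i] -> R[i]) (k tau S S' : R[i]) :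
  [/\ airy_vec U U' k tau S S' 0 0 0 0 0 = U 0 * U 0 * (Num.sqrt pi)%:C,
      airy_vec U U' k tau S S' 0 0 0 0 1 = - (2 * 'i) * (k * (U' 0 * U 0 * (Num.sqrt pi)%:C)),
      airy_vec U U' k tau S S' 0 0 0 0 2 = - (2 * 'i) * (k * (U 0 * U' 0 * (Num.sqrt pi)%:C)) &
      airy_vec U U' k tau S S' 0 0 0 0 3 = - 4 * (k ^+ 2 * (U' 0 * U' 0 * (Num.sqrt pi)%:C))].
Proof.
have e0 t : airy_phase 0 0 0 t = 0 :> R[i] by rewrite /airy_phase expr0n /= !mul0r addr0.
have a0 t : airy_arg 0 0 t = 0 :> R[i] by rewrite /airy_arg expr0n /= !mul0r addr0.
have T i j : airy_moment U U' k tau S S' 0 0 0 0 i j =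
    k ^+ (i + j) * (airy_family U U' i 0 * airy_family U U' j 0 * (Num.sqrt pi)%:C).
  by rewrite /airy_moment !a0 mulr0 !mul0r /airy_int gauss_int_zero.
rewrite /airy_vec e0 cexp0 !T /= !(mul0r, expr0n) /=; split.
- by rewrite expr0 !mul1r.
- by rewrite !(sub0r, mul1r, expr1) mulrN mulNr.
- by rewrite !(sub0r, mul1r, expr1) mulrN mulNr.
- by rewrite !(subr0, sub0r, oppr0, add0r, mul1r).
Qed.

Lemma airy_vec_zero_even (U U' : R[i] -> R[i]) (k tau S S' : R[i]) : U 0 = 1 -> U' 0 = 0 ->
  [/\ airy_vec U U' k tau S S' 0 0 0 0 0 = (Num.sqrt pi)%:C, airy_vec U U' k tau S S' 0 0 0 0 1 = 0,
      airy_vec U U' k tau S S' 0 0 0 0 2 = 0 & airy_vec U U' k tau S S' 0 0 0 0 3 = 0].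
Proof.
move=> U0 U'0; have [-> -> -> ->] := airy_vec_zero U U' k tau S S'.
by rewrite U0 U'0; move: (Num.sqrt pi)%:C => s; split; ring.
Qed.

Lemma airy_vec_zero_odd (U U' : R[i] -> R[i]) (k tau S S' : R[i]) : U 0 = 0 -> U' 0 = 1 ->
  [/\ airy_vec U U' k tau S S' 0 0 0 0 0 = 0, airy_vec U U' k tau S S' 0 0 0 0 1 = 0,
      airy_vec U U' k tau S S' 0 0 0 0 2 = 0 &
      airy_vec U U' k tau S S' 0 0 0 0 3 = - (4 * k ^+ 2 * (Num.sqrt pi)%:C)].
Proof.
move=> U0 U'0; have [-> -> -> ->] := airy_vec_zero U U' k tau S S'.
by rewrite U0 U'0; move: (Num.sqrt pi)%:C => s; split; ring.
Qed.

Variables (f' g' : R[i] -> R[i]) (t0 : R).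
Hypothesis ff' : airy_pair (@airy_f R) f'.
Hypothesis gg' : airy_pair (@airy_g R) g'.
Hypothesis f0 : airy_f (0 : R[i]) = 1.
Hypothesis f'0 : f' 0 = 0.
Hypothesis g0 : airy_g (0 : R[i]) = 0.
Hypothesis g'0 : g' 0 = 1.

Definition umb_scale : R[i] := ((3 * gam R)^-1)%:C.
Definition umb_rot : R[i] := cexp (t0*i).
(** When b^2 = i z, the product of b, [umb_scale] and this number has the square of s, because 8 /
    (3 gam)^2 = 2 gam. *)
Definition umb_speed : R[i] := cexp (- (t0 / 2)*i) * (Num.sqrt 8)%:C.
Definition umb_speed' : R[i] := cexp ((t0 / 2)*i) * (Num.sqrt 8)%:C.
(* 2 pi times the constant of the theorem, with Ai and Bi expanded over the two
   Maclaurin series by Ai_Bi_symmetric. *)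
Definition umb_weight (c : R) : R := 2 * pi * Num.sqrt pi * Num.sqrt 3 * gam R * c ^+ 2.

Definition airy_side (a b X Y : R[i]) (i : nat) : R[i] :=
  (umb_weight (airy_c1 R))%:C * airy_vec (@airy_f R) f' umb_scale umb_rot umb_speed umb_speed' a b X Y i
  - (umb_weight (airy_c2 R))%:C * airy_vec (@airy_g R) g' umb_scale umb_rot umb_speed umb_speed' a b X Y i.

Lemma umb_scale3 : 12 * umb_scale ^+ 3 = 1.
Proof.
rewrite /umb_scale -rmorphXn -(rmorph_nat (real_complex R) 12) -rmorphM -(rmorph1 (real_complex R)).
congr _%:C; rewrite exprVn exprMn gam_cube; by field.
Qed.

Lemma umb_rot_neq0 : umb_rot != 0. Proof. exact: cexp_neq0. Qed.

Lemma sqrt8C : (Num.sqrt 8)%:C * (Num.sqrt 8)%:C = 8 :> R[i].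
Proof. by rewrite -rmorphM -expr2 sqr_sqrtr// rmorph_nat. Qed.

Lemma half_angle : (t0 / 2)*i + (t0 / 2)*i = t0*i :> R[i].
Proof. by apply: complexP; rewrite /= ?addr0//; field. Qed.

Lemma umb_rotV : umb_rot^-1 = cexp (- (t0*i)).
Proof. by apply: (mulfI umb_rot_neq0); rewrite mulfV ?umb_rot_neq0// cexpN. Qed.

Lemma umb_speed_ss : umb_speed * umb_speed = 8 * umb_rot^-1.
Proof. by rewrite mulrACA sqrt8C -cexpD -opprD half_angle umb_rotV mulrC. Qed.

Lemma umb_speed_ss' : umb_speed * umb_speed' = 8.
Proof. by rewrite mulrACA sqrt8C -cexpD addNr cexp0 mul1r. Qed.

Lemma umb_speed_s's' : umb_speed' * umb_speed' = 8 * umb_rot.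
Proof. by rewrite mulrACA sqrt8C -cexpD half_angle mulrC. Qed.

Lemma airy_side_solution (b0 b1 X1 Y1 : R[i]) u :
  umb_solution (path_a b0 b1) (path_X X1) (path_Y Y1) (path_a' b0 b1) (fun=> X1) (fun=> Y1)
  (fun i u => airy_side (path_a b0 b1 u) (path_b b0 b1 u) (path_X X1 u) (path_Y Y1 u) i) u.
Proof.
apply: umb_solution_comb; apply: airy_vec_solution => //;
  [exact: umb_scale3|exact: umb_rot_neq0|exact: umb_speed_ss|exact: umb_speed_ss'|exact: umb_speed_s's'
  |exact: umb_scale3|exact: umb_rot_neq0|exact: umb_speed_ss|exact: umb_speed_ss'|exact: umb_speed_s's'].
Qed.

(** Since f(0) = 1, f'(0) = 0 and g(0) = 0, g'(0) = 1, the f part contributes to entry 0 only and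
    the g part to entry 3 only: each Airy constant is fixed by one equation. *)
Lemma airy_side_zero : [/\ airy_side 0 0 0 0 0 = (Num.sqrt pi * sextic_moment 0 0)%:C,
  airy_side 0 0 0 0 1 = 0, airy_side 0 0 0 0 2 = 0 &
  airy_side 0 0 0 0 3 = (Num.sqrt pi * sextic_slope 0)%:C].
Proof.
have [e0 e1 e2 e3] := airy_vec_zero_even umb_scale umb_rot umb_speed umb_speed' f0 f'0.
have [h0 h1 h2 h3] := airy_vec_zero_odd umb_scale umb_rot umb_speed umb_speed' g0 g'0.
rewrite /airy_side e0 e1 e2 e3 h0 h1 h2 h3.
have z (a b c : R[i]) : a * 0 - b * 0 = 0 /\ a * c - b * 0 = a * c /\ a * 0 - b * - c = b * c.
  by rewrite !mulr0 subr0 subr0 sub0r mulrN opprK.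
have z1 a b c := (z a b c).1; have z2 a b c := (z a b c).2.1; have z3 a b c := (z a b c).2.2.
split.
- rewrite z2 -rmorphM sextic_moment_at0// /umb_weight airy_c1_value.
  by congr _%:C; ring.
- exact: z1.
- exact: z1.
- rewrite z3 sextic_slope_at0 -airy_c2_value /umb_weight /umb_scale.
  rewrite -rmorphXn -(rmorph_nat (real_complex R) 4) -!rmorphM.
  by congr _%:C; ring.
Qed.

Lemma path_real (b1 : R[i]) (beta : R) u : b1 * b1 = (beta ^+ 2)%:C ->
  path_a 0 b1 u = (u ^+ 2 * beta ^+ 2)%:C.
Proof.
move=> b1b; rewrite /path_a /path_b add0r exprMn [b1 ^+ 2]expr2 b1b -rmorphXn -rmorphM.
by [].
Qed.

(** The path b = u b1 starts at a = 0. The right limits of the moments there are read off their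
    expressions by [sextic_moment] and [sextic_slope], which are continuous at 0. *)
Lemma umb_airy_real (b1 : R[i]) (beta : R) : 0 < beta -> b1 * b1 = (beta ^+ 2)%:C ->
  forall i, (i < 4)%N -> umb_vec (fun=> (beta ^+ 2)%:C) (fun=> 0) (fun=> 0) i 1 =
    airy_side (beta ^+ 2)%:C b1 0 0 i.
Proof.
move=> beta0 b1b i i4.
have a_gt0 u : 0 < u <= 1 -> 0 < Re (path_a 0 b1 u).
  by move=> /andP[u0 _]; rewrite (path_real _ b1b) /= mulr_gt0 ?exprn_gt0.
have X0 u : path_X 0 u = 0 :> R[i] by rewrite /path_X mulr0.
have Y0 u : path_Y 0 u = 0 :> R[i] by rewrite /path_Y mulr0.
have h := @umb_solution_unique R (path_a 0 b1) (path_X 0) (path_Y 0) (path_a' 0 b1) (fun=> 0) (fun=> 0)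
  (fun=> 2 * b1 ^+ 2) (fun=> 0) (fun=> 0)
  (umb_vec (path_a 0 b1) (path_X 0) (path_Y 0))
  (fun i u => airy_side (path_a 0 b1 u) (path_b 0 b1 u) (path_X 0 u) (path_Y 0 u) i)
  (fun u => cderiv_path_a 0 b1 u) (fun u => cderiv_lin 0 u) (fun u => cderiv_lin 0 u)
  (fun u => cderiv_path_a' 0 b1 u) (fun u => cderiv_cst 0 u) (fun u => cderiv_cst 0 u).
have := h _ _ _ i i4; rewrite /= X0 Y0 /path_b add0r mul1r (path_real _ b1b) expr1n mul1r => <-.
- by case: i i4 => [|[|[|[|//]]]] _; rewrite /umb_vec (path_real _ b1b) expr1n mul1r X0 Y0.
- move=> u u01; apply: (@umb_vec_solution _ _ _ _ _ _ _ (fun=> 2 * b1 ^+ 2) (fun=> 0) (fun=> 0)) => //;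
    [exact: cderiv_path_a|exact: cderiv_lin|exact: cderiv_lin|exact: cderiv_path_a'|exact: cderiv_cst|exact: cderiv_cst|exact: a_gt0].
- by move=> u u01; exact: airy_side_solution.
have lim j : (j < 4)%N -> ccvg (fun u => airy_side (path_a 0 b1 u) (path_b 0 b1 u) (path_X 0 u) (path_Y 0 u) j) 0^'+
    (airy_side 0 0 0 0 j).
  move=> j4; have := cderiv_ccvg_right (airy_side_solution 0 b1 0 0 (0:R) j4).
  rewrite X0 Y0 (path_real _ b1b) expr0n /= mul0r.
  by rewrite /path_b !mul0r addr0.
have [z0 z1 z2 z3] := airy_side_zero.
have sq0 : (u ^+ 2 * beta ^+ 2) @[u --> 0^'+] --> (0 : R).
  rewrite -[X in _ --> X](mul0r (beta ^+ 2)); apply: cvgM; last exact: cvg_cst.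
  apply: cvg_at_right_filter; rewrite -[X in _ --> X](expr0n R 2); exact: exprn_continuous.
have real_lim (F : R -> R) (d : R) : is_derive (0:R) 1 F d ->
    ccvg (fun u => (Num.sqrt pi * F (u ^+ 2 * beta ^+ 2))%:C) 0^'+ (Num.sqrt pi * F 0)%:C.
  move=> dF; apply: ccvg_real; apply: cvgMl_tmp.
  apply: (@cvg_comp _ _ _ (fun u : R => u ^+ 2 * beta ^+ 2) F _ _ _ sq0).
  exact: derivable_for_continuous dF.
have real_vec u : 0 < u -> [/\ umb_vec (path_a 0 b1) (path_X 0) (path_Y 0) 0 u = (Num.sqrt pi * sextic_moment 0 (u ^+ 2 * beta ^+ 2))%:C,
    umb_vec (path_a 0 b1) (path_X 0) (path_Y 0) 1 u = 0, umb_vec (path_a 0 b1) (path_X 0) (path_Y 0) 2 u = 0 &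
    umb_vec (path_a 0 b1) (path_X 0) (path_Y 0) 3 u = (Num.sqrt pi * sextic_slope (u ^+ 2 * beta ^+ 2))%:C].
  move=> u0; have ub : 0 < u ^+ 2 * beta ^+ 2 by rewrite mulr_gt0 ?exprn_gt0.
  have [q0 q3] := umb_moment_real ub; have [q1 q2] := umb_moment_real_odd ub.
  by split; rewrite /umb_vec (path_real _ b1b) X0 Y0.
have tr (F G : R -> R[i]) w : (forall u : R, 0 < u -> G u = F u) -> ccvg F 0^'+ w -> ccvg G 0^'+ w.
  move=> FG [h1 h2]; split.
    apply: (cvg_trans _ h1); apply: near_eq_cvg; near=> u; rewrite FG//.
  apply: (cvg_trans _ h2); apply: near_eq_cvg; near=> u; rewrite FG//.
move=> j j4; suff : ccvg (fun u => umb_vec (path_a 0 b1) (path_X 0) (path_Y 0) j u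
  - airy_side (path_a 0 b1 u) (path_b 0 b1 u) (path_X 0 u) (path_Y 0 u) j) 0^'+
  (airy_side 0 0 0 0 j - airy_side 0 0 0 0 j) by rewrite subrr.
apply: ccvgB; last exact: lim.
case: j j4 => [|[|[|[|//]]]] _.
- by rewrite z0; apply: tr (real_lim _ _ (is_derive_sextic0 0)) => u /real_vec[].
- by rewrite z1; apply: tr (@ccvg_cst R _ 0^'+ _ 0) => u /real_vec[].
- by rewrite z2; apply: tr (@ccvg_cst R _ 0^'+ _ 0) => u /real_vec[].
- by rewrite z3; apply: tr (real_lim _ _ (is_derive_sextic_slope 0)) => u /real_vec[].
Unshelve. all: end_near. Qed.

(** The path runs from the real point Re p to p while X and Y grow from 0. Along it Re a = (Re p)^2
    - u^2 (Im p)^2 stays positive. The sign kap provides for both square roots of a. *)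
Lemma umb_airy (kap p X Y : R[i]) : kap * kap = 1 -> `|Im p| < Re p ->
  umb_moment (p ^+ 2) X Y 0 0 = airy_side (p ^+ 2) (kap * p) X Y 0.
Proof.
move=> kk pI; pose beta := Re p; have beta0 : 0 < beta by exact: le_lt_trans (normr_ge0 _) pI.
pose b0 := kap * beta%:C; pose b1 := kap * (p - beta%:C).
pose q u := beta%:C + u%:C * (p - beta%:C).
have bE u : path_b b0 b1 u = kap * q u by rewrite /path_b /b0 /b1 /q; ring.
have aE u : path_a b0 b1 u = q u ^+ 2.
  by rewrite /path_a bE exprMn [kap ^+ 2]expr2 kk mul1r.
have q1 : q 1 = p by rewrite /q mul1r addrC subrK.
have q0 : q 0 = beta%:C by rewrite /q mul0r addr0.
have a_gt0 u : 0 <= u <= 1 -> 0 < Re (path_a b0 b1 u).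
  move=> /andP[u0 u1]; rewrite aE expr2 ReM.
  have -> : Re (q u) = beta by rewrite /q /beta; case: (p) => pr pim /=; ring.
  have -> : Im (q u) = u * Im p by rewrite /q /beta; case: (p) => pr pim /=; ring.
  rewrite subr_gt0 -!expr2 exprMn.
  have h : Im p ^+ 2 < beta ^+ 2 by rewrite -real_normK ?num_real// ltrXn2r.
  have h2 : u ^+ 2 <= 1 by rewrite exprn_ile1.
  have := sqr_ge0 (Im p); have := sqr_ge0 u; nra.
have X0 (Z : R[i]) : path_X Z 0 = 0 by rewrite /path_X mul0r.
have X1 (Z : R[i]) : path_X Z 1 = Z by rewrite /path_X mul1r.
have Y0 (Z : R[i]) : path_Y Z 0 = 0 by rewrite /path_Y mul0r.
have Y1 (Z : R[i]) : path_Y Z 1 = Z by rewrite /path_Y mul1r.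
have sl u : 0 <= u <= 1 -> umb_solution (path_a b0 b1) (path_X X) (path_Y Y) (path_a' b0 b1) (fun=> X) (fun=> Y)
    (umb_vec (path_a b0 b1) (path_X X) (path_Y Y)) u.
  move=> u01; apply: (@umb_vec_solution _ _ _ _ _ _ _ (fun=> 2 * b1 ^+ 2) (fun=> 0) (fun=> 0)) => //;
    [exact: cderiv_path_a|exact: cderiv_lin|exact: cderiv_lin|exact: cderiv_path_a'|exact: cderiv_cst|exact: cderiv_cst|exact: a_gt0].
have h := @umb_solution_unique R (path_a b0 b1) (path_X X) (path_Y Y) (path_a' b0 b1) (fun=> X) (fun=> Y)
  (fun=> 2 * b1 ^+ 2) (fun=> 0) (fun=> 0)
  (umb_vec (path_a b0 b1) (path_X X) (path_Y Y))
  (fun i u => airy_side (path_a b0 b1 u) (path_b b0 b1 u) (path_X X u) (path_Y Y u) i)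
  (fun u => cderiv_path_a b0 b1 u) (fun u => cderiv_lin X u) (fun u => cderiv_lin Y u)
  (fun u => cderiv_path_a' b0 b1 u) (fun u => cderiv_cst X u) (fun u => cderiv_cst Y u).
have := h _ _ _ 0%N isT; rewrite /= aE bE q1 X1 Y1; apply.
- by move=> u /andP[u0 u1]; apply: sl; rewrite ltW.
- by move=> u _; exact: airy_side_solution.
- move=> j j4.
  have c1 := cderiv_ccvg_right (sl 0 _ _ j4).
  have c2 := cderiv_ccvg_right (airy_side_solution b0 b1 X Y (0:R) j4).
  have e : umb_vec (path_a b0 b1) (path_X X) (path_Y Y) j 0 =
      airy_side (path_a b0 b1 0) (path_b b0 b1 0) (path_X X 0) (path_Y Y 0) j.
    rewrite aE bE q0 X0 Y0 -rmorphXn /= -(@umb_airy_real (kap * beta%:C) beta)//; last first.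
      by rewrite mulrACA kk mul1r -rmorphM expr2.
    by case: j j4 {c1 c2} => [|[|[|[|//]]]] _; rewrite /umb_vec aE q0 X0 Y0 -rmorphXn.
  suff : ccvg (fun u => umb_vec (path_a b0 b1) (path_X X) (path_Y Y) j u -
      airy_side (path_a b0 b1 u) (path_b b0 b1 u) (path_X X u) (path_Y Y u) j) 0^'+
      (umb_vec (path_a b0 b1) (path_X X) (path_Y Y) j 0 -
       airy_side (path_a b0 b1 0) (path_b b0 b1 0) (path_X X 0) (path_Y Y 0) j).
    by rewrite e subrr.
  by apply: ccvgB => //; apply: c1; rewrite lexx ler01.
Qed.

End Connection.

(** * Removal of the convergence factor *)

Section Limit.
Context {R : realType}.
Local Notation mu := (@lebesgue_measure R).
Local Notation mu2 := (@lebesgue_measure R \x @lebesgue_measure R)%E.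
Implicit Types (x y z eps : R) (X Y : R[i]).

(** The value at 0 is 1, so that the square is always 1. *)
Definition root_sign z : R := if 0 <= z then 1 else -1.

(* The principal square root of eps + i z, for 0 <= eps. *)
Definition half_plane_root z eps : R[i] :=
  Num.sqrt ((Num.sqrt (eps ^+ 2 + z ^+ 2) + eps) / 2) +i*
  (root_sign z * Num.sqrt ((Num.sqrt (eps ^+ 2 + z ^+ 2) - eps) / 2)).

Lemma root_modulus z eps : 0 <= eps -> eps <= Num.sqrt (eps ^+ 2 + z ^+ 2).
Proof.
move=> e0; rewrite -[leLHS](ger0_norm e0) -sqrtr_sqr ler_sqrt ?lerDl ?sqr_ge0//.
by rewrite addr_ge0 ?sqr_ge0.
Qed.

Lemma half_plane_root_sqr z eps : 0 <= eps -> half_plane_root z eps ^+ 2 = eps +i* z.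
Proof.
move=> e0; have h := root_modulus z e0.
have r2 : Num.sqrt (eps ^+ 2 + z ^+ 2) ^+ 2 = eps ^+ 2 + z ^+ 2 by rewrite sqr_sqrtr// addr_ge0 ?sqr_ge0.
rewrite /half_plane_root; move: (Num.sqrt (eps ^+ 2 + z ^+ 2)) h r2 => rho h r2.
have p0 : 0 <= (rho + eps) / 2 by lra.
have m0 : 0 <= (rho - eps) / 2 by lra.
have sgz : root_sign z * `|z| = z /\ root_sign z ^+ 2 = 1.
  rewrite /root_sign; case: leP => z0; first by rewrite mul1r ger0_norm ?expr1n.
  by rewrite ltr0_norm// mulN1r opprK sqrrN expr1n.
apply: complexP; rewrite expr2 ?ReM ?ImM /=.
  rewrite -!expr2 exprMn sgz.2 mul1r !sqr_sqrtr//; by field.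
have pm : Num.sqrt ((rho + eps) / 2) * Num.sqrt ((rho - eps) / 2) = `|z| / 2.
  rewrite -sqrtrM// (_ : _ * _ = (z / 2) ^+ 2); last by rewrite exprMn exprVn; lra.
  by rewrite sqrtr_sqr normrM [`|2^-1|]ger0_norm.
rewrite mulrCA pm [X in _ + X]mulrAC -mulrA pm -[RHS]sgz.1; by field.
Qed.

(** For eps = 0 the root lies on the boundary |Im| = Re of the sector, where [umb_airy] no longer
    applies; hence the passage to the limit. *)
Lemma half_plane_root_sector z eps : 0 < eps -> `|Im (half_plane_root z eps)| < Re (half_plane_root z eps).
Proof.
move=> e0; have h := root_modulus z (ltW e0); rewrite /half_plane_root /= normrM.
have -> : `|root_sign z| = 1 by rewrite /root_sign; case: ifP => _; rewrite ?normrN normr1.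
rewrite mul1r ger0_norm ?sqrtr_ge0// ltr_sqrt; lra.
Qed.

Lemma half_plane_root_cvg z : ccvg (half_plane_root z) 0^'+ (half_plane_root z 0).
Proof.
have idc : (eps : R) @[eps --> (0:R)^'+] --> (0:R) by apply: cvg_at_right_filter; exact: cvg_id.
have sc (F : R -> R) (l : R) : F e @[e --> (0:R)^'+] --> l -> Num.sqrt (F e) @[e --> (0:R)^'+] --> Num.sqrt l.
  by move=> h; apply: (@cvg_comp _ _ _ F Num.sqrt _ _ _ h); exact: sqrt_continuous.
have rc : Num.sqrt (eps ^+ 2 + z ^+ 2) @[eps --> (0:R)^'+] --> Num.sqrt (0 ^+ 2 + z ^+ 2).
  apply: sc; apply: cvgD; last exact: cvg_cst.
  by apply: (@cvg_comp _ _ _ id (fun u : R => u ^+ 2) _ _ _ idc); exact: exprn_continuous.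
split.
  by apply: sc; apply: cvgM; [exact: cvgD|exact: cvg_cst].
by apply: cvgMl_tmp; apply: sc; apply: cvgM; [exact: cvgB|exact: cvg_cst].
Qed.

Lemma ccvg_cexp (T : Type) (fl : set_system T) {FF : Filter fl} (F : T -> R[i]) w :
  ccvg F fl w -> ccvg (fun t => cexp (F t)) fl (cexp w).
Proof.
move=> [hr hi]; split; apply: cvgM.
- by apply: (cvg_comp _ _ hr); exact: continuous_expR.
- by apply: (cvg_comp _ _ hi); exact: continuous_cos.
- by apply: (cvg_comp _ _ hr); exact: continuous_expR.
- by apply: (cvg_comp _ _ hi); exact: continuous_sin.
Qed.

Lemma umbilic_reg_moment x y z eps :
  umbilic_reg x y z eps = ((2 * pi)^-1)%:C * umb_moment (eps +i* z) (x +i* y) (x -i* y) 0 0.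
Proof.
rewrite /umbilic_reg /umb_moment; congr (_ * _); apply: cintegral_ext => p.
rewrite /umb_term !expr0 !mul1r -cexpR -cexpD; congr cexp.
have zz : zbar p * zvar p = (p.1 ^+ 2 + p.2 ^+ 2)%:C.
  by apply: complexP; rewrite ?ReM ?ImM /=; ring.
have z3 : zvar p ^+ 3 + zbar p ^+ 3 = (2 * (p.1 ^+ 3 - 3 * p.1 * p.2 ^+ 2))%:C.
  by rewrite !exprS expr0; apply: complexP; rewrite ?(ReD, ImD, ReM, ImM) /=; ring.
have xy : (x +i* y) * zbar p + (x -i* y) * zvar p = (2 * (x * p.1 + y * p.2))%:C.
  by apply: complexP; rewrite ?(ReD, ImD, ReM, ImM) /=; ring.
have -> : umb_phase (eps +i* z) (x +i* y) (x -i* y) p =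
    - ((eps +i* z) * (p.1 ^+ 2 + p.2 ^+ 2)%:C) - 'i * (x * p.1 + y * p.2)%:C
    + 'i * (p.1 ^+ 3 - 3 * p.1 * p.2 ^+ 2)%:C.
  rewrite /umb_phase zz z3 xy; congr (_ - _ + _).
    by rewrite rmorphM rmorph_nat; field.
  by rewrite rmorphM rmorph_nat; field.
by apply: complexP; rewrite ?(ReD, ImD, ReN, ImN, ReM, ImM) /=; ring.
Qed.

Variables (f' g' : R[i] -> R[i]) (t0 : R).
Hypothesis ff' : airy_pair (@airy_f R) f'.
Hypothesis gg' : airy_pair (@airy_g R) g'.

(** The weight exp (- t^2) does not involve a, so this side extends continuously to Re a = 0, where
    the plane integral loses its Gaussian factor. *)
Lemma airy_vec0_cvg (U U' : R[i] -> R[i]) (k tau S S' X Y a0 b0 : R[i]) (T : Type) (fl : set_system T)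
   {FF : Filter fl} (a b : T -> R[i]) : airy_pair U U' ->
  ccvg a fl a0 -> ccvg b fl b0 ->
  ccvg (fun t => airy_vec U U' k tau S S' (a t) (b t) X Y 0) fl (airy_vec U U' k tau S S' a0 b0 X Y 0).
Proof.
move=> UU' ca cb.
have c w : ccvg (fun=> w : R[i]) fl w by exact: ccvg_cst.
have cX n : ccvg (fun t => a t ^+ n) fl (a0 ^+ n).
  elim: n => [|n IH]; first by under eq_fun do rewrite expr0; rewrite expr0; exact: c.
  by under eq_fun do rewrite exprS; rewrite exprS; exact: ccvgM.
have d0 := airy_family_diff UU' (isT : (0 < 4)%N).
have d1 := airy_family_diff UU' (isT : (1 < 4)%N).
have s0 := airy_family_subgaussian UU' (isT : (0 < 4)%N).
have s1 := airy_family_subgaussian UU' (isT : (1 < 4)%N).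
have ca' Z w : ccvg (fun t => - k * airy_arg (a t) Z w) fl (- k * airy_arg a0 Z w).
  apply: (ccvgM (c _)); apply: (ccvgD (c _)); apply: ccvgM (c _).
  exact: ccvgM (cX _) (c _).
apply: ccvgM.
  apply: ccvg_cexp; apply: ccvgD; apply: ccvgM (c _); apply: ccvgM (c _) => //.
apply: (ccvgM (c _)); apply: (gauss_int_ccvg d0 d0 d1 d1 s0 s0 s1 s1) => //.
  by apply: ccvgM (c _); exact: ccvgM.
by apply: ccvgM (c _); exact: ccvgM.
Qed.

Lemma airy_side_cvg X Y (T : Type) (fl : set_system T) {FF : Filter fl} (a b : T -> R[i]) a0 b0 :
  ccvg a fl a0 -> ccvg b fl b0 ->
  ccvg (fun t => airy_side f' g' t0 (a t) (b t) X Y 0) fl (airy_side f' g' t0 a0 b0 X Y 0).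
Proof.
move=> ca cb; have c (w : R[i]) : ccvg (fun _ : T => w) fl w by exact: ccvg_cst.
by apply: ccvgB; apply: (ccvgM (c _)); apply: airy_vec0_cvg.
Qed.

End Limit.

(** * Matching of arguments, exponent and constants *)

Section Final.
Context {R : realType}.
Local Notation mu := (@lebesgue_measure R).
Implicit Types (x y z t : R) (X Y : R[i]).

Definition airy_weight (c : R) : R := 2 * Num.sqrt 3 * c ^+ 2.

Lemma symmetric_pairing (c d q a b a' b' : R[i]) :
  (c * a - d * a') * (q * (c * b + d * b')) + (c * b - d * b') * (q * (c * a + d * a')) =
  2 * q * c ^+ 2 * (a * b) - 2 * q * d ^+ 2 * (a' * b').
Proof. by ring. Qed.

Lemma airy_weightE (c : R) : (airy_weight c)%:C = 2 * (Num.sqrt 3)%:C * c%:C ^+ 2 :> R[i].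
Proof. by rewrite /airy_weight rmorphM rmorphXn rmorphM rmorph_nat. Qed.

Lemma Ai_Bi_symmetric (v w : R[i]) : Ai v * Bi w + Ai w * Bi v =
  (airy_weight (airy_c1 R))%:C * (airy_f v * airy_f w)
  - (airy_weight (airy_c2 R))%:C * (airy_g v * airy_g w).
Proof.
apply: (etrans (symmetric_pairing _ _ _ _ _ _ _)).
by congr (_ * _ - _ * _); symmetry; exact: airy_weightE.
Qed.

Lemma cintegral_linear2 (c d : R[i]) (e a b : R -> R[i]) (F : R -> R[i]) :
  (forall t, F t = e t * (c * a t - d * b t)) ->
  cintegrable mu setT (fun t => e t * a t) -> cintegrable mu setT (fun t => e t * b t) ->
  cintegrable mu setT F /\ cintegral mu setT F =
    c * cintegral mu setT (fun t => e t * a t) - d * cintegral mu setT (fun t => e t * b t).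
Proof.
move=> FE ia ib.
have -> : F = (fun t => c * (e t * a t) - d * (e t * b t)).
  by apply/funext => t; rewrite FE; ring.
split; first by apply: cintegrableB; exact: cintegrableZ.
by rewrite cintegralB ?cintegralZ//; exact: cintegrableZ.
Qed.

Lemma airy_integrand (f' g' : R[i] -> R[i]) (V W s s' : R[i]) :
  airy_pair (@airy_f R) f' -> airy_pair (@airy_g R) g' ->
  let F := fun t : R => (expR (- t ^+ 2))%:C *
    (Ai (V + t%:C * s) * Bi (W + t%:C * s') + Ai (W + t%:C * s') * Bi (V + t%:C * s)) in
  cintegrable mu setT F /\ cintegral mu setT F =
    (airy_weight (airy_c1 R))%:C * gauss_int (@airy_f R) (@airy_f R) V W s s'
    - (airy_weight (airy_c2 R))%:C * gauss_int (@airy_g R) (@airy_g R) V W s s'.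
Proof.
move=> [df _ sf _] [dg _ sg _] F.
have [i1 _] := cintegrable_gauss_term V W s s' df df sf sf.
have [i2 _] := cintegrable_gauss_term V W s s' dg dg sg sg.
apply: (@cintegral_linear2 _ _ (fun t => (expR (- t ^+ 2))%:C)
  (fun t => airy_f (V + t%:C * s) * airy_f (W + t%:C * s'))
  (fun t => airy_g (V + t%:C * s) * airy_g (W + t%:C * s')) F) => // t.
by congr (_ * _); exact: Ai_Bi_symmetric.
Qed.

Lemma cexp_im t : cexp (t*i) = cos t +i* sin t :> R[i].
Proof. by rewrite /cexp /= expR0 !mul1r. Qed.

Lemma cexp_imX t n : cexp (t*i) ^+ n = cos (t *+ n) +i* sin (t *+ n) :> R[i].
Proof.
rewrite cexpX -cexp_im; congr cexp; elim: n => [|n IH]; first by rewrite !mulr0n.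
by rewrite !mulrS IH; apply: complexP; rewrite /= ?addr0.
Qed.

Lemma cexp_imNX t n : cexp (- (t*i)) ^+ n = cos (t *+ n) -i* sin (t *+ n) :> R[i].
Proof.
have -> : - (t*i) = (- t)*i :> R[i] by apply: complexP; rewrite /= ?oppr0.
by rewrite cexp_imX mulNrn cosN sinN.
Qed.

(** For a = i z the shift in [airy_arg] is - z^2 / 3 (2 exp (i t0) + exp (- 2 i t0)) = - (x0 + i
    y0). As a^2 is real, conjugation exchanges X with Y and the rotation with its inverse. *)
Lemma arg_match x y z t0 (x0 := z ^+ 2 / 3 * (2 * cos t0 + cos (2 * t0)))
   (y0 := z ^+ 2 / 3 * (2 * sin t0 - sin (2 * t0))) :
  - (((x - x0) +i* (y - y0)) / (3 * gam R)%:C) =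
    - umb_scale * airy_arg (0 +i* z) (x +i* y) (umb_rot t0) /\
  conjc (- (((x - x0) +i* (y - y0)) / (3 * gam R)%:C)) =
    - umb_scale * airy_arg (0 +i* z) (x -i* y) (umb_rot t0)^-1.
Proof.
have dbl : t0 *+ 2 = 2 * t0 by rewrite mulr_natl.
have iz : (0 +i* z) ^+ 2 = (- z ^+ 2)%:C :> R[i].
  by rewrite expr2; apply: complexP; rewrite ?ReM ?ImM /=; ring.
have d3 (w : R[i]) : w / 3 = w * (3^-1)%:C by rewrite fmorphV rmorph_nat.
have A : airy_arg (0 +i* z) (x +i* y) (umb_rot t0) = (x - x0) +i* (y - y0).
  rewrite /airy_arg umb_rotV cexp_imNX dbl iz d3 /umb_rot cexp_im -(rmorph_nat (real_complex R) 2).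
  by apply: complexP; rewrite ?(ReD, ImD, ReM, ImM) /= /x0 /y0; field.
have B : airy_arg (0 +i* z) (x -i* y) (umb_rot t0)^-1 = (x - x0) -i* (y - y0).
  rewrite /airy_arg invrK umb_rotV /umb_rot cexp_imX dbl iz d3 -[cexp (- _)]expr1 cexp_imNX mulr1n -(rmorph_nat (real_complex R) 2).
  by apply: complexP; rewrite ?(ReD, ImD, ReM, ImM) /= /x0 /y0; field.
rewrite A B /umb_scale -fmorphV; split.
  by rewrite mulNr mulrC.
apply: complexP; rewrite ?(ReN, ImN) /= ?mulr0 ?mul0r ?oppr0 ?subr0 ?addr0; ring.
Qed.

Lemma airy_phaseE (a X Y t : R[i]) : airy_phase a X Y t =
  (6^-1)%:C * (a * (X * t^-1 + Y * t))
  + (27^-1)%:C * (a ^+ 3 * (3%:C + (2^-1)%:C * (t ^+ 3 + t^-1 ^+ 3))).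
Proof. by rewrite /airy_phase !fmorphV !rmorph_nat; move: (t^-1) => t'; field. Qed.

Lemma phase_match x y z t0 : airy_phase (0 +i* z) (x +i* y) (x -i* y) (umb_rot t0) =
  (z / 3 * (x * cos t0 + y * sin t0))*i - (z ^+ 3 / 27 * (3 + cos (3 * t0)))*i.
Proof.
have tpl : t0 *+ 3 = 3 * t0 by rewrite mulr_natl.
have iz : (0 +i* z) ^+ 3 = (- z ^+ 3)*i :> R[i].
  by rewrite !exprS expr0 mulr1; apply: complexP; rewrite ?ReM ?ImM /=; ring.
have h1 := cexp_im t0; have h3 := cexp_imX t0 3; have h3' := cexp_imNX t0 3.
have h1' : cexp (- (t0*i)) = cos t0 -i* sin t0 :> R[i] by have := cexp_imNX t0 1; rewrite expr1 mulr1n.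
rewrite airy_phaseE umb_rotV h3' /umb_rot h3 h1 h1' tpl iz.
by apply: complexP; rewrite ?(ReD, ImD, ReN, ImN, ReM, ImM) /=; field.
Qed.

Lemma weighted_difference (q w1 w2 E G1 G2 K a1 a2 : R[i]) : q * w1 = K * a1 -> q * w2 = K * a2 ->
  q * (w1 * (E * G1) - w2 * (E * G2)) = K * E * (a1 * G1 - a2 * G2).
Proof.
move=> h1 h2; transitivity (q * w1 * (E * G1) - q * w2 * (E * G2)); first by ring.
by rewrite h1 h2; ring.
Qed.

Lemma speed_scale_sqr : ((3 * gam R)^-1 * Num.sqrt 8) ^+ 2 = 2 * gam R.
Proof.
have g0 := @gam_gt0 R; have g3 := @gam_cube R.
rewrite exprMn sqr_sqrtr// (_ : 2 * gam R = 18 * gam R ^+ 3 / (9 * gam R ^+ 2)); last by field; exact: lt0r_neq0.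
by rewrite g3; field; exact: lt0r_neq0.
Qed.

End Final.

Theorem mainTheorem1 (R : realType) (x y z t0 : R) (r : R[i])
    (ht0 : 0 <= t0 < 2 * pi)
    (hr : r ^+ 2 = (2 * gam R * z)*i) :
  let x0 := z ^+ 2 / 3 * (2 * cos t0 + cos (2 * t0)) in
  let y0 := z ^+ 2 / 3 * (2 * sin t0 - sin (2 * t0)) in
  let V := - (((x - x0) +i* (y - y0)) / (3 * gam R)%:C) in
  let s := cexp (- (t0 / 2)*i) * r in
  let s' := cexp ((t0 / 2)*i) * r in
  let F := fun t : R =>
    (expR (- t ^+ 2))%:C *
    (Ai (V + t%:C * s) * Bi (conjc V + t%:C * s')
     + Ai (conjc V + t%:C * s') * Bi (V + t%:C * s)) in
  [/\ cintegrable (@lebesgue_measure R) setT F,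
      umbilic_cvg x y z
    & umbilic x y z =
        (gam R * Num.sqrt pi / 2)%:C
        * cexp ((z / 3 * (x * cos t0 + y * sin t0))*i
                - (z ^+ 3 / 27 * (3 + cos (3 * t0)))*i)
        * cintegral (@lebesgue_measure R) setT F].
Proof.
move=> x0 y0 V s s' F.
have [f' [g' [pf pg [f0 f'0] [g0 g'0]]]] := @airy_solutions R.
have [iF IF] := airy_integrand V (conjc V) s s' pf pg.
(* lam^2 = 2 gam, so r and lam times the boundary root are square roots of the same number. They
   differ by the sign kap, which is kept for every eps. *)
pose lam : R := (3 * gam R)^-1 * Num.sqrt 8.
have [kap [kk rE]] : exists kap : R[i], kap * kap = 1 /\ r = kap * half_plane_root z 0 * lam%:C.
  have : r ^+ 2 = (half_plane_root z 0 * lam%:C) ^+ 2.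
    rewrite hr exprMn half_plane_root_sqr// -rmorphXn /= speed_scale_sqr.
    by apply: complexP; rewrite ?ReM ?ImM /=; ring.
  move/eqP; rewrite eqf_sqr => /orP[] /eqP ->.
    by exists 1; rewrite !mul1r.
  by exists (-1); rewrite mulrNN mulr1 !mulN1r mulNr.
pose B := airy_side f' g' t0 (0 +i* z) (kap * half_plane_root z 0) (x +i* y) (x -i* y) 0.
have lim : ccvg (umbilic_reg x y z) 0^'+ (((2 * pi)^-1)%:C * B).
  have c (w : R[i]) : ccvg (fun _ : R => w) 0^'+ w by exact: ccvg_cst.
  have ca : ccvg (fun eps : R => eps +i* z) 0^'+ (0 +i* z).
    by split => /=; [apply: cvg_at_right_filter; exact: cvg_id|exact: cvg_cst].
  have h := ccvgM (c ((2 * pi)^-1)%:C) (airy_side_cvg t0 pf pg (x +i* y) (x -i* y) ca (ccvgM (c kap) (half_plane_root_cvg z))).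
  have e (eps : R) : 0 < eps -> umbilic_reg x y z eps = ((2 * pi)^-1)%:C *
      airy_side f' g' t0 (eps +i* z) (kap * half_plane_root z eps) (x +i* y) (x -i* y) 0.
    move=> e0; rewrite umbilic_reg_moment -(half_plane_root_sqr z (ltW e0)).
    by rewrite (umb_airy t0 pf pg f0 f'0 g0 g'0 _ _ kk (half_plane_root_sector z e0)).
  case: h => h1 h2; split.
    by apply: (cvg_trans _ h1); apply: near_eq_cvg; near=> eps; rewrite e.
  by apply: (cvg_trans _ h2); apply: near_eq_cvg; near=> eps; rewrite e.
split => //.
  by apply/cvg_ex; exists (((2 * pi)^-1)%:C * B); exact: ccvg_cvg.
rewrite /umbilic (ccvg_lim lim) IF /B /airy_side /airy_vec /airy_moment /airy_int /= expr0 !mul1r.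
have [<- <-] := arg_match x y z t0; rewrite phase_match -/x0 -/y0 -/V.
have sE : kap * half_plane_root z 0 * umb_scale * umb_speed t0 = s.
  by rewrite /s rE /umb_scale /umb_speed /lam rmorphM; ring.
have s'E : kap * half_plane_root z 0 * umb_scale * umb_speed' t0 = s'.
  by rewrite /s' rE /umb_scale /umb_speed' /lam rmorphM; ring.
rewrite sE s'E; set E := cexp _.
have w c : ((2 * pi)^-1)%:C * (umb_weight c)%:C = (gam R * Num.sqrt pi / 2)%:C * (airy_weight c)%:C :> R[i].
  rewrite -!rmorphM; congr _%:C; rewrite /umb_weight /airy_weight.
  by move: (pi_gt0 R); move: (@pi R) => P P0; field; exact: lt0r_neq0.
exact: weighted_difference.
Unshelve. all: end_near. Qed.
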